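(* Let $k$ be a difference field and $\bar{k}$ a separable closure of $k$, i.e. $\bar{k}$ is the separable algebraic closure of $\lfloor k\rfloor$ equipped with an extension of $\sigma_k$. Let $G=\pi_1(k,\bar{k})=\mathrm{Gal}[\bar{k}/k]$ be the absolute Galois group of $\lfloor k\rfloor$ equipped with the continuous endomorphism $()^\sigma$. Then the functor $$A\mapsto X(A)=(\lfloor k\rfloor\text{-}\mathbf{Alg}(\lfloor A\rfloor,\lfloor\bar{k}\rfloor),()^\sigma)$$ defines an anti-equivalence of categories between the category of difference locally étale $k$-algebras and the category $[G,\boldsymbol{\sigma}\text{-}\mathbf{Prof}]$ of difference profinite spaces equipped with a $G$-action. Moreover, under this correspondence: (1) a surjective map of $k$-algebras corresponds to an injective map of difference profinite spaces; (2) an injective map of $k$-algebras corresponds to a surjective map of difference profinite spaces; (3) the difference algebra $A$ is finitely $\boldsymbol{\sigma}$-generated if and only if $X(A)$ is a subshift; (4) the difference algebra $A$ is finitely $\boldsymbol{\sigma}$-presented if and only if $X(A)$ is a subshift of finite type.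
   Context: All rings are commutative and unital. A difference ring is a ring with an endomorphism $\sigma$; a difference field is a difference ring whose underlying ring is a field; $\lfloor R\rfloor$ denotes the underlying ring. A $k$-algebra is a difference ring $A$ with a morphism $k\to A$ of difference rings. $\boldsymbol{\sigma}\text{-}\mathbf{Prof}$ is the category of profinite spaces $X$ with a continuous self-map $\sigma_X$, with continuous maps commuting with the self-maps. A $k$-algebra $A$ is difference locally étale if every $a\in A$ satisfies a separable polynomial over $\lfloor k\rfloor$ (i.e. $\lfloor A\rfloor$ is ind-étale over $\lfloor k\rfloor$). It is finitely $\boldsymbol{\sigma}$-generated if there is a finite $B\subseteq A$ such that $B,\sigma_A(B),\sigma_A^2(B),\dots$ generate $\lfloor A\rfloor$ as a $\lfloor k\rfloor$-algebra. It is finitely $\boldsymbol{\sigma}$-presented if it is a quotient of a difference polynomial ring $k\{x_1,\dots,x_n\}=\lfloor k\rfloor[\sigma^i(x_j):i\ge0,1\le j\le n]$ by a difference ideal $I$ (an ideal with $\sigma(I)\subseteq I$) generated as an ideal by $B,\sigma(B),\sigma^2(B),\dots$ for some finite $B\subseteq I$. The endomorphism $()^\sigma$ of $\mathrm{Gal}(\lfloor\bar{k}\rfloor/\lfloor k\rfloor)$ is determined by $g\circ\sigma_{\bar{k}}=\sigma_{\bar{k}}\circ g^\sigma$; the continuous self-map $()^\sigma$ of $\lfloor k\rfloor\text{-}\mathbf{Alg}(\lfloor A\rfloor,\lfloor\bar{k}\rfloor)$ is determined by $\sigma_{\bar{k}}\circ h^\sigma=h\circ\sigma_A$. The latter set carries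 the profinite topology obtained by writing $\lfloor A\rfloor$ as a colimit of finite-dimensional $\lfloor k\rfloor$-algebras $A_\lambda$ and taking the limit of the finite sets $\lfloor k\rfloor\text{-}\mathbf{Alg}(A_\lambda,\lfloor\bar{k}\rfloor)$; $G$ acts on it by composition. An object of $[G,\boldsymbol{\sigma}\text{-}\mathbf{Prof}]$ is a difference profinite space $X$ with a continuous action of $\lfloor G\rfloor$ satisfying $\sigma_X(g.x)=\sigma_G(g).\sigma_X(x)$; morphisms are equivariant morphisms of $\boldsymbol{\sigma}\text{-}\mathbf{Prof}$. The full shift on a finite set $E_0$ is $E_0^{\mathbb{N}}$ with $\sigma(x_0,x_1,\dots)=(x_1,x_2,\dots)$. A subshift is a closed, $\sigma$-stable subset of a full shift. The subshift of finite type of a finite directed graph with vertex set $X_0$, edge set $E_0$ and source and target maps $s,t:E_0\to X_0$ is $\{(x_i)\in E_0^{\mathbb{N}}:s(x_{i+1})=t(x_i)\text{ for all }i\}$. Any object of $\boldsymbol{\sigma}\text{-}\mathbf{Prof}$ isomorphic to a subshift (resp. subshift of finite type) is also called a subshift (resp. subshift of finite type). *)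

(* Defs.v *)
From HB Require Import structures.
From mathcomp Require Import all_boot all_order all_algebra.
From mathcomp Require Import separable.
From mathcomp Require Import finmap.
From mathcomp Require Import boolp classical_sets functions cardinality topology.
From mathcomp Require monalg.

Set Implicit Arguments.
Unset Strict Implicit.
Unset Printing Implicit Defensive.

Import GRing.Theory.
Local Open Scope classical_set_scope.
Local Open Scope ring_scope.

Record category := Category {
  Ob :> Type;
  Hom : Ob -> Ob -> Type;
  cid1 : forall a, Hom a a;
  ccomp : forall a b c, Hom b c -> Hom a b -> Hom a c;
  ccomp1 : forall a b (f : Hom a b), ccomp f (cid1 a) = f;
  ccomp1l : forall a b (f : Hom a b), ccomp (cid1 b) f = f;
  ccompA : forall a b c d (h : Hom c d) (g : Hom b c) (f : Hom a b),
    ccomp h (ccomp g f) = ccomp (ccomp h g) f }.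

Definition opposite (C : category) : category :=
  @Category C (fun a b => Hom b a) (@cid1 C) (fun _ _ _ g f => ccomp f g)
    (fun _ _ f => ccomp1l f) (fun _ _ f => ccomp1 f)
    (fun _ _ _ _ h g f => esym (ccompA f g h)).

Definition isomorphic (C : category) (a b : C) : Prop :=
  exists (f : Hom a b) (g : Hom b a), ccomp g f = cid1 a /\ ccomp f g = cid1 b.

Record functor (C D : category) := Functor {
  fun_ob :> C -> D;
  fun_hom : forall a b, Hom a b -> Hom (fun_ob a) (fun_ob b);
  fun_hom1 : forall a, fun_hom (cid1 a) = cid1 (fun_ob a);
  fun_homM : forall a b c (g : Hom b c) (f : Hom a b),
    fun_hom (ccomp g f) = ccomp (fun_hom g) (fun_hom f) }.

Definition id_functor (C : category) : functor C C :=
  @Functor C C id (fun _ _ f => f) (fun _ => erefl) (fun _ _ _ _ _ => erefl).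

Section CompFunctor.
Variables (C D E : category) (G : functor D E) (F : functor C D).

Fact comp_fun_hom1 a :
  fun_hom G (fun_hom F (cid1 a)) = cid1 (G (F a)).
Proof. by rewrite !fun_hom1. Qed.

Fact comp_fun_homM a b c (g : Hom b c) (f : Hom a b) :
  fun_hom G (fun_hom F (ccomp g f)) =
  ccomp (fun_hom G (fun_hom F g)) (fun_hom G (fun_hom F f)).
Proof. by rewrite !fun_homM. Qed.

Definition comp_functor : functor C E := Functor comp_fun_hom1 comp_fun_homM.
End CompFunctor.

Record nat_iso (C D : category) (F G : functor C D) := NatIso {
  ni_map : forall a, Hom (F a) (G a);
  ni_inv : forall a, Hom (G a) (F a);
  ni_natural : forall a b (f : Hom a b),
    ccomp (fun_hom G f) (ni_map a) = ccomp (ni_map b) (fun_hom F f);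
  ni_mapK : forall a, ccomp (ni_inv a) (ni_map a) = cid1 (F a);
  ni_invK : forall a, ccomp (ni_map a) (ni_inv a) = cid1 (G a) }.

Definition is_equivalence (C D : category) (F : functor C D) : Prop :=
  exists G : functor D C,
    inhabited (nat_iso (comp_functor G F) (id_functor C)) /\
    inhabited (nat_iso (comp_functor F G) (id_functor D)).

Record diffField := DiffField {
  df_field :> fieldType;
  df_sigma : {rmorphism df_field -> df_field} }.

(* The underlying ring may be the zero ring. *)
Record diffAlg (k : diffField) := DiffAlg {
  da_ring :> comPzRingType;
  da_sigma : {rmorphism da_ring -> da_ring};
  da_struct : {rmorphism k -> da_ring};
  da_compat : forall c, da_sigma (da_struct c) = da_struct (df_sigma k c) }.

Lemma rmorphism_eq (A B : comPzRingType) (f g : {rmorphism A -> B}) :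
  f =1 g -> f = g.
Proof.
case: f g => f [[fa] [fm]] [g [[ga] [gm]]] /= /funext fg; subst g.
by rewrite (Prop_irrelevance fa ga) (Prop_irrelevance fm gm).
Qed.

Definition mk_rmorphism (A B : comPzRingType) (f : A -> B)
    (fB : zmod_morphism f) (fM : monoid_morphism f) : {rmorphism A -> B} :=
  HB.pack f (GRing.isZmodMorphism.Build A B f fB)
            (GRing.isMonoidMorphism.Build A B f fM).


Section AlgHom.
Variable k : diffField.
Implicit Types A B C : diffAlg k.

(* Morphisms of the underlying k-algebras: compatibility with the
   endomorphisms is not required. *)
Record algHom A B := AlgHom {
  alg_fun :> {rmorphism A -> B};
  alg_str : forall c, alg_fun (da_struct A c) = da_struct B c }.

Lemma algHom_eq A B (f g : algHom A B) : f =1 g -> f = g.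
Proof.
case: f g => f fs [g gs] /= /rmorphism_eq fg; subst g.
by rewrite (Prop_irrelevance fs gs).
Qed.

Definition mk_algHom A B (f : A -> B) (fB : zmod_morphism f)
    (fM : monoid_morphism f)
    (fs : forall c, f (da_struct A c) = da_struct B c) : algHom A B :=
  @AlgHom A B (mk_rmorphism fB fM) fs.

Fact alg_id_str A (c : k) : (idfun : {rmorphism A -> A}) (da_struct A c) = da_struct A c.
Proof. by []. Qed.
Definition alg_id A : algHom A A := AlgHom (@alg_id_str A).

Fact alg_comp_str A B C (g : algHom B C) (f : algHom A B) (c : k) :
  (g \o f : {rmorphism A -> C}) (da_struct A c) = da_struct C c.
Proof. by rewrite /= !alg_str. Qed.
Definition alg_comp A B C (g : algHom B C) (f : algHom A B) : algHom A C :=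
  AlgHom (alg_comp_str g f).

Lemma alg_compE A B C (g : algHom B C) (f : algHom A B) a :
  alg_comp g f a = g (f a).
Proof. by []. Qed.

Record dalgHom A B := DAlgHom {
  dalg_fun :> algHom A B;
  dalg_sigma : forall a, dalg_fun (da_sigma A a) = da_sigma B (dalg_fun a) }.

Lemma dalgHom_eq A B (f g : dalgHom A B) : f =1 g -> f = g.
Proof.
case: f g => f fs [g gs] /= /algHom_eq fg; subst g.
by rewrite (Prop_irrelevance fs gs).
Qed.

Fact dalg_id_sigma A a : alg_id A (da_sigma A a) = da_sigma A (alg_id A a).
Proof. by []. Qed.
Definition dalg_id A : dalgHom A A := DAlgHom (@dalg_id_sigma A).

Fact dalg_comp_sigma A B C (g : dalgHom B C) (f : dalgHom A B) a :
  alg_comp g f (da_sigma A a) = da_sigma C (alg_comp g f a).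
Proof. by rewrite !alg_compE !dalg_sigma. Qed.
Definition dalg_comp A B C (g : dalgHom B C) (f : dalgHom A B) : dalgHom A C :=
  DAlgHom (dalg_comp_sigma g f).

(* The library's evaluation p.[a] is only available in nonzero rings. *)
Definition alg_eval A (p : {poly k}) (a : A) : A :=
  \sum_(i < size p) da_struct A p`_i * a ^+ i.

Definition locally_etale A : Prop :=
  forall a : A, exists2 p : {poly k}, separable_poly p & alg_eval p a = 0.

Record letAlg := LetAlg {
  let_alg :> diffAlg k;
  let_etale : locally_etale let_alg }.

Fact let_comp1 (A B : letAlg) (f : dalgHom A B) : dalg_comp f (dalg_id A) = f.
Proof. exact: dalgHom_eq. Qed.
Fact let_comp1l (A B : letAlg) (f : dalgHom A B) : dalg_comp (dalg_id B) f = f.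
Proof. exact: dalgHom_eq. Qed.
Fact let_compA (A B C D : letAlg) (h : dalgHom C D) (g : dalgHom B C)
    (f : dalgHom A B) :
  dalg_comp h (dalg_comp g f) = dalg_comp (dalg_comp h g) f.
Proof. exact: dalgHom_eq. Qed.

Definition let_cat : category :=
  @Category letAlg (fun A B : letAlg => dalgHom A B) (fun A : letAlg => dalg_id A)
    (fun A B C : letAlg => @dalg_comp A B C) let_comp1 let_comp1l let_compA.

(* Closure under opposites follows from -1 being a scalar. *)
Definition subalgebra A (S : set A) : Prop :=
  [/\ forall c, S (da_struct A c),
      forall x y, S x -> S y -> S (x + y) &
      forall x y, S x -> S y -> S (x * y)].

Definition alg_span A (s : seq A) : set A :=
  [set a | exists c : nat -> k,
     a = \sum_(i < size s) da_struct A (c i) * s`_i].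

Section Span.
Variable A : diffAlg k.
Implicit Types (s : seq A) (x y : A) (P : set A).

Lemma alg_span0 s : alg_span s 0.
Proof.
by exists (fun=> 0); rewrite big1 // => i _; rewrite rmorph0 mul0r.
Qed.

Lemma alg_spanD s x y : alg_span s x -> alg_span s y -> alg_span s (x + y).
Proof.
move=> [c ->] [d ->]; exists (fun i => c i + d i).
by rewrite -big_split; apply: eq_bigr => i _; rewrite rmorphD mulrDl.
Qed.

Lemma alg_spanZ s c x : alg_span s x -> alg_span s (da_struct A c * x).
Proof.
move=> [d ->]; exists (fun i => c * d i).
by rewrite mulr_sumr; apply: eq_bigr => i _; rewrite rmorphM mulrA.
Qed.

Lemma alg_span_mem s x : x \in s -> alg_span s x.
Proof.
move=> xs; exists (fun i => (i == index x s)%:R).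
have xi : (index x s < size s)%N by rewrite index_mem.
rewrite (bigD1 (Ordinal xi)) //= eqxx rmorph1 mul1r nth_index // big1 ?addr0 //.
move=> i /negPf; rewrite -val_eqE /= => ->.
by rewrite rmorph0 mul0r.
Qed.

Lemma alg_span_min s P :
    P 0 -> (forall x y, P x -> P y -> P (x + y)) ->
    (forall c x, P x -> P (da_struct A c * x)) ->
    (forall x, x \in s -> P x) ->
  alg_span s `<=` P.
Proof.
move=> P0 PD PZ Ps _ [c ->]; apply: big_ind => // i _.
by apply/PZ/Ps/mem_nth.
Qed.

Lemma subalgebra_span s :
    alg_span s 1 -> (forall x y, x \in s -> y \in s -> alg_span s (x * y)) ->
  subalgebra (alg_span s).
Proof.
move=> s1 sM; split; [| exact: alg_spanD |].
  by move=> c; rewrite -[da_struct A c]mulr1; exact: alg_spanZ.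
have sM1 y : y \in s -> forall x, alg_span s x -> alg_span s (x * y).
  move=> ys; apply: alg_span_min; first by rewrite mul0r; exact: alg_span0.
  - by move=> x z; rewrite mulrDl; exact: alg_spanD.
  - by move=> c x; rewrite -mulrA; exact: alg_spanZ.
  - by move=> x xs; exact: sM.
move=> x y sx; move: y; apply: alg_span_min.
- by rewrite mulr0; exact: alg_span0.
- by move=> y z; rewrite mulrDr; exact: alg_spanD.
- by move=> c y; rewrite mulrCA; exact: alg_spanZ.
- by move=> y ys; exact: sM1.
Qed.

Lemma subalgebra_one : subalgebra (alg_span [:: 1 : A]).
Proof.
apply: subalgebra_span => [|x y]; first by apply: alg_span_mem; rewrite inE.
rewrite !inE => /eqP-> /eqP->; rewrite mulr1.
by apply: alg_span_mem; rewrite inE.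
Qed.

Section Compositum.
Variables s1 s2 : seq A.
Let s := [seq x * y | x <- s1, y <- s2].

Lemma alg_spanM x y : alg_span s1 x -> alg_span s2 y -> alg_span s (x * y).
Proof.
move=> + s2y; move: x; apply: alg_span_min.
- by rewrite mul0r; exact: alg_span0.
- by move=> x z; rewrite mulrDl; exact: alg_spanD.
- by move=> c x; rewrite -mulrA; exact: alg_spanZ.
move=> x xs; move: y s2y; apply: alg_span_min.
- by rewrite mulr0; exact: alg_span0.
- by move=> y z; rewrite mulrDr; exact: alg_spanD.
- by move=> c y; rewrite mulrCA; exact: alg_spanZ.
by move=> y ys; apply/alg_span_mem/allpairs_f.
Qed.

Hypotheses (S1 : subalgebra (alg_span s1)) (S2 : subalgebra (alg_span s2)).

Lemma alg_span1 (t : seq A) : subalgebra (alg_span t) -> alg_span t 1.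
Proof. by case=> /(_ 1) + _ _; rewrite rmorph1. Qed.

Lemma compositum_subalgebra : subalgebra (alg_span s).
Proof.
apply: subalgebra_span => [|x y].
  by rewrite -[1]mulr1; apply: alg_spanM; exact: alg_span1.
case/allpairsP=> -[x1 x2] [/= x1s x2s ->] /allpairsP[[y1 y2] [/= y1s y2s ->]].
case: S1 S2 => _ _ M1 [_ _ M2].
by rewrite mulrACA; apply: alg_spanM; [apply: M1|apply: M2]; exact: alg_span_mem.
Qed.

Lemma compositum_subl : alg_span s1 `<=` alg_span s.
Proof. by move=> x ?; rewrite -[x]mulr1; apply/alg_spanM/alg_span1. Qed.

Lemma compositum_subr : alg_span s2 `<=` alg_span s.
Proof. by move=> x ?; rewrite -[x]mul1r; apply/alg_spanM => //; exact/alg_span1. Qed.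

End Compositum.
End Span.

Section ImageSpan.
Variables (A B : diffAlg k) (f : {rmorphism A -> B}) (t : k -> k).
Hypothesis ft : forall c, f (da_struct A c) = da_struct B (t c).

Lemma alg_span_image (s : seq A) x :
  alg_span s x -> alg_span [seq f y | y <- s] (f x).
Proof.
move: x; apply: alg_span_min.
- by rewrite rmorph0; exact: alg_span0.
- by move=> x y; rewrite rmorphD; exact: alg_spanD.
- by move=> c x; rewrite rmorphM ft; exact: alg_spanZ.
by move=> x xs; apply/alg_span_mem/map_f.
Qed.

Lemma image_subalgebra (s : seq A) :
  subalgebra (alg_span s) -> subalgebra (alg_span [seq f y | y <- s]).
Proof.
move=> Ss; apply: subalgebra_span.
  by rewrite -(rmorph1 f); apply/alg_span_image/alg_span1.
move=> _ _ /mapP[x xs ->] /mapP[y ys ->]; rewrite -rmorphM.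
by apply: alg_span_image; case: Ss => _ _; apply; exact: alg_span_mem.
Qed.
End ImageSpan.

(* The limit of the discrete sets of homomorphisms on the finite-dimensional
   subalgebras of A. *)
Definition alg_open A B (U : set (algHom A B)) : Prop :=
  forall h, U h -> exists s : seq A, subalgebra (alg_span s) /\
    forall h' : algHom A B, (forall a, alg_span s a -> h' a = h a) -> U h'.

Fact alg_openT A B : alg_open [set: algHom A B].
Proof. by move=> h _; exists [:: 1]; split=> //; exact: subalgebra_one. Qed.

Fact alg_openI A B : setI_closed (@alg_open A B).
Proof.
move=> U V oU oV h [/oU[s [Ss sU]] /oV[t [St tV]]].
exists [seq x * y | x <- s, y <- t]; split; first exact: compositum_subalgebra.
move=> h' h'E; split; [apply: sU|apply: tV] => a sa; apply: h'E.
- exact: compositum_subl.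
- exact: compositum_subr.
Qed.

Fact alg_open_bigU A B (I : Type) (U : I -> set (algHom A B)) :
  (forall i, alg_open (U i)) -> alg_open (\bigcup_i U i).
Proof.
move=> oU h [i _ /oU[s [Ss sU]]]; exists s; split=> // h' /sU ?.
by exists i.
Qed.

HB.instance Definition _ A B := gen_eqMixin (algHom A B).
HB.instance Definition _ A B := gen_choiceMixin (algHom A B).
HB.instance Definition _ A B := isOpenTopological.Build (algHom A B)
  (@alg_openT A B) (@alg_openI A B) (@alg_open_bigU A B).

Lemma alg_openE A B (U : set (algHom A B)) : open U = alg_open U.
Proof. by []. Qed.

Lemma alg_nbhsP A B (h : algHom A B) (U : set (algHom A B)) :
  nbhs h U <-> exists s : seq A, subalgebra (alg_span s) /\
    forall h' : algHom A B, (forall a, alg_span s a -> h' a = h a) -> U h'.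
Proof.
split=> [|[s [Ss sU]]].
  rewrite nbhsE => -[V [oV Vh] VU]; have [s [Ss sV]] := oV h Vh.
  by exists s; split=> // h' /sV; exact: VU.
rewrite nbhsE; exists [set h' : algHom A B | forall a, alg_span s a -> h' a = h a] => //.
split; last by [].
rewrite alg_openE => g gh; exists s; split=> // g' g'g a sa.
by rewrite g'g // gh.
Qed.

Lemma alg_comp_continuous A B C (f : algHom A B) :
  continuous (fun h : algHom B C => alg_comp h f).
Proof.
apply/continuousP => U; rewrite !alg_openE => oU h /oU[s [Ss sU]].
exists [seq f y | y <- s].
split; first by apply: (image_subalgebra (t := id)) => // c; exact: alg_str.
move=> h' h'E; apply: sU => a sa; rewrite !alg_compE; apply: h'E.
by apply: (alg_span_image (t := id)) => // c; exact: alg_str.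
Qed.

Lemma letale_subalgebra A (a : A) : locally_etale A ->
  exists s, subalgebra (alg_span s) /\ alg_span s a.
Proof.
move=> /(_ a)[p sp pa]; pose n := (size p).-1.
have p0 : p != 0 by exact: separable_poly_neq0.
have sE : size p = n.+1 by rewrite /n prednK // lt0n size_poly_eq0.
have lp : p`_n != 0 by rewrite -[p`_n]/(lead_coef p) lead_coef_eq0.
pose s := [seq a ^+ i | i <- iota 0 n].
have sX i : (i < n)%N -> alg_span s (a ^+ i).
  by move=> ni; apply/alg_span_mem/mapP; exists i => //; rewrite mem_iota.
have sXn : alg_span s (a ^+ n).
  have: alg_span s (- \sum_(i < n) da_struct A p`_i * a ^+ i).
    rewrite -mulN1r -(rmorph1 (da_struct A)) -rmorphN; apply: alg_spanZ.
    by apply: big_ind => [||i _]; [exact: alg_span0|exact: alg_spanD|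
      exact/alg_spanZ/sX].
  move/(alg_spanZ (p`_n)^-1); rewrite /alg_eval sE big_ord_recr /= in pa.
  move/eqP: pa; rewrite addrC addr_eq0 => /eqP <-.
  by rewrite mulrA -rmorphM mulVf // rmorph1 mul1r.
have sXS x : alg_span s x -> alg_span s (a * x).
  move: x; apply: alg_span_min.
  - by rewrite mulr0; exact: alg_span0.
  - by move=> x y; rewrite mulrDr; exact: alg_spanD.
  - by move=> c x; rewrite mulrCA; exact: alg_spanZ.
  move=> _ /mapP[i + ->]; rewrite mem_iota /= add0n -exprS => ni.
  by have [/sX//|ni' ] := ltnP i.+1 n; rewrite (_ : i.+1 = n) //; apply/eqP; rewrite eqn_leq ni.
have s1 : alg_span s 1.
  by rewrite -(expr0 a); case: (posnP n) sXn sX => [->//|n0 _]; exact.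
have sXm m x : alg_span s x -> alg_span s (a ^+ m * x).
  elim: m => [|m IH] sx; first by rewrite mul1r.
  by rewrite exprS -mulrA; exact/sXS/IH.
exists s; split; last by rewrite -[a]mulr1; exact: sXS.
apply: subalgebra_span => // x y /mapP[i _ ->] ys.
exact/sXm/alg_span_mem.
Qed.

Lemma alg_eq_on_span A B (s : seq A) (g h : algHom A B) :
  (forall x, x \in s -> g x = h x) -> forall a, alg_span s a -> g a = h a.
Proof.
move=> gh; apply: alg_span_min.
- by rewrite !rmorph0.
- by move=> x y; rewrite !rmorphD => -> ->.
- by move=> c x; rewrite !rmorphM !alg_str => ->.
- exact: gh.
Qed.

Lemma alg_open_eq A B (a : A) (P : B -> Prop) : locally_etale A ->
  open [set h : algHom A B | P (h a)].
Proof.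
move=> /(letale_subalgebra a)[s [Ss sa]]; rewrite alg_openE => h Ph; exists s; split=> // h' h'E.
by rewrite /= h'E.
Qed.

Lemma algHom_hausdorff A B : locally_etale A -> hausdorff_space (algHom A B).
Proof.
move=> lA g h gh; apply: algHom_eq => a.
have Ng : nbhs g [set f : algHom A B | f a = g a].
  by apply: open_nbhs_nbhs; split=> //; exact: (@alg_open_eq A B a (fun x => x = g a) lA).
have Nh : nbhs h [set f : algHom A B | f a = h a].
  by apply: open_nbhs_nbhs; split=> //; exact: (@alg_open_eq A B a (fun x => x = h a) lA).
by have [f [/= <- <-]] := gh _ _ Ng Nh.
Qed.

Lemma algHom_totally_disconnected A B :
  locally_etale A -> totally_disconnected [set: algHom A B].
Proof.
move=> lA; apply: zero_dimension_totally_disconnected => g h gh.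
have [a ga] : exists a, g a <> h a.
  by apply/existsNP => /algHom_eq /eqP; rewrite (negPf gh).
exists [set f : algHom A B | f a = g a]; split=> //=; last exact/nesym.
split; first exact: (@alg_open_eq A B a (fun x => x = g a) lA).
by rewrite -openC; exact: (@alg_open_eq A B a (fun x => x <> g a) lA).
Qed.

End AlgHom.

(* A separable algebraic extension of k that is separably closed, with an
   extension of the endomorphism of k. *)
Record sepClosure (k : diffField) := SepClosure {
  sc_field : fieldType;
  sc_sigma : {rmorphism sc_field -> sc_field};
  sc_emb : {rmorphism k -> sc_field};
  sc_compat : forall c, sc_sigma (sc_emb c) = sc_emb (df_sigma k c);
  sc_separable : forall x : sc_field,
    exists2 p : {poly k}, separable_poly p & root (map_poly sc_emb p) x;
  sc_closed : forall p : {poly sc_field},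
    separable_poly p -> (1 < size p)%N -> exists x, root p x }.

Definition sc_alg (k : diffField) (K : sepClosure k) : diffAlg k :=
  DiffAlg (@sc_compat k K).
Coercion sc_alg : sepClosure >-> diffAlg.

Section Galois.
Variables (k : diffField) (K : sepClosure k).

Lemma sc_split (p : {poly sc_field K}) : separable_poly p ->
  exists2 rs : seq (sc_field K), p = lead_coef p *: \prod_(r <- rs) ('X - r%:P)
    & lead_coef p != 0.
Proof.
have [n] := ubnP (size p); elim: n p => // n IH p pn sp.
have p0 := separable_poly_neq0 sp.
have lp : lead_coef p != 0 by rewrite lead_coef_eq0.
have [p1|p1] := leqP (size p) 1.
  exists [::] => //; rewrite big_nil.
  by rewrite {1}(size1_polyC p1) lead_coefE (eqP (_ : (size p).-1 == 0)) ?alg_polyC //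
    -leqn0; case: (size p) p1.
have [r /factor_theorem[q qE]] := sc_closed sp p1.
have sq : separable_poly q by apply: dvdp_separable sp; rewrite qE dvdp_mulr.
have q0 := separable_poly_neq0 sq.
have [|rs rsE lq] := IH q _ sq.
  by move: pn; rewrite qE size_Mmonic ?monicXsubC // size_XsubC addn2.
exists (r :: rs) => //.
rewrite big_cons {2}qE lead_coef_Mmonic ?monicXsubC //.
by rewrite scalerAr -rsE mulrC.
Qed.

Lemma sc_eval_root (A : diffAlg k) (u : {rmorphism A -> sc_field K})
    (t : {rmorphism k -> sc_field K}) (ut : forall c, u (da_struct A c) = t c)
    (p : {poly k}) a : alg_eval p a = 0 -> root (map_poly t p) (u a).
Proof.
move=> pa; apply/rootP; rewrite horner_coef size_map_poly.
apply: etrans (rmorph0 u); rewrite -pa rmorph_sum.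
 under [RHS]eq_bigr do rewrite rmorphM rmorphXn ut.
by under [LHS]eq_bigr do rewrite coef_map.
Qed.

Lemma sc_letale : locally_etale K.
Proof.
move=> x; have [p sp /rootP px] := @sc_separable k K x; exists p => //.
move: px; rewrite horner_coef size_map_poly.
by under eq_bigr do rewrite coef_map.
Qed.

Lemma sc_roots (p : {poly k}) : separable_poly p ->
  exists rs : seq (sc_field K), forall t : {rmorphism sc_field K -> sc_field K},
  forall x, root (map_poly (t \o sc_emb K : {rmorphism _ -> _}) p) x ->
    exists2 r, r \in rs & x = t r.
Proof.
move=> sp; have [|rs] := @sc_split (map_poly (sc_emb K) p).
  by rewrite separable_map.
set l := lead_coef _ => pE l0; exists rs => t x.
rewrite map_poly_comp pE linearZ /= rootZ ?fmorph_eq0 //.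
rewrite rmorph_prod /= => rx.
have: root (\prod_(r <- map t rs) ('X - r%:P)) x.
  rewrite big_map; move: rx; congr (root _ x).
  by apply: eq_bigr => r _; rewrite rmorphB /= map_polyX map_polyC.
by rewrite root_prod_XsubC => /mapP[r rrs ->]; exists r.
Qed.

Lemma sc_sigma_inj : injective (sc_sigma K).
Proof. exact: fmorph_inj. Qed.

(* If p has the roots r, then the image of p under sigma_k has the roots
   sigma(r): a semilinear homomorphism to K factors through sigma. *)
Lemma sigma_lift (A : diffAlg k) (u : {rmorphism A -> sc_field K}) :
    locally_etale A ->
    (forall c, u (da_struct A c) = sc_emb K (df_sigma k c)) ->
  exists h : algHom A K, forall a, sc_sigma K (h a) = u a.
Proof.
move=> lA us.
have /choice[h hE] : forall a, exists r, sc_sigma K r = u a.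
  move=> a; have [p sp pa] := lA a; have [rs rsP] := sc_roots sp.
  have us' c : u (da_struct A c) =
      (sc_sigma K \o sc_emb K : {rmorphism _ -> _}) c.
    by rewrite us /= sc_compat.
  by have [r _ ->] := rsP (sc_sigma K) (u a) (sc_eval_root us' pa); exists r.
have hB : zmod_morphism h.
  by move=> a b; apply: sc_sigma_inj; rewrite rmorphB !hE rmorphB.
have hM : monoid_morphism h.
  split; first by apply: sc_sigma_inj; rewrite hE !rmorph1.
  by move=> a b; apply: sc_sigma_inj; rewrite rmorphM !hE rmorphM.
have hs c : h (da_struct A c) = da_struct K c.
  by apply: sc_sigma_inj; rewrite hE us sc_compat.
by exists (@mk_algHom k A K h hB hM hs) => a; rewrite -hE.
Qed.

Section HomSigma.
Variables (A : diffAlg k) (lA : locally_etale A).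

Fact hom_sigma_subproof (h : algHom A K) :
  exists h' : algHom A K, forall a, da_sigma K (h' a) = h (da_sigma A a).
Proof.
apply: (@sigma_lift A (h \o da_sigma A : {rmorphism _ -> _})) => // c.
by rewrite /= da_compat alg_str.
Qed.

Definition hom_sigma (h : algHom A K) : algHom A K :=
  projT1 (cid (hom_sigma_subproof h)).

Lemma hom_sigmaE h a : da_sigma K (hom_sigma h a) = h (da_sigma A a).
Proof. exact: (projT2 (cid (hom_sigma_subproof h))). Qed.

Lemma hom_sigma_unique (h h' : algHom A K) :
  (forall a, da_sigma K (h' a) = h (da_sigma A a)) -> h' = hom_sigma h.
Proof.
by move=> h'E; apply: algHom_eq => a; apply: sc_sigma_inj; rewrite h'E -hom_sigmaE.
Qed.

Lemma hom_sigma_continuous : continuous hom_sigma.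
Proof.
apply/continuousP => U; rewrite !alg_openE => oU h /oU[s [Ss sU]].
exists [seq da_sigma A y | y <- s].
split; first by apply: (image_subalgebra (t := df_sigma k)) => // c; exact: da_compat.
move=> h' h'E; apply: sU => a sa; apply: sc_sigma_inj.
rewrite [LHS]hom_sigmaE [RHS]hom_sigmaE; apply: h'E.
by apply: (alg_span_image (t := df_sigma k)) => // c; exact: da_compat.
Qed.

Lemma algHom_compact : compact [set: algHom A K].
Proof.
rewrite compact_ultra => F FF _.
have /choice[c cF] : forall a, exists c, F [set h : algHom A K | h a = c].
  move=> a; have [p sp pa] := lA a; have [rs rsP] := sc_roots sp.
  apply: contrapT => /forallNP nF.
  have: F [set h : algHom A K | h a \notin rs].
    elim: rs {rsP} => [|r rs IH]; first by apply: filterE.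
    have [/nF//|Fr] := in_ultra_setVsetC [set h : algHom A K | h a = r] FF.
    apply: filterS (filterI Fr IH) => h [/= /eqP har hrs].
    by rewrite inE negb_or har.
  case/filter_ex => h /= /negP; apply.
  have ht c : h (da_struct A c) = (idfun \o sc_emb K : {rmorphism _ -> _}) c.
    exact: alg_str.
  by have [r rrs ->] := rsP idfun (h a) (sc_eval_root ht pa).
have cE (P : algHom A K -> Prop) (q : Prop) : F P -> (forall h, P h -> q) -> q.
  by move=> FP Pq; have [h /Pq] := filter_ex FP.
have cB : zmod_morphism c.
  move=> a b; apply: cE (filterI (cF (a - b)) (filterI (cF a) (cF b))) _.
  by move=> h [/= <- [<- <-]]; rewrite rmorphB.
have cM : monoid_morphism c.
  split; first by apply: cE (cF 1) _ => h /= <-; rewrite rmorph1.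
  move=> a b; apply: cE (filterI (cF (a * b)) (filterI (cF a) (cF b))) _.
  by move=> h [/= <- [<- <-]]; rewrite rmorphM.
have cs x : c (da_struct A x) = da_struct K x.
  by apply: cE (cF (da_struct A x)) _ => h /= <-; rewrite alg_str.
exists (@mk_algHom k A K c cB cM cs); split=> //= U /alg_nbhsP[s [_ sU]].
have Fs : F [set h : algHom A K | forall x, x \in s -> h x = c x].
  elim: {sU} s => [|x s IH]; first by apply: filterE.
  apply: filterS (filterI (cF x) IH) => h [/= hx hs] y.
  by rewrite inE => /predU1P[->//|]; exact: hs.
by apply: filterS Fs => h hs; apply/sU/alg_eq_on_span.
Qed.

End HomSigma.

Record galois := Galois {
  gal_hom :> algHom K K;
  gal_bij : bijective gal_hom }.

Lemma gal_eq (g h : galois) : gal_hom g =1 gal_hom h -> g = h.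
Proof.
case: g h => g gb [h hb] /= gh; have {}gh := @algHom_eq k K K g h gh; subst h.
by rewrite (Prop_irrelevance gb hb).
Qed.

HB.instance Definition _ := gen_eqMixin galois.
HB.instance Definition _ := gen_choiceMixin galois.
(* This subspace topology is the Krull topology: a subalgebra of K is a
   subextension of k. *)
HB.instance Definition _ := Topological.copy galois (initial_topology gal_hom).

Definition gal_one : galois := @Galois (alg_id K) (Bijective (fun=> erefl) (fun=> erefl)).

Definition gal_mul (g h : galois) : galois :=
  @Galois (alg_comp g h) (bij_comp (gal_bij g) (gal_bij h)).

Fact gal_inv_subproof (g : galois) :
  exists h : galois, cancel g h /\ cancel h g.
Proof.
have [f gK fK] := gal_bij g.
have fB : zmod_morphism f by move=> x y; apply: (can_inj gK); rewrite rmorphB !fK.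
have fM : monoid_morphism f.
  split; first by apply: (can_inj gK); rewrite fK rmorph1.
  by move=> x y; apply: (can_inj gK); rewrite rmorphM !fK.
have fs c : f (da_struct K c) = da_struct K c.
  by apply: (can_inj gK); rewrite fK alg_str.
by exists (@Galois (@mk_algHom k K K f fB fM fs) (Bijective fK gK)).
Qed.

Definition gal_inv (g : galois) : galois := projT1 (cid (gal_inv_subproof g)).

Lemma gal_invK (g : galois) : cancel g (gal_inv g).
Proof. by have [] := projT2 (cid (gal_inv_subproof g)). Qed.

Lemma gal_Kinv (g : galois) : cancel (gal_inv g) g.
Proof. by have [] := projT2 (cid (gal_inv_subproof g)). Qed.

Fact gal_mulA : associative gal_mul. Proof. by move=> f g h; exact: gal_eq. Qed.
Fact gal_mul1 : left_id gal_one gal_mul. Proof. by move=> g; exact: gal_eq. Qed.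
Fact gal_1mul : right_id gal_one gal_mul. Proof. by move=> g; exact: gal_eq. Qed.
Fact gal_mulV : left_inverse gal_one gal_inv gal_mul.
Proof. by move=> g; apply: gal_eq => x; exact: gal_invK. Qed.
Fact gal_Vmul : right_inverse gal_one gal_inv gal_mul.
Proof. by move=> g; apply: gal_eq => x; exact: gal_Kinv. Qed.

HB.instance Definition _ :=
  isGroup.Build galois gal_mulA gal_mul1 gal_1mul gal_mulV gal_Vmul.

Fact gal_sigma_subproof (g : galois) : exists g' : galois,
  forall x, g (da_sigma K x) = da_sigma K (g' x).
Proof.
pose h := hom_sigma sc_letale g; pose h' := hom_sigma sc_letale (gal_inv g).
have hE x : da_sigma K (h x) = g (da_sigma K x) := hom_sigmaE sc_letale g x.
have h'E x : da_sigma K (h' x) = gal_inv g (da_sigma K x) :=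
  hom_sigmaE sc_letale (gal_inv g) x.
have hK : cancel h h' by move=> x; apply: sc_sigma_inj; rewrite [LHS]h'E hE gal_invK.
have h'K : cancel h' h by move=> x; apply: sc_sigma_inj; rewrite [LHS]hE h'E gal_Kinv.
by exists (@Galois h (Bijective hK h'K)) => x; rewrite -hE.
Qed.

Definition gal_sigma (g : galois) : galois := projT1 (cid (gal_sigma_subproof g)).

Lemma gal_sigmaE (g : galois) x : g (da_sigma K x) = da_sigma K (gal_sigma g x).
Proof. exact: (projT2 (cid (gal_sigma_subproof g))). Qed.

Lemma gal_sigma_unique (g g' : galois) :
  (forall x, g (da_sigma K x) = da_sigma K (g' x)) -> g' = gal_sigma g.
Proof.
by move=> g'E; apply: gal_eq => x; apply: sc_sigma_inj; rewrite -[LHS]g'E gal_sigmaE.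
Qed.

Lemma gal_sigmaM : {morph gal_sigma : g h / (g * h)%g}.
Proof.
by move=> g h; apply/esym/gal_sigma_unique => x /=; rewrite -!gal_sigmaE.
Qed.

Lemma gal_sigma_continuous : continuous gal_sigma.
Proof.
apply/continuousP => _ [U oU <-].
exists (hom_sigma sc_letale @^-1` U).
  by have /continuousP := @hom_sigma_continuous K sc_letale; exact.
apply/seteqP; split=> g /=; rewrite (_ : hom_sigma _ _ = gal_sigma g) //;
  by apply/esym/hom_sigma_unique => x; rewrite gal_sigmaE.
Qed.

Lemma gal_hom_continuous : continuous gal_hom.
Proof. exact: initial_continuous. Qed.

Lemma gal_comp_continuous (A : diffAlg k) :
  continuous (fun gh : galois * algHom A K => alg_comp gh.1 gh.2).
Proof.
move=> [g h] U /alg_nbhsP[s [Ss sU]].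
exists (gal_hom @^-1` [set g' : algHom K K | forall x,
    alg_span [seq h a | a <- s] x -> g' x = g x],
  [set h' : algHom A K | forall a, alg_span s a -> h' a = h a]).
  split=> /=.
    apply: gal_hom_continuous; apply/alg_nbhsP; exists [seq h a | a <- s].
    split=> //; apply: (image_subalgebra (f := h) (t := id)) => // c.
    exact: alg_str.
  by apply/alg_nbhsP; exists s.
move=> [g' h'] [/= g'E h'E]; apply: sU => a sa; rewrite !alg_compE h'E // g'E //.
by apply: (alg_span_image (f := h) (t := id)) => // c; exact: alg_str.
Qed.

End Galois.

(* Profinite means compact, Hausdorff and totally disconnected. *)
Record diffProf := DiffProf {
  dp_space :> topologicalType;
  dp_compact : compact [set: dp_space];
  dp_hausdorff : hausdorff_space dp_space;
  dp_totally_disconnected : totally_disconnected [set: dp_space];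
  dp_sigma : dp_space -> dp_space;
  dp_sigma_continuous : continuous dp_sigma }.

Record diffProfHom (X Y : diffProf) := DiffProfHom {
  dph_fun :> X -> Y;
  dph_continuous : continuous dph_fun;
  dph_sigma : forall x, dph_fun (dp_sigma x) = dp_sigma (dph_fun x) }.

Section DiffProfCat.
Implicit Types X Y Z : diffProf.

Lemma diffProfHom_eq X Y (f g : diffProfHom X Y) : f =1 g -> f = g.
Proof.
case: f g => f fc fs [g gc gs] /= /funext fg; subst g.
by rewrite (Prop_irrelevance fc gc) (Prop_irrelevance fs gs).
Qed.

Definition dph_id X : diffProfHom X X :=
  @DiffProfHom X X id (fun=> cvg_id) (fun=> erefl).

Fact dph_comp_continuous X Y Z (g : diffProfHom Y Z) (f : diffProfHom X Y) :
  continuous (g \o f).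
Proof.
by move=> x; apply: continuous_comp; exact: dph_continuous.
Qed.

Fact dph_comp_sigma X Y Z (g : diffProfHom Y Z) (f : diffProfHom X Y) x :
  (g \o f) (dp_sigma x) = dp_sigma ((g \o f) x).
Proof. by rewrite /= !dph_sigma. Qed.

Definition dph_comp X Y Z (g : diffProfHom Y Z) (f : diffProfHom X Y) :=
  @DiffProfHom X Z (g \o f) (@dph_comp_continuous X Y Z g f) (dph_comp_sigma g f).

Fact dph_comp1 X Y (f : diffProfHom X Y) : dph_comp f (dph_id X) = f.
Proof. exact: diffProfHom_eq. Qed.
Fact dph_comp1l X Y (f : diffProfHom X Y) : dph_comp (dph_id Y) f = f.
Proof. exact: diffProfHom_eq. Qed.
Fact dph_compA W X Y Z (h : diffProfHom Y Z) (g : diffProfHom X Y)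
    (f : diffProfHom W X) :
  dph_comp h (dph_comp g f) = dph_comp (dph_comp h g) f.
Proof. exact: diffProfHom_eq. Qed.

Definition diffProf_cat : category :=
  @Category diffProf diffProfHom dph_id dph_comp dph_comp1 dph_comp1l dph_compA.

End DiffProfCat.

Section GProf.
Variables (k : diffField) (K : sepClosure k).

Record gProf := GProf {
  gp_prof :> diffProf;
  gp_act : galois K -> gp_prof -> gp_prof;
  gp_act1 : forall x, gp_act 1%g x = x;
  gp_actM : forall g h x, gp_act (g * h)%g x = gp_act g (gp_act h x);
  gp_act_continuous :
    continuous (fun gx : galois K * gp_prof => gp_act gx.1 gx.2);
  gp_act_sigma : forall g x,
    dp_sigma (gp_act g x) = gp_act (gal_sigma g) (dp_sigma x) }.

Record gProfHom (X Y : gProf) := GProfHom {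
  gph_fun :> diffProfHom X Y;
  gph_act : forall g x, gph_fun (gp_act g x) = gp_act g (gph_fun x) }.

Lemma gProfHom_eq (X Y : gProf) (f g : gProfHom X Y) : f =1 g -> f = g.
Proof.
case: f g => f fa [g ga] /= fg; have {}fg := diffProfHom_eq fg; subst g.
by rewrite (Prop_irrelevance fa ga).
Qed.

Definition gph_id (X : gProf) : gProfHom X X :=
  @GProfHom X X (dph_id X) (fun _ _ => erefl).

Fact gph_comp_act (X Y Z : gProf) (g : gProfHom Y Z) (f : gProfHom X Y) a x :
  dph_comp g f (gp_act a x) = gp_act a (dph_comp g f x).
Proof. by rewrite /= !gph_act. Qed.

Definition gph_comp (X Y Z : gProf) (g : gProfHom Y Z) (f : gProfHom X Y) :=
  GProfHom (gph_comp_act g f).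

Fact gph_comp1 (X Y : gProf) (f : gProfHom X Y) : gph_comp f (gph_id X) = f.
Proof. exact: gProfHom_eq. Qed.
Fact gph_comp1l (X Y : gProf) (f : gProfHom X Y) : gph_comp (gph_id Y) f = f.
Proof. exact: gProfHom_eq. Qed.
Fact gph_compA (W X Y Z : gProf) (h : gProfHom Y Z) (g : gProfHom X Y)
    (f : gProfHom W X) :
  gph_comp h (gph_comp g f) = gph_comp (gph_comp h g) f.
Proof. exact: gProfHom_eq. Qed.

Definition gProf_cat : category :=
  @Category gProf gProfHom gph_id gph_comp gph_comp1 gph_comp1l gph_compA.

Section GaloisObject.
Variable A : letAlg k.
Let lA : locally_etale A := @let_etale k A.

Definition galois_prof : diffProf :=
  @DiffProf (algHom A K) (@algHom_compact k K A lA) (@algHom_hausdorff k A K lA)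
    (@algHom_totally_disconnected k A K lA) (hom_sigma lA)
    (@hom_sigma_continuous k K A lA).

Definition galois_act (g : galois K) (h : galois_prof) : galois_prof :=
  alg_comp g h.

Fact galois_act1 h : galois_act 1%g h = h.
Proof. exact: algHom_eq. Qed.

Fact galois_actM g g' h :
  galois_act (g * g')%g h = galois_act g (galois_act g' h).
Proof. exact: algHom_eq. Qed.

Fact galois_act_continuous :
  continuous (fun gh : galois K * galois_prof => galois_act gh.1 gh.2).
Proof. exact: gal_comp_continuous. Qed.

Fact galois_act_sigma g (h : galois_prof) :
  dp_sigma (galois_act g h) = galois_act (gal_sigma g) (dp_sigma h).
Proof.
apply/esym/hom_sigma_unique => a.
by rewrite /galois_act !alg_compE -gal_sigmaE hom_sigmaE.
Qed.

Definition galois_object : gProf :=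
  GProf galois_act1 galois_actM galois_act_continuous galois_act_sigma.
End GaloisObject.

Section GaloisHom.
Variables (A B : letAlg k) (f : dalgHom A B).

Definition galois_precomp (h : galois_prof B) : galois_prof A := alg_comp h f.

Fact galois_precomp_continuous : continuous galois_precomp.
Proof. exact: alg_comp_continuous. Qed.

Fact galois_precomp_sigma (h : galois_prof B) :
  galois_precomp (dp_sigma h) = dp_sigma (galois_precomp h).
Proof.
apply: hom_sigma_unique => a.
by rewrite /galois_precomp !alg_compE dalg_sigma hom_sigmaE.
Qed.

Fact galois_precomp_act (g : galois K) (h : galois_object B) :
  galois_precomp (gp_act g h) = @gp_act (galois_object A) g (galois_precomp h).
Proof. exact: algHom_eq. Qed.

Definition galois_hom : gProfHom (galois_object B) (galois_object A) :=
  @GProfHom (galois_object B) (galois_object A)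
    (@DiffProfHom (galois_prof B) (galois_prof A) galois_precomp
       galois_precomp_continuous galois_precomp_sigma)
    galois_precomp_act.
End GaloisHom.

Fact galois_hom1 (A : letAlg k) : galois_hom (dalg_id A) = gph_id (galois_object A).
Proof. by apply: gProfHom_eq => h; exact: algHom_eq. Qed.

Fact galois_homM (A B C : letAlg k) (f : dalgHom B A) (g : dalgHom C B) :
  galois_hom (dalg_comp f g) = gph_comp (galois_hom g) (galois_hom f).
Proof. by apply: gProfHom_eq => h; exact: algHom_eq. Qed.

Definition galois_functor : functor (opposite (let_cat k)) gProf_cat :=
  @Functor (opposite (let_cat k)) gProf_cat galois_object
    (fun A B f => galois_hom f) galois_hom1
    (fun A B C g f => galois_homM f g).

End GProf.

Section FullShift.
Variable E : finType.

Definition shift_space : topologicalType :=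
  prod_topology (fun _ : nat => discrete_topology E).

Definition shift_map (x : shift_space) : shift_space := fun n => x n.+1.

Fact shift_compact : compact [set: shift_space].
Proof.
have := @tychonoff nat (fun=> discrete_topology E) (fun=> setT).
rewrite (_ : [set f | _] = setT); first by apply=> _; exact/finite_compact/finite_finset.
by apply/seteqP; split.
Qed.

Fact shift_hausdorff : hausdorff_space shift_space.
Proof. by apply: hausdorff_product => _; exact: discrete_hausdorff. Qed.

Fact shift_zero_dimensional : zero_dimensional shift_space.
Proof. by apply: zero_dimension_prod => _; exact: discrete_zero_dimension. Qed.

Fact coord_continuous n : continuous (fun x : shift_space => x n : discrete_topology E).
Proof. exact: proj_continuous. Qed.

Fact shift_map_continuous : continuous shift_map.
Proof.
move=> x; apply/cvg_sup; first exact/fmap_filter/(nbhs_filter (x : shift_space)).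
move=> n; move: x.
apply/(@continuousP _ (initial_topology (@^~ n))) => _ [B oB <-].
by have /continuousP/(_ B oB) := @coord_continuous n.+1.
Qed.

Definition full_shift : diffProf :=
  DiffProf shift_compact shift_hausdorff
    (zero_dimension_totally_disconnected shift_zero_dimensional)
    shift_map_continuous.

Section Subshift.
Variables (S : set full_shift) (cS : closed S)
  (sS : forall x, S x -> S (dp_sigma x)).

Let val_continuous : continuous (set_val : S -> full_shift).
Proof. exact: initial_continuous. Qed.

Fact sub_compact : compact [set: S].
Proof.
move=> F PF _.
have cptS : compact S by exact: (subclosed_compact cS shift_compact (@subsetT _ S)).
have FS : (set_val @ F) S by apply: (@filterE _ F) => x; exact: set_valP.
have [p [Sp Fp]] := cptS (set_val @ F) _ FS.
exists (SigSub (mem_set Sp)); split=> // A B FA.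
move=> [_ [[V oV <-] /= Vp VB]].
have FA' : (set_val @ F) (set_val @` A).
  by apply: (@filterS _ F) FA => x Ax; exists x.
have Vp' : nbhs p V by apply: open_nbhs_nbhs; split.
by have [_ [[x Ax <-] Vx]] := Fp _ _ FA' Vp'; exists x; split=> //; exact: VB.
Qed.

Fact sub_hausdorff : hausdorff_space S.
Proof.
move=> x y xy; apply: val_inj; apply: shift_hausdorff => A B Ax By.
by have [z [Az Bz]] := xy _ _ (val_continuous Ax) (val_continuous By); exists (val z).
Qed.

Fact sub_totally_disconnected : totally_disconnected [set: S].
Proof.
apply: zero_dimension_totally_disconnected => x y xy.
have [|U [cU Ux Uy]] := @shift_zero_dimensional (val x) (val y).
  by rewrite (inj_eq val_inj).
by exists (set_val @^-1` U); split=> //; exact: preimage_clopen.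
Qed.

Definition sub_sigma (x : S) : S := SigSub (mem_set (sS (set_valP x))).

Fact sub_sigma_continuous : continuous sub_sigma.
Proof.
apply/continuousP => _ [U oU <-]; exists (shift_map @^-1` U) => //.
by have /continuousP/(_ U oU) := shift_map_continuous.
Qed.

Definition subshift : diffProf :=
  DiffProf sub_compact sub_hausdorff sub_totally_disconnected
    sub_sigma_continuous.
End Subshift.
End FullShift.

Definition is_subshift (X : diffProf) : Prop :=
  exists (E : finType) (S : set (full_shift E)) (cS : closed S)
    (sS : forall x, S x -> S (dp_sigma x)),
    isomorphic (C := diffProf_cat) X (subshift cS sS).

Section FiniteType.
Variables (V E : finType) (s t : E -> V).

Definition edge_shift : set (full_shift E) :=
  [set x | forall i, s (x i.+1) = t (x i)].

Fact edge_shift_closed : closed edge_shift.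
Proof.
have -> : edge_shift = \bigcap_i [set x : full_shift E | s (x i.+1) = t (x i)].
  by apply/seteqP; split=> [x xE i _|x xE i]; exact: xE.
apply: closed_bigI => i _; rewrite -openC.
have -> : ~` [set x : full_shift E | s (x i.+1) = t (x i)] =
    \bigcup_(e in [set e : E * E | s e.1 <> t e.2])
      ((fun x : full_shift E => x i.+1 : discrete_topology E) @^-1` [set e.1] `&`
       (fun x : full_shift E => x i : discrete_topology E) @^-1` [set e.2]).
  apply/seteqP; split=> [x xi|x [e ee [/= xe xe']] /=]; last by rewrite xe xe'.
  by exists (x i.+1, x i).
apply: bigcup_open => e _; apply: openI.
  have /continuousP := @coord_continuous E i.+1; apply; exact: discrete_open.
have /continuousP := @coord_continuous E i; apply; exact: discrete_open.
Qed.

Fact edge_shift_sigma x : edge_shift x -> edge_shift (dp_sigma x).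
Proof. by move=> xE i; exact: xE. Qed.

End FiniteType.

Definition is_sft (X : diffProf) : Prop :=
  exists (V E : finType) (s t : E -> V), isomorphic (C := diffProf_cat) X
    (subshift (@edge_shift_closed V E s t) (@edge_shift_sigma V E s t)).

Definition sigma_orbit (k : diffField) (A : diffAlg k) (B : seq A) : set A :=
  [set a | exists2 b, b \in B & exists i, a = iter i (da_sigma A) b].

Definition finitely_sigma_generated (k : diffField) (A : diffAlg k) : Prop :=
  exists B : seq A, forall S : set A,
    subalgebra S -> sigma_orbit B `<=` S -> forall a, S a.

Module DiffPoly.
Import monalg.
Section DiffPoly.
Variables (k : diffField) (n : nat).

(* The variable (i, j) is sigma^i(x_j). *)
Definition var : choiceType := (nat * 'I_n)%type.
Definition mon := {cmonom var}.
Definition pol : comNzRingType := {malg k[{cmonom var}]}.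

Definition shift_exp (m : mon) (v : var) : nat :=
  if v.1 is i.+1 then m (i, v.2) else 0%N.

Definition shift_mon (m : mon) : mon :=
  [cmonom shift_exp m v | v in [fset ((u.1.+1, u.2) : var) | u in finsupp m]%fset]%M.

Lemma shift_monE m v : shift_mon m v = shift_exp m v.
Proof.
rewrite /shift_mon cmE fsfun_fun; case: ifPn => // vN.
rewrite /shift_exp; case: v vN => -[|i] j //= vN; apply/esym/eqP.
rewrite cmE_eq0; apply: contra vN => ij; apply/imfsetP.
by exists (i, j).
Qed.

Definition shift_monpol (m : mon) : {malg k[{cmonom var}]} := << 1 *g shift_mon m >>.

Fact shift_monpol_mmorphism : mmorphism shift_monpol.
Proof.
split=> [m m'|]; rewrite /shift_monpol.
  have -> : shift_mon (mmul m m') = mmul (shift_mon m) (shift_mon m').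
    apply/eqP/cmP => v; rewrite cmM !shift_monE /shift_exp.
    by case: v => -[|i] j //=; rewrite cmM.
  rewrite [RHS]malgM_def.
  rewrite [RHS]fgmulUU.
  by rewrite mul1r.
have -> : shift_mon mone = mone.
  apply/eqP/cmP => v; rewrite shift_monE cm1 /shift_exp.
  by case: v => -[|i] j //=; rewrite cm1.
by [].
Qed.

HB.instance Definition _ :=
  monalg.isMultiplicative.Build _ _ shift_monpol shift_monpol_mmorphism.

Definition sigma : {rmorphism pol -> pol} :=
  mmap (@malgC _ k \o df_sigma k) shift_monpol.

Definition struct : {rmorphism k -> pol} := @malgC _ k.

Fact compat c : sigma (struct c) = struct (df_sigma k c).
Proof. exact: mmapC. Qed.

End DiffPoly.
End DiffPoly.

Definition diff_poly (k : diffField) (n : nat) : diffAlg k :=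
  DiffAlg (@DiffPoly.compat k n).

Definition is_ideal (A : comPzRingType) (I : set A) : Prop :=
  [/\ I 0, forall x y, I x -> I y -> I (x + y) & forall a x, I x -> I (a * x)].

Definition ideal_span (A : comPzRingType) (S : set A) : set A :=
  [set x | forall I : set A, is_ideal I -> S `<=` I -> I x].

(* A quotient by I is a surjective homomorphism with kernel I. *)
Definition finitely_sigma_presented (k : diffField) (A : diffAlg k) : Prop :=
  exists (n : nat) (I : set (diff_poly k n)) (p : dalgHom (diff_poly k n) A),
    [/\ is_ideal I /\ (forall x, I x -> I (da_sigma _ x)),
        exists2 B : seq (diff_poly k n), forall b, b \in B -> I b
          & I = ideal_span (sigma_orbit B),
        forall a, exists x, p x = a &
        forall x, p x = 0 <-> I x].

(* Main.v *)
(** The inverse functor sends X to the ring of locally constant equivariant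
    functions X -> K.  Everything rests on one extension theorem: a partial
    homomorphism from A to K, seen as a functional subalgebra of A x K, extends
    to A.  By Zorn's lemma it suffices to extend it by one element a, i.e. to
    find a root in K of the ideal of polynomials forced to vanish at a; this
    ideal is proper because A is von Neumann regular.

    Extension gives separation of the elements of A by its homomorphisms to K,
    the fixed field of the Galois group, and the surjectivity statements.  That
    A exhausts the equivariant functions on X(A) is Stone-Weierstrass followed
    by descent in a linear combination of minimal length.  Points x, y of X are
    separated by the coefficients of prod (T - g theta), the product being taken
    over the conjugates g theta with g^-1 z in U, where U is clopen, contains x but
    not y, and theta is a tuple such that every g fixing it stabilizes U.

    X(A) is a subshift iff it carries a locally constant generating code into a
    finite set, and such codes are given by the values at finitely many elements
    of A.  For finite presentation, relations involving sigma^0, ..., sigma^N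
    become conditions on windows of length N + 1; conversely, if X(A) is a
    subshift of finite type, finitely many relations on windows force every
    homomorphism from the difference polynomial ring that kills their sigma-ideal
    to come from a point of X(A), and separation modulo this ideal shows that it
    is the whole kernel. *)
Require Import Defs.
From HB Require Import structures.
From mathcomp Require Import all_boot all_algebra topology ring.
From mathcomp Require Import separable finmap boolp classical_sets functions.
From mathcomp Require monalg.

Set Implicit Arguments.
Unset Strict Implicit.
Unset Printing Implicit Defensive.

Import GRing.Theory.
Local Open Scope classical_set_scope.
Local Open Scope ring_scope.

(** * Evaluation of polynomials in rings that may be zero *)

Definition nonzero_ring (A : comPzRingType) (A1 : (1 : A) != 0) : comNzRingType :=
  HB.pack (GRing.ComPzRing.sort A) (GRing.ComPzRing.class A)
    (GRing.PzSemiRing_isNonZero.Build A A1).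

Section Eval.
Variables (k : diffField) (A : diffAlg k).
Implicit Types (p q : {poly k}) (a : A).

(** Since [nonzero_ring A1] keeps the carrier of [A], facts about Horner evaluation transfer to
    [alg_eval]; the zero ring, where every equation holds, is treated apart below. *)
Lemma alg_eval_horner (A1 : (1 : A) != 0) p a :
  alg_eval p a =
  (map_poly (da_struct A : {rmorphism k -> nonzero_ring A1}) p).[(a : nonzero_ring A1)].
Proof.
rewrite (@horner_coef_wide _ (size p)) ?size_poly //.
by apply: eq_bigr => i _; rewrite coef_map.
Qed.

Lemma zero_ring_eq : (1 : A) = 0 -> forall x y : A, x = y.
Proof. by move=> A1 x y; rewrite -[x]mul1r -[y]mul1r A1 !mul0r. Qed.

Lemma alg_evalD p q a : alg_eval (p + q) a = alg_eval p a + alg_eval q a.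
Proof.
have [A1|A1] := eqVneq (1 : A) 0; first exact: zero_ring_eq.
by rewrite !(alg_eval_horner A1) rmorphD hornerD.
Qed.

Lemma alg_evalM p q a : alg_eval (p * q) a = alg_eval p a * alg_eval q a.
Proof.
have [A1|A1] := eqVneq (1 : A) 0; first exact: zero_ring_eq.
by rewrite !(alg_eval_horner A1) rmorphM hornerM.
Qed.

Lemma alg_evalX a : alg_eval 'X a = a.
Proof.
have [A1|A1] := eqVneq (1 : A) 0; first exact: zero_ring_eq.
by rewrite !(alg_eval_horner A1) map_polyX hornerX.
Qed.

Lemma alg_evalC c a : alg_eval c%:P a = da_struct A c.
Proof.
have [A1|A1] := eqVneq (1 : A) 0; first exact: zero_ring_eq.
by rewrite !(alg_eval_horner A1) map_polyC hornerC.
Qed.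

End Eval.

(** * Extension of partial homomorphisms *)

(** Von Neumann regularity of the class of ['X] modulo [p]. If the constant term [c] is nonzero,
    ['X] is invertible modulo [p]; otherwise [p = 'X * (t * 'X + d)], where [d] is nonzero because
    ['X] cannot divide [p] twice. *)
Lemma sep_regular (k : fieldType) (p : {poly k}) : separable_poly p ->
  exists s u : {poly k}, 'X = 'X * 'X * s + p * u.
Proof.
move=> sp; have [q [c pE]] : exists q c, p = q * 'X + c%:P.
  by elim/poly_ind: (p) => [|q c _]; [exists 0, 0; rewrite mul0r addr0|exists q, c].
have [c0|c0] := eqVneq c 0; last first.
  exists (- (c^-1 *: q)), (c^-1 *: 'X); rewrite pE -!mul_polyC.
  transitivity ((c^-1 * c)%:P * 'X : {poly k}); first by rewrite mulVf // mul1r.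
  by rewrite rmorphM /= mulrDl; ring.
have [t [d qE]] : exists t d, q = t * 'X + d%:P.
  by elim/poly_ind: (q) => [|t d _]; [exists 0, 0; rewrite mul0r addr0|exists t, d].
have d0 : d != 0.
  apply/eqP => d0; have [/(_ 'X 'X) + _] := separable_polyP sp.
  by rewrite coprimepp size_polyX pE qE d0 c0 !addr0 -mulrA dvdp_mull // => /(_ isT).
exists (- (d^-1 *: t)), (d^-1)%:P; rewrite pE qE c0 addr0 -!mul_polyC.
transitivity ((d^-1 * d)%:P * 'X : {poly k}); first by rewrite mulVf // mul1r.
by rewrite rmorphM /=; ring.
Qed.

(** The graph of a homomorphism to [K] from a subalgebra of [A], killing [J]. As [R] is closed under
    differences, the last clause expresses that [R] is single-valued. *)
Definition partial_hom (k K : fieldType) (emb : {rmorphism k -> K})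
    (A : comPzRingType) (str : {rmorphism k -> A}) (J : set A) (R : set (A * K)) :
    Prop :=
  [/\ forall c, R (str c, emb c),
      forall x y, R x -> R y -> R (x + y),
      forall x y, R x -> R y -> R (x * y),
      forall a, J a -> R (a, 0) &
      forall c, R (0, c) -> c = 0].

Section PartialHom.
Variables (k K : fieldType) (emb : {rmorphism k -> K}).
Variables (A : comNzRingType) (str : {rmorphism k -> A}) (J : set A).
Hypothesis closedK : forall p : {poly K},
  separable_poly p -> (1 < size p)%N -> exists x, root p x.
Hypothesis sepK : forall x : K,
  exists2 p : {poly k}, separable_poly p & root (map_poly emb p) x.
Hypothesis idJ : is_ideal J.
Hypothesis etJ : forall a : A,
  exists2 p : {poly k}, separable_poly p & J (map_poly str p).[a].

(** Evaluate [sep_regular] at [a]: the multiple of [p] falls into [J]. *)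
Lemma regular_mod a : exists s : {poly k}, J (a - a * a * (map_poly str s).[a]).
Proof.
have [p /sep_regular[s [u E]] Jp] := etJ a; exists s.
have [_ _ JM] := idJ; have := JM (map_poly str u).[a] _ Jp.
congr J; move/(congr1 (fun q => (map_poly str q).[a])): E.
rewrite rmorphD !rmorphM /= map_polyX !hornerE => E.
by apply/esym/eqP; rewrite subr_eq [eqbRHS]addrC [_.[a] * _.[a]]mulrC -E.
Qed.

(** For nonzero [x] this writes the inverse of [x] as a polynomial in [x] over [k], so that
    subalgebras of [K] are closed under inverses. *)
Lemma regular_field (x : K) : exists s : {poly k}, x = x * x * (map_poly emb s).[x].
Proof.
have [p /sep_regular[s [u E]] /eqP px] := sepK x; exists s.
move/(congr1 (fun q => (map_poly emb q).[x])): E.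
by rewrite rmorphD !rmorphM /= map_polyX !hornerE px mul0r addr0.
Qed.

Section Step.
Variables (R : set (A * K)) (hR : partial_hom emb str J R) (a : A).

Let Rc c : R (str c, emb c). Proof. by case: hR. Qed.
Let RD x y : R x -> R y -> R (x + y). Proof. by case: hR => _ + _ _ _; apply. Qed.
Let RM x y : R x -> R y -> R (x * y). Proof. by case: hR => _ _ + _ _; apply. Qed.
Let RJ x : J x -> R (x, 0). Proof. by case: hR => _ _ _ + _; apply. Qed.
Let R0 c : R (0, c) -> c = 0. Proof. by case: hR => _ _ _ _; apply. Qed.
Let R_0 : R 0. Proof. by have := Rc 0; rewrite !rmorph0. Qed.
Let R_1 : R 1. Proof. by have := Rc 1; rewrite !rmorph1. Qed.
Let R_N x : R x -> R (- x).
Proof. by move=> Rx; rewrite -mulN1r; apply: RM => //; have := Rc (-1); rewrite !rmorphN1. Qed.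

Lemma partial_hom_horner (s : {poly k}) b c : R (b, c) ->
  R ((map_poly str s).[b], (map_poly emb s).[c]).
Proof.
move=> Rbc; elim/poly_ind: s => [|s d IH]; first by rewrite !rmorph0 !horner0.
rewrite !rmorphD !rmorphM /= !map_polyX !map_polyC !hornerE /=.
exact: (RD (RM IH Rbc) (Rc d)).
Qed.

Definition coefs_in (q : {poly (A * K)%type}) : Prop := forall i, R q`_i.

Lemma coefs_inD q r : coefs_in q -> coefs_in r -> coefs_in (q + r).
Proof. by move=> hq hr i; rewrite coefD; exact: RD. Qed.

Lemma coefs_inM q r : coefs_in q -> coefs_in r -> coefs_in (q * r).
Proof. by move=> hq hr i; rewrite coefM; apply: big_ind => // j _; exact: RM. Qed.

Lemma coefs_inC x : R x -> coefs_in x%:P.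
Proof. by move=> Rx i; rewrite coefC; case: eqP. Qed.

Lemma coefs_inX : coefs_in 'X.
Proof. by move=> i; rewrite coefX; case: eqP. Qed.

(** The relations forced on the image of [a] by any extension of [R]: a polynomial over the domain
    of [R] that vanishes at [a] is transported to [K] through [R]. *)
Definition rel_ideal (q : {poly K}) : Prop := exists r, [/\ coefs_in r,
  (map_poly fst r).[a] = 0 & map_poly snd r = q].

Lemma rel_idealD q r : rel_ideal q -> rel_ideal r -> rel_ideal (q + r).
Proof.
move=> [q' [Rq qa <-]] [r' [Rr ra <-]]; exists (q' + r'); split.
- exact: coefs_inD.
- by rewrite rmorphD hornerD qa ra addr0.
- by rewrite rmorphD.
Qed.

Lemma rel_idealM r q : coefs_in r -> rel_ideal q -> rel_ideal (map_poly snd r * q).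
Proof.
move=> Rr [q' [Rq qa <-]]; exists (r * q'); split.
- exact: coefs_inM.
- by rewrite rmorphM hornerM qa mulr0.
- by rewrite rmorphM.
Qed.

(* The kernel of R is locally generated by idempotents e; w is a product of elements 1 - e. *)
Lemma partial_hom_kill (r : {poly (A * K)%type}) : coefs_in r -> map_poly snd r = 0 ->
  exists2 w, R (w, 1) & J (w * (map_poly fst r).[a]).
Proof.
have [J0 JD JM] := idJ.
elim/poly_ind: r => [|r x IH] Rr r0.
  by exists 1 => //; rewrite rmorph0 horner0 mulr0.
have x0 : x.2 = 0.
  have /(congr1 (fun q : {poly K} => q`_0)) := r0.
  by rewrite coef_map coefD coefMX coefC /= add0r coef0.
have rr0 : map_poly snd r = 0.
  apply/polyP => i; have /(congr1 (fun q : {poly K} => q`_i.+1)) := r0.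
  by rewrite !coef_map coefD coefMX coefC /= addr0 !coef0.
have Rr' : coefs_in r.
  by move=> i; have := Rr i.+1; rewrite coefD coefMX coefC /= addr0.
have Rx : R (x.1, 0).
  by have := Rr 0; rewrite coefD coefMX coefC /= add0r -x0; case: (x).
have [w Rw Jw] := IH Rr' rr0; have [s Js] := regular_mod x.1.
(* [x.1] is killed by [1 - e] modulo [J], while [R] sends [e] to 0 because it sends [x.1] to 0. *)
set e := x.1 * (map_poly str s).[x.1].
have Re : R (1 - e, 1).
  have := RD R_1 (R_N (RM Rx (partial_hom_horner s Rx))).
  by congr R; congr pair; rewrite /= mul0r oppr0 addr0.
exists (w * (1 - e)); first by have := RM Rw Re; congr R; congr pair; rewrite /= mulr1.
rewrite rmorphD rmorphM /= map_polyX map_polyC !hornerE /= mulrDr; apply: JD.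
  by have := JM ((1 - e) * a) _ Jw; congr J; ring.
by have := JM w _ Js; congr J; rewrite /e; ring.
Qed.

(** If [r] vanishes at [a] and maps to 1, then [partial_hom_kill] applied to [r - 1] gives [w] with
    [- w] in [J]. Then [R] sends [w] to both 1 and 0. *)
Lemma rel_ideal_proper : ~ rel_ideal 1.
Proof.
move=> [r [Rr ra r1]].
have R1 : coefs_in (r - 1) by apply/coefs_inD=> //; rewrite -polyCN; apply/coefs_inC/R_N.
have [|w Rw] := partial_hom_kill R1; first by rewrite rmorphB /= r1 rmorph1 subrr.
rewrite rmorphB rmorph1 hornerD ra hornerN hornerC add0r mulrN1 => /RJ RwN.
have /R0/eqP : R (0, 1) by have := RD Rw RwN; congr R; congr pair; rewrite /= ?subrr ?addr0.
by rewrite oner_eq0.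
Qed.

(** The second coordinates of [R] form a field, so a nonzero relation [d] of least degree divides
    all others. It divides the image of a separable polynomial, hence is separable, and it is not
    constant because the ideal is proper; a root of [d] in [K] is a common root. *)
Lemma rel_ideal_root : exists c, forall q, rel_ideal q -> root q c.
Proof.
have [p sp Jp] := etJ a.
have Ip : rel_ideal (map_poly emb p).
  pose r := \poly_(i < size p) (str p`_i, emb p`_i).
  have fr : map_poly fst r = map_poly str p.
    apply/polyP=> i; rewrite !coef_map coef_poly; case: ltnP => //= pi.
    by rewrite nth_default // rmorph0.
  have sr : map_poly snd r = map_poly emb p.
    apply/polyP=> i; rewrite !coef_map coef_poly; case: ltnP => //= pi.
    by rewrite nth_default // rmorph0.
  (* [p] vanishes at [a] only modulo [J]. The value of [p] at [a], paired with 0, belongs to [R];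
     subtracting it leaves the second projection unchanged and makes the first vanish at [a]. *)
  exists (r - ((map_poly str p).[a], 0)%:P); split.
  - apply: coefs_inD; first by move=> i; rewrite coef_poly; case: ifP.
    by rewrite -polyCN; apply/coefs_inC/R_N/RJ.
  - by rewrite rmorphB /= fr /= map_polyC /= hornerD hornerN hornerC subrr.
  - by rewrite rmorphB /= sr /= map_polyC /= subr0.
have [d [d0 Id dmin]] : exists d, [/\ d != 0, rel_ideal d &
    forall q, q != 0 -> rel_ideal q -> (size d <= size q)%N].
  pose P n := `[< exists q, [/\ q != 0, rel_ideal q & size q = n] >].
  have exP : exists n, P n.
    exists (size (map_poly emb p)); apply/asboolP; exists (map_poly emb p).
    by split=> //; rewrite map_poly_eq0 separable_poly_neq0.
  case: (ex_minnP exP) => _ /asboolP[d [d0 Id <-]] dmin; exists d; split=> // q q0 Iq.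
  by apply: dmin; apply/asboolP; exists q.
have inv q : rel_ideal q -> forall i, q`_i != 0 -> exists2 x, R x & x.2 = (q`_i)^-1.
  move=> [r [Rr ra <-]] i; rewrite coef_map => ri0.
  have [s sE] := regular_field (r`_i).2.
  have := partial_hom_horner s (_ : R ((r`_i).1, (r`_i).2)); rewrite -surjective_pairing.
  move=> /(_ (Rr i)) Rs; eexists; first exact: Rs.
  by apply: (mulfI ri0); rewrite /= mulfV // ; apply: (mulfI ri0); rewrite mulr1 mulrA -sE.
have coefR q : rel_ideal q -> forall i, exists2 x, R x & x.2 = q`_i.
  by move=> [r [Rr ra <-]] i; exists r`_i => //; rewrite coef_map.
have ld0 : lead_coef d != 0 by rewrite lead_coef_eq0.
have [w Rw wE] := inv d Id (size d).-1 ld0.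
(* Division by [d] is carried out one leading term at a time, so that the coefficients of the
   quotient remain second coordinates of [R]. *)
have dvd q : rel_ideal q -> d %| q.
  have [n] := ubnP (size q); elim: n q => // n IH q qn Iq.
  have [->|q0] := eqVneq q 0; first exact: dvdp0.
  have sd := dmin q q0 Iq.
  have [v Rv vE] := coefR q Iq (size q).-1.
  pose m := (size q - size d)%N.
  pose t := (w * v)%:P * 'X^m : {poly (A * K)%type}.
  have Rt : coefs_in t.
    apply: coefs_inM; first exact/coefs_inC/RM.
    elim: (m) => [|j IHj]; first exact: coefs_inC.
    by rewrite exprS; apply: coefs_inM => //; exact: coefs_inX.
  have tE : map_poly snd t = ((lead_coef d)^-1 * lead_coef q)%:P * 'X^m.
    by rewrite rmorphM /= map_polyC map_polyXn /= wE vE.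
  have It := rel_idealM Rt Id; rewrite tE in It.
  set t' := _%:P * _ in It.
  have IB : rel_ideal (q - t' * d).
    rewrite -mulN1r; apply: rel_idealD => //.
    have := rel_idealM (coefs_inC (R_N R_1)) It.
    by rewrite map_polyC /= polyCN polyC1.
  rewrite -(subrK (t' * d) q) dvdp_add ?dvdp_mull //; apply: IH IB.
  rewrite ltnS in qn; apply: leq_trans qn.
  have lq0 : lead_coef q != 0 by rewrite lead_coef_eq0.
  have c0 : (lead_coef d)^-1 * lead_coef q != 0 by rewrite mulf_neq0 ?invr_eq0.
  have st : size (t' * d) = size q.
    rewrite /t' -mulrA mul_polyC size_scale // mulrC size_Mmonic ?monicXn //.
    by rewrite size_polyXn addnS /= subnKC.
  have sq : (0 < size q)%N by rewrite size_poly_gt0.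
  rewrite -(prednK sq) ltnS; apply/leq_sizeP => j; rewrite leq_eqVlt => /orP[/eqP <-|qj].
    rewrite coefB -{2}st -[(t' * d)`_ _]/(lead_coef _) lead_coefM /t' lead_coefM lead_coefC.
    by rewrite lead_coefXn mulr1 mulrAC mulVf // mul1r subrr.
  have sj : (size q <= j)%N by rewrite -(prednK sq).
  by rewrite coefB !nth_default ?subr0 // st.
have sd : separable_poly d.
  by apply: dvdp_separable (dvd _ Ip) _; rewrite separable_map.
have [|c] := closedK sd.
  (* A constant [d] could be scaled, within [R], to the relation 1. *)
  rewrite ltnNge; apply/negP => sd1; apply: rel_ideal_proper.
  have s0 : (size d).-1 = 0%N by case: (size d) sd1 => [|[]].
  have := rel_idealM (coefs_inC Rw) Id.
  by rewrite map_polyC /= wE [X in _ * X](size1_polyC sd1) s0 -polyCM mulVf // -s0.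
rewrite -dvdp_XsubCl => dc; exists c => q /dvd; rewrite -dvdp_XsubCl.
exact: dvdp_trans.
Qed.

(** The extension consists of the values at [(a, c)] of the polynomials with coefficients in [R]. It
    is single-valued because a polynomial whose first projection vanishes at [a] gives a relation,
    and [c] is a root of all relations. *)
Lemma partial_hom_step : exists R', [/\ partial_hom emb str J R', R `<=` R' & exists c, R' (a, c)].
Proof.
have [c cP] := rel_ideal_root; pose x : (A * K)%type := (a, c).
have RX y : R y -> exists q, coefs_in q /\ y = q.[x].
  by move=> Ry; exists y%:P; rewrite hornerC; split=> //; exact: coefs_inC.
exists [set y | exists q, coefs_in q /\ y = q.[x]]; split; [split| |].
- by move=> d; exact: RX.
- move=> _ _ [q [Rq ->]] [r [Rr ->]]; exists (q + r); rewrite hornerD.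
  by split=> //; exact: coefs_inD.
- move=> _ _ [q [Rq ->]] [r [Rr ->]]; exists (q * r); rewrite hornerM.
  by split=> //; exact: coefs_inM.
- by move=> b Jb; exact/RX/RJ.
- move=> d [q [Rq qE]].
  have q1 : (map_poly fst q).[a] = 0 by rewrite -[a]/(fst x) horner_map -qE.
  have /rootP := cP (map_poly snd q) (ex_intro _ q (And3 Rq q1 erefl)).
  by rewrite -[c]/(snd x) horner_map -qE.
- exact: RX.
- by exists c, 'X; rewrite hornerX; split=> //; exact: coefs_inX.
Qed.

End Step.

Lemma partial_hom_extend (R : set (A * K)) : partial_hom emb str J R ->
  exists h : {rmorphism A -> K}, forall a c, R (a, c) -> h a = c.
Proof.
move=> hR.
(* Zorn's lemma is applied to the sets whose union with [R] is a partial homomorphism, so that the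
   empty chain causes no exception and the maximal object contains [R]. *)
have [F FF|M [hM maxM]] := @Zorn_bigcup _ (fun S => partial_hom emb str J (R `|` S)).
  move=> totF; have key x y : (R `|` \bigcup_(X in F) X) x ->
      (R `|` \bigcup_(X in F) X) y -> exists S, [/\ partial_hom emb str J S, S x, S y &
        S `<=` R `|` \bigcup_(X in F) X].
    have inU X : F X -> R `|` X `<=` R `|` \bigcup_(X in F) X.
      by move=> FX z [Rz|Xz]; [left|right; exists X].
    move=> [Rx|[X FX Xx]] [Ry|[Y FY Yy]].
    - by exists R; split=> // z; left.
    - by exists (R `|` Y); split; [exact: FF|left|right|exact: inU].
    - by exists (R `|` X); split; [exact: FF|right|left|exact: inU].
    - have [XY|YX] := totF X Y FX FY.
        by exists (R `|` Y); split; [exact: FF|right; exact: XY|right|exact: inU].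
      by exists (R `|` X); split; [exact: FF|right|right; exact: YX|exact: inU].
  have [Rc RD RM RJ R0] := hR; split.
  - by move=> c; left.
  - by move=> x y Ux Uy; have [S [[_ SD _ _ _] Sx Sy]] := key x y Ux Uy; apply; exact: SD.
  - by move=> x y Ux Uy; have [S [[_ _ SM _ _] Sx Sy]] := key x y Ux Uy; apply; exact: SM.
  - by move=> a Ja; left; exact: RJ.
  - by move=> c Uc; have [S [[_ _ _ _ S0] Sx Sy]] := key _ _ Uc Uc => _; exact: S0.
set S := R `|` M in hM.
have /choice[h hS] a : exists c, S (a, c).
  have [S' [hS' SS' [c S'c]]] := partial_hom_step hM a.
  apply: contrapT => Nc; have RS' : R `|` S' = S'.
    by apply/setUidPr; apply: subset_trans SS' => x; left.
  apply: (maxM S'); last by rewrite RS'.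
  split; first by apply: subset_trans SS' => x; right.
  by move=> S'M; apply: Nc; exists c; right; exact: S'M.
have [Sc SD SM _ S0] := hM.
have SN x : S x -> S (- x).
  by move=> Sx; rewrite -mulN1r; apply: SM => //; have := Sc (-1); rewrite !rmorphN1.
have hU a c : S (a, c) -> h a = c.
  move=> Sac; apply/eqP; rewrite -subr_eq0; apply/eqP/S0.
  by have := SD _ _ (hS a) (SN _ Sac); congr S; congr pair; rewrite /= subrr.
have hB : zmod_morphism h by move=> a b; apply: hU; exact: (SD _ _ (hS a) (SN _ (hS b))).
have hMm : monoid_morphism h.
  split; first by apply: hU; have := Sc 1; rewrite !rmorph1.
  by move=> a b; apply: hU; exact: (SM _ _ (hS a) (hS b)).
by exists (mk_rmorphism hB hMm) => a c Rac; apply: hU; left.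
Qed.

End PartialHom.

(** * Separation of elements and the fixed field of the Galois group *)

Section Extension.
Variables (k : diffField) (K : sepClosure k).

(** The quotient of [A] by [J] is locally étale, expressed without forming the quotient. *)
Definition etale_mod (A : diffAlg k) (J : set A) : Prop :=
  forall a : A, exists2 p : {poly k}, separable_poly p & J (alg_eval p a).

Lemma sc_root (x : sc_field K) :
  exists2 p : {poly k}, separable_poly p & root (map_poly (sc_emb K) p) x.
Proof. exact: sc_separable. Qed.

Lemma alg_extend (A : diffAlg k) (J : set A) (R : set (A * K)) :
    is_ideal J -> etale_mod J -> partial_hom (sc_emb K) (da_struct A) J R ->
  exists h : algHom A K, forall a c, R (a, c) -> h a = c.
Proof.
move=> idJ etJ hR; have [A1|A1] := eqVneq (1 : A) 0.
  have [Rc _ _ _ R0] := hR; case/eqP: (oner_neq0 (sc_field K)); apply: R0.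
  by have := Rc 1; rewrite !rmorph1 A1.
have [|h hR'] := @partial_hom_extend k (sc_field K) (sc_emb K) (nonzero_ring A1)
    (da_struct A) J (@sc_closed k K) sc_root idJ _ R hR.
  by move=> a; have [p sp Jp] := etJ a; exists p => //; rewrite -alg_eval_horner.
have hs c : h (da_struct A c) = sc_emb K c by apply: hR'; case: hR.
by exists (@AlgHom k A K h hs).
Qed.

Lemma zero_ideal (A : diffAlg k) : is_ideal [set (0 : A)].
Proof.
by split=> // [x y /= -> ->|a x /= ->]; rewrite ?addr0 ?mulr0.
Qed.

Lemma etale_mod0 (A : diffAlg k) : locally_etale A -> etale_mod [set (0 : A)].
Proof. by move=> lA a; have [p sp pa] := lA a; exists p. Qed.

Lemma alg_eval_struct (A B : diffAlg k) (h : algHom A B) p a :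
  h (alg_eval p a) = alg_eval p (h a).
Proof.
by rewrite rmorph_sum; apply: eq_bigr => i _; rewrite rmorphM rmorphXn alg_str.
Qed.

(** Modulo [J], the element [e = a * s(a)] is idempotent and generates the same ideal as [a], so it
    is not in [J]. A homomorphism sending [e] to 1 cannot kill [a]. *)
Lemma alg_separate_mod (A : diffAlg k) (J : set A) (a : A) :
    is_ideal J -> etale_mod J -> ~ J a ->
  exists2 h : algHom A K, forall x, J x -> h x = 0 & h a != 0.
Proof.
move=> idJ etJ Ja; have [J0 JD JM] := idJ.
have [p sp Jp] := etJ a; have [s [u E]] := sep_regular sp.
pose e := a * alg_eval s a.
have Jae : J (a - a * e).
  have := JM (alg_eval u a) _ Jp; congr J.
  have := congr1 (fun q => alg_eval q a) E.
  rewrite alg_evalD !alg_evalM alg_evalX => E'.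
  by apply/esym/eqP; rewrite subr_eq [eqbRHS]addrC [alg_eval u a * _]mulrC /e mulrA -E'.
(* The elements that agree with a scalar on the component cut out by [e] are sent to this scalar.
   Two different scalars would put [e], hence [a], into [J]. *)
pose R : set (A * K) := [set z | exists c : k, z.2 = sc_emb K c /\ J (e * (z.1 - da_struct A c))].
have hR : partial_hom (sc_emb K) (da_struct A) J R.
  split.
  - by move=> c; exists c; rewrite subrr mulr0.
  - move=> [x1 x2] [y1 y2] [c [/= -> Jc]] [d [/= -> Jd]]; exists (c + d).
    split; first by rewrite /= rmorphD.
    by have := JD _ _ Jc Jd; congr J; rewrite /= rmorphD; ring.
  - move=> [x1 x2] [y1 y2] [c [/= -> Jc]] [d [/= -> Jd]]; exists (c * d).
    split; first by rewrite /= rmorphM.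
    have := JD _ _ (JM y1 _ Jc) (JM (da_struct A c) _ Jd); congr J; rewrite /= rmorphM; ring.
  - by move=> x Jx; exists 0; rewrite !rmorph0 subr0; split=> //; exact: JM.
  - move=> c [d [/= -> Jd]]; apply: contrapT => /eqP; rewrite fmorph_eq0 => d0.
    apply: Ja; rewrite -[a](subrK (a * e)); apply: JD => //; apply: (JM).
    have := JM (da_struct A (- d^-1)) _ Jd; congr J.
    by rewrite sub0r mulrCA -rmorphN -rmorphM mulNr mulrN opprK mulVf // rmorph1 mulr1.
have [h hE] := alg_extend idJ etJ hR; exists h.
  by move=> x Jx; apply: hE; case: hR => _ _ _ + _; apply.
have he : h (1 - e) = 0.
  apply: hE; exists 0; rewrite !rmorph0 subr0; split=> //.
  have := JM (alg_eval s a) _ Jae; congr J; rewrite /= /e; ring.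
apply: contra_eq_neq he; rewrite rmorphB rmorph1 rmorphM => ->.
by rewrite mul0r subr0 oner_eq0.
Qed.

Lemma alg_separate (A : diffAlg k) (a b : A) : locally_etale A ->
  (forall h : algHom A K, h a = h b) -> a = b.
Proof.
move=> lA hab; apply/eqP; rewrite -subr_eq0; apply/eqP; apply: contrapT => ab.
have [h _] := alg_separate_mod (zero_ideal A) (etale_mod0 lA) ab.
by rewrite rmorphB hab subrr eqxx.
Qed.

(** Surjectivity: [h] fixes the coefficients of a polynomial over [k] and carries a full list of its
    roots onto all its roots. *)
Lemma sc_hom_bij (h : algHom K K) : bijective h.
Proof.
have /choice[g gE] (y : sc_field K) : exists x, h x = y.
  have [p sp py] := sc_root y; have [rs rsP] := sc_roots K sp.
  have [|r _ ->] := rsP h y; last by exists r.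
  suff -> : map_poly (h \o sc_emb K) p = map_poly (sc_emb K) p by [].
  by apply: eq_map_poly => c /=; exact: (alg_str h c).
exists g; last exact: gE.
by move=> x; apply: (fmorph_inj h); rewrite gE.
Qed.

(** If [c] is not in [k], its minimal polynomial has a second root [c'], distinct from [c] by
    separability. The substitution of [c'] for [c] is a partial homomorphism on [k[c]]; its
    extension to [K] is an automorphism that moves [c]. *)
Lemma sc_fixed (c : sc_field K) : (forall g : galois K, g c = c) ->
  exists d, c = sc_emb K d.
Proof.
move=> fixc; apply: contrapT => Nc; have [p sp pc] := sc_root c.
have [m [m0 mc mmin]] : exists m : {poly k}, [/\ m != 0, root (map_poly (sc_emb K) m) c &
    forall q, q != 0 -> root (map_poly (sc_emb K) q) c -> (size m <= size q)%N].
  pose P n := `[< exists q : {poly k}, [/\ q != 0,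
    root (map_poly (sc_emb K) q) c & size q = n] >].
  have exP : exists n, P n.
    exists (size p); apply/asboolP; exists p; split=> //.
    exact: separable_poly_neq0.
  case: (ex_minnP exP) => _ /asboolP[m [m0 mc <-]] mmin; exists m; split=> // q q0 qc.
  by apply: mmin; apply/asboolP; exists q.
have dvdm q : root (map_poly (sc_emb K) q) c -> m %| q.
  move=> qc; rewrite /dvdp; apply: contraT => r0.
  suff /(mmin _ r0) : root (map_poly (sc_emb K) (q %% m)) c by rewrite leqNgt ltn_modp m0.
  move: qc; rewrite {1}(divp_eq q m) rmorphD rmorphM /=.
  by rewrite /root !hornerE (rootP mc) mulr0 add0r.
have sm : separable_poly m by exact: dvdp_separable (dvdm _ pc) sp.
have [q qE] := factor_theorem _ _ mc.
have q0 : q != 0 by apply: contraNneq m0 => q0; rewrite -(map_poly_eq0 (sc_emb K)) qE q0 mul0r.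
have sq : separable_poly q.
  have qm : q %| map_poly (sc_emb K) m by rewrite qE dvdp_mulr.
  by apply: dvdp_separable qm _; rewrite separable_map.
have size_q : size q = (size m).-1.
  by rewrite -(size_map_poly (sc_emb K) m) qE size_Mmonic ?monicXsubC // size_XsubC addn2.
(* Otherwise [m] would be linear and [c] would lie in [k]. *)
have q1 : (1 < size q)%N.
  rewrite size_q ltnNge; apply/negP => m2.
  have mE : m = (m`_1)%:P * 'X + (m`_0)%:P.
    apply/polyP => -[|[|i]]; rewrite coefD coefMX !coefC /= ?add0r ?addr0 //.
    by rewrite nth_default //; apply: leq_trans (leqSpred _) _; rewrite ltnS (leq_trans m2).
  have m1 : m`_1 != 0.
    apply: contraTneq mc => m1; move: m0; rewrite mE m1 polyC0 mul0r add0r map_polyC /=.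
    by rewrite rootC !fmorph_eq0.
  move: (mc); rewrite mE rmorphD rmorphM /= !map_polyC map_polyX /root !hornerE /=.
  rewrite addr_eq0 => /eqP mc'; apply: Nc; exists (- (m`_0 / m`_1)).
  rewrite rmorphN fmorph_div /=.
  by apply: (@mulfI _ (sc_emb K m`_1)); rewrite ?fmorph_eq0 //
    mulrN mulrCA mulfV ?fmorph_eq0 // mulr1.
have [c' qc'] := sc_closed sq q1.
have cc' : c' != c.
  apply: contraTneq sm => cc'; rewrite -(separable_map (sc_emb K)) qE.
  have /factor_theorem[t ->] := qc'; rewrite cc' -mulrA -expr2.
  apply/negP => st; have := separable_nosquare st (isT : 1 < 2)%N (_ : size ('X - c%:P) != 1%N).
  by rewrite size_XsubC dvdp_mull // => /(_ isT).
pose R : set (K * K) := [set z | exists s : {poly k},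
  z = ((map_poly (sc_emb K) s).[c], (map_poly (sc_emb K) s).[c'])].
have hR : partial_hom (sc_emb K) (da_struct K) [set 0] R.
  split.
  - by move=> d; exists d%:P; rewrite map_polyC !hornerC.
  - by move=> _ _ [s ->] [t ->]; exists (s + t); rewrite rmorphD !hornerD.
  - by move=> _ _ [s ->] [t ->]; exists (s * t); rewrite rmorphM !hornerM.
  - by move=> _ ->; exists 0; rewrite rmorph0 !horner0.
  - move=> d [s [s0 ->]]; have /dvdm : root (map_poly (sc_emb K) s) c by apply/rootP.
    move/dvdpP => [t ->]; rewrite rmorphM /= hornerM qE hornerM.
    by rewrite (rootP qc') mul0r mulr0.
have [h hE] := alg_extend (zero_ideal K) (etale_mod0 (@sc_letale k K)) hR.
have := fixc (Galois (sc_hom_bij h)); rewrite /= => hc; case/eqP: cc'; rewrite -hc.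
by apply/esym/hE; exists 'X; rewrite map_polyX !hornerX.
Qed.

End Extension.

(** * Closure properties of étale elements *)

Section EtaleClosure.
Variables (k : diffField) (K : sepClosure k).
Local Notation emb := (sc_emb K).

(** The least common multiple is separable because the two factors [e] and [gcdp p q] of the
    separable [q] are coprime, which makes [p] and [e] coprime. *)
Lemma sep_lcm (p q : {poly k}) : separable_poly p -> separable_poly q ->
  exists r : {poly k}, [/\ separable_poly r, p %| r & q %| r].
Proof.
move=> sp sq; pose e := q %/ gcdp p q.
have qE : e * gcdp p q = q by rewrite divpK ?dvdp_gcdr.
have eq : e %| q by rewrite -qE dvdp_mulr.
exists (p * e); split; last 2 first.
- exact: dvdp_mulr.
- by rewrite -{1}qE mulrC dvdp_mul ?dvdp_gcdl.
rewrite separable_mul sp (dvdp_separable eq sq) /=.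
have [/(_ e (gcdp p q)) + _] := separable_polyP sq.
rewrite qE dvdpp => /(_ isT)/coprimepP cop; apply/coprimepP => d dp de.
by apply: cop => //; rewrite dvdp_gcd dp (dvdp_trans de eq).
Qed.

Lemma sep_roots (s : seq (sc_field K)) : exists2 r : {poly k}, separable_poly r &
  forall x, x \in s -> root (map_poly emb r) x.
Proof.
elim: s => [|x s [r sr rs]].
  by exists 1 => //; rewrite unlock coprime1p.
have [p sp px] := sc_root x; have [t [st pt rt]] := sep_lcm sp sr; exists t => //.
have root_dvd u y : u %| t -> root (map_poly emb u) y -> root (map_poly emb t) y.
  by rewrite -(dvdp_map emb) -!dvdp_XsubCl => ut yu; exact: dvdp_trans ut.
by move=> y; rewrite inE => /predU1P[->|/rs/(root_dvd _ _ rt)//]; apply: root_dvd pt _.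
Qed.

Lemma sc_roots_dvd (p : {poly k}) : separable_poly p ->
  exists rs : seq (sc_field K),
    [/\ (size rs).+1 = size p, uniq rs, root (map_poly emb p) =1 [in rs] &
      forall f : {poly sc_field K}, (forall x, x \in rs -> root f x) -> map_poly emb p %| f].
Proof.
move=> sp; have smp : separable_poly (map_poly emb p) by rewrite separable_map.
have [rs pE l0] := sc_split smp; exists rs.
have srs : separable_poly (\prod_(r <- rs) ('X - r%:P)).
  by apply: dvdp_separable smp; rewrite [X in _ %| X]pE dvdpZr.
split.
- by rewrite -(size_map_poly emb) pE size_scale // size_prod_XsubC.
- by rewrite -separable_prod_XsubC.
- by move=> x; rewrite pE rootZ // root_prod_XsubC.
- move=> f fr; rewrite pE dvdpZl //; apply: uniq_roots_dvdp; first exact/allP.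
  by rewrite uniq_rootsE -separable_prod_XsubC.
Qed.

(** Here [p] concerns the inner variable and [q] the outer one. The remainder of [G] modulo [q] has
    degree less than the number of roots of [q], so it vanishes identically at each root of [p];
    each of its coefficients is then divisible by [p]. *)
Lemma bivariate_nullstellensatz (p q : {poly k}) (G : {poly {poly k}}) :
    separable_poly p -> separable_poly q ->
    (forall x y, root (map_poly emb p) x -> root (map_poly emb q) y ->
      (map_poly (horner_eval x \o map_poly emb) G).[y] = 0) ->
  exists U V, G = U * map_poly polyC q + p%:P * V.
Proof.
move=> sp sq G0; set q' := map_poly polyC q.
have lq : lead_coef q' \is a GRing.unit.
  by rewrite lead_coef_map rmorph_unit // unitfE lead_coef_eq0 separable_poly_neq0.
have sq' : size q' = size q by rewrite size_map_poly.
have GE := Pdiv.IdomainUnit.divp_eq lq G.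
have [rq [srq uq rqE _]] := sc_roots_dvd sq; have [rp [_ _ rpE rpd]] := sc_roots_dvd sp.
set R := G %% q' in GE *.
have sR : (size R < size q)%N.
  by rewrite -sq' ltn_modp -size_poly_eq0 sq' size_poly_eq0 separable_poly_neq0.
have R0 x : x \in rp -> map_poly (horner_eval x \o map_poly emb) R = 0.
  move=> xp; apply: (@roots_geq_poly_eq0 _ (map_poly (horner_eval x \o map_poly emb) R) rq _ uq).
    apply/allP => y yq; apply/rootP.
    have := G0 x y; rewrite rpE rqE /= xp yq => /(_ isT isT).
    rewrite GE rmorphD rmorphM hornerD hornerM -/R /= -map_poly_comp.
    rewrite (eq_map_poly (_ : _ =1 emb)) => [|c]; last first.
      by rewrite /= map_polyC /= horner_evalE hornerC.
    by rewrite (rootP (_ : root (map_poly emb q) y)) ?mulr0 ?add0r ?rqE.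
  by apply: leq_trans (size_poly _ _) _; rewrite -ltnS srq.
have dR j : p %| R`_j.
  rewrite -(dvdp_map emb); apply: rpd => x xp; apply/rootP.
  by have /(congr1 (fun f : {poly _} => f`_j)) := R0 x xp; rewrite coef_map coef0.
exists (G %/ q'), (\poly_(j < size R) (R`_j %/ p)).
rewrite {1}GE; congr (_ + _); apply/polyP => j; rewrite coefCM coef_poly.
case: ltnP => [_|jR]; first by rewrite mulrC divpK.
by rewrite mulr0 nth_default.
Qed.

Definition eval2 (B : comNzRingType) (t : {rmorphism k -> B}) (x y : B) : {poly {poly k}} -> B :=
  horner_eval y \o map_poly (horner_eval x \o map_poly t).

HB.instance Definition _ B t x y := GRing.RMorphism.on (@eval2 B t x y).

Lemma eval2_comp (B : comNzRingType) (t : {rmorphism k -> B}) x y r F :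
  eval2 t x y (map_poly (polyC \o polyC) r).[F] = (map_poly t r).[eval2 t x y F].
Proof.
rewrite -horner_map -map_poly_comp; congr (_.[_]); apply: eq_map_poly => c /=.
by rewrite /eval2 /= map_polyC /= horner_evalE hornerC horner_evalE map_polyC hornerC.
Qed.

(** Take [r] separable over [k] and vanishing at the values of [F] on all pairs of roots of [p] and
    [q]. Then [r(F)] lies in the ideal generated by [p] and [q], whose values at [(x, y)] are in
    [J]. *)
Lemma etale_eval2 (B : comNzRingType) (t : {rmorphism k -> B}) (J : set B) x y
    (p q : {poly k}) F :
    is_ideal J -> separable_poly p -> separable_poly q ->
    J (map_poly t p).[x] -> J (map_poly t q).[y] ->
  exists2 r : {poly k}, separable_poly r & J (map_poly t r).[eval2 t x y F].
Proof.
move=> [_ JD JM] sp sq Jp Jq.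
have [rp [_ _ rpE _]] := sc_roots_dvd sp; have [rq [_ _ rqE _]] := sc_roots_dvd sq.
have [r sr rE] := sep_roots [seq eval2 emb u v F | u <- rp, v <- rq]; exists r => //.
have [|U [V E]] := bivariate_nullstellensatz (G := (map_poly (polyC \o polyC) r).[F]) sp sq.
  move=> u v; rewrite rpE rqE => ur vr.
  have := eval2_comp emb u v r F; rewrite /eval2 /= horner_evalE => ->.
  by apply/rootP/rE/allpairs_f.
rewrite -eval2_comp E rmorphD !rmorphM /=; apply: JD.
  have := JM (eval2 t x y U) _ Jq; congr J; congr (_ * _).
  rewrite /eval2 /= horner_evalE -map_poly_comp; congr (_.[_]); apply: eq_map_poly => c /=.
  by rewrite map_polyC /= horner_evalE hornerC.
have := JM (eval2 t x y V) _ Jp; rewrite mulrC; congr J; congr (_ * _).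
by rewrite /eval2 /= map_polyC /= !horner_evalE hornerC.
Qed.

Lemma etale_modDM (A : diffAlg k) (J : set A) (a b : A) (p q : {poly k}) :
    is_ideal J -> separable_poly p -> separable_poly q ->
    J (alg_eval p a) -> J (alg_eval q b) ->
  (exists2 r : {poly k}, separable_poly r & J (alg_eval r (a + b))) /\
  (exists2 r : {poly k}, separable_poly r & J (alg_eval r (a * b))).
Proof.
move=> idJ sp sq; have [J0 _ _] := idJ.
have [A1|A1] := eqVneq (1 : A) 0.
  by split; exists p => //; rewrite (zero_ring_eq A1 (alg_eval p _) 0).
rewrite !(alg_eval_horner A1) => Jp Jq.
have eX : eval2 (da_struct A : {rmorphism k -> nonzero_ring A1}) a b 'X%:P = a.
  by rewrite /eval2 /= map_polyC /= !horner_evalE hornerC map_polyX hornerX.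
have eY : eval2 (da_struct A : {rmorphism k -> nonzero_ring A1}) a b 'X = b.
  by rewrite /eval2 /= map_polyX horner_evalE hornerX.
split.
  have [r sr Jr] := @etale_eval2 (nonzero_ring A1) (da_struct A) J a b p q
    ('X%:P + 'X) idJ sp sq Jp Jq; exists r => //.
  by rewrite (alg_eval_horner A1); rewrite rmorphD /= eX eY in Jr.
have [r sr Jr] := @etale_eval2 (nonzero_ring A1) (da_struct A) J a b p q
    ('X%:P * 'X) idJ sp sq Jp Jq; exists r => //.
by rewrite (alg_eval_horner A1); rewrite rmorphM /= eX eY in Jr.
Qed.

Lemma etale_mod_subalgebra (A : diffAlg k) (J : set A) : is_ideal J ->
  subalgebra [set a : A | exists2 r : {poly k}, separable_poly r & J (alg_eval r a)].
Proof.
move=> idJ; split.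
- move=> c; exists ('X - c%:P).
    by rewrite unlock derivXsubC coprimep1.
  have -> : alg_eval ('X - c%:P) (da_struct A c) = 0; last by case: idJ.
  by rewrite -polyCN alg_evalD alg_evalX alg_evalC rmorphN subrr.
- move=> x y [p sp Jp] [q sq Jq]; exact: (etale_modDM idJ sp sq Jp Jq).1.
- move=> x y [p sp Jp] [q sq Jq]; exact: (etale_modDM idJ sp sq Jp Jq).2.
Qed.

End EtaleClosure.

(** * Locally constant functions on compact spaces and descent *)

(** Passage from local to global. If [P] failed for the whole space, the sets with complement in [P]
    would form a proper filter, and a cluster point of it would contradict the local hypothesis. *)
Lemma compact_ind (X : topologicalType) (P : set X -> Prop) :
    compact [set: X] -> P set0 ->
    (forall U V, U `<=` V -> P V -> P U) ->
    (forall U V, P U -> P V -> P (U `|` V)) ->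
    (forall x : X, exists2 U : set X, nbhs x U & P U) ->
  P setT.
Proof.
move=> cX P0 PS PU PN; apply: contrapT => PT.
pose F : set (set X) := [set U | P (~` U)].
have FF : ProperFilter F.
  split; first by rewrite /F /= setC0.
  split.
  - by rewrite /F /= setCT.
  - by move=> U V FU FV; rewrite /F /= setCI; exact: PU.
  - by move=> U V UV; apply: PS; exact: subsetC.
have [|x [_ xF]] := cX F FF; first by rewrite /F /= setCT.
have [U xU PU'] := PN x; have FU : F (~` U) by rewrite /F /= setCK.
by have [y [yNU yU]] := xF _ _ FU xU.
Qed.

(** Continuity for the discrete topology on [T], stated so that [T] needs no structure. *)
Definition loc_const (X : topologicalType) (T : Type) (f : X -> T) : Prop :=
  forall x, \forall y \near x, f y = f x.

Section LocConst.
Variable X : topologicalType.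

Lemma loc_const_comp (T U : Type) (f : X -> T) (g : T -> U) :
  loc_const f -> loc_const (g \o f).
Proof. by move=> lf x; apply: filterS (lf x) => y /= ->. Qed.

Lemma loc_const_pair (T U : Type) (f : X -> T) (g : X -> U) :
  loc_const f -> loc_const g -> loc_const (fun x => (f x, g x)).
Proof. by move=> lf lg x; apply: filterS2 (lf x) (lg x) => y -> ->. Qed.

Lemma loc_const_continuous (Y : topologicalType) (T : Type) (f : Y -> T) (g : X -> Y) :
  continuous g -> loc_const f -> loc_const (f \o g).
Proof. by move=> cg lf x; exact: (cg x _ (lf (g x))). Qed.

Lemma loc_const_open (T : Type) (f : X -> T) (P : set T) :
  loc_const f -> open (f @^-1` P).
Proof.
by move=> lf; rewrite openE => x Px; apply: filterS (lf x) => y /= ->.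
Qed.

Lemma open_loc_const (T : Type) (f : X -> T) :
  (forall c, open (f @^-1` [set c])) -> loc_const f.
Proof. by move=> of_ x; apply: open_nbhs_nbhs; split=> //; exact: of_. Qed.

Lemma loc_const_finite (T : eqType) (f : X -> T) : compact [set: X] -> loc_const f ->
  exists s : seq T, forall x, f x \in s.
Proof.
move=> cX lf; have := @compact_ind X (fun U => exists s : seq T, forall x, U x -> f x \in s) cX.
case.
- by exists [::].
- by move=> U V UV [s sV]; exists s => x /UV/sV.
- move=> U V [s sU] [t tV]; exists (s ++ t) => x; rewrite mem_cat.
  by case=> [/sU->|/tV->]; rewrite ?orbT.
- by move=> x; exists [set y | f y = f x]; [exact: lf|exists [:: f x] => y ->; rewrite inE].
by move=> s sf; exists s => x; exact: sf.
Qed.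

End LocConst.

Lemma compact_inverse_continuous (X Y : topologicalType) (f : X -> Y) (g : Y -> X) :
    compact [set: X] -> hausdorff_space Y -> continuous f ->
    cancel f g -> cancel g f ->
  continuous g.
Proof.
move=> cX hY cf fK gK; apply/continuous_closedP => U cU.
have -> : g @^-1` U = f @` U.
  by apply/seteqP; split=> [y Uy|_ [x Ux <-]]; [exists (g y)|rewrite /= fK].
apply: compact_closed => //; apply: continuous_compact.
  by apply: continuous_subspaceT.
exact: subclosed_compact cU cX _.
Qed.

Section StoneWeierstrass.
Variables (X : topologicalType) (F : fieldType) (V : set (X -> F)).
Hypotheses (cX : compact [set: X]) (Vcst : forall c, V (fun=> c))
  (VD : forall u v, V u -> V v -> V (fun x => u x + v x))
  (VM : forall u v, V u -> V v -> V (fun x => u x * v x))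
  (Vlc : forall u, V u -> loc_const u)
  (Vsep : forall x y, x <> y -> exists2 u, V u & u x != u y).

Let VB u v : V u -> V v -> V (fun x => u x - v x).
Proof.
move=> Vu Vv; have := VD Vu (VM (Vcst (-1)) Vv); congr V.
by apply/funext => x; rewrite mulN1r.
Qed.

(** Lagrange interpolation over the finitely many values of [u]. *)
Lemma sw_indicator u c : V u -> exists2 e, V e &
  forall x, e x = (u x == c)%:R.
Proof.
move=> Vu; have [s us] := loc_const_finite cX (Vlc Vu).
suff [e Ve eE] : exists2 e, V e & forall x, u x \in c :: s -> e x = (u x == c)%:R.
  by exists e => // x; apply: eE; rewrite inE us orbT.
elim: (s) => [|d t [e Ve eE]].
  by exists (fun=> 1) => // x; rewrite inE => ->.
have [dc|dc] := eqVneq d c.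
  exists e => // x; rewrite !inE dc => ut; apply: eE; rewrite inE.
  by case/or3P: ut => ->; rewrite ?orbT.
exists (fun x => e x * ((u x - d) * (c - d)^-1)).
  by apply: VM => //; apply: VM => //; exact: VB.
move=> x; rewrite !inE; have [->|ud] /= := eqVneq (u x) d.
  by rewrite subrr mul0r mulr0 (negPf dc).
move=> ut; rewrite eE ?inE //; have [->|_] := eqVneq (u x) c; last by rewrite mul0r.
by rewrite mulfV ?mulr1 // subr_eq0 eq_sym.
Qed.

Lemma stone_weierstrass (f : X -> F) : loc_const f -> V f.
Proof.
move=> lf.
(* An idempotent of [V] equal to 1 at [x] and supported where [f] takes the value [f x]; its product
   with [f] is its product with a constant. *)
have loc x : exists e, [/\ V e, forall y, e y = 0 \/ e y = 1, e x = 1 &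
    forall y, f y <> f x -> e y = 0].
  have := @compact_ind X (fun U => exists e, [/\ V e, forall y, e y = 0 \/ e y = 1, e x = 1 &
    forall y, U y -> f y <> f x -> e y = 0]) cX; case.
  - by exists (fun=> 1); split=> //; right.
  - by move=> U W UW [e [Ve e01 ex eW]]; exists e; split=> // y /UW; exact: eW.
  - move=> U W [e [Ve e01 ex eU]] [d [Vd d01 dx dW]]; exists (fun y => e y * d y); split.
    + exact: VM.
    + move=> y; case: (e01 y) => ->; first by left; rewrite mul0r.
      by case: (d01 y) => ->; [left|right]; rewrite mul1r.
    + by rewrite ex dx mulr1.
    + by move=> y [Uy|Wy] fy; [rewrite eU // mul0r|rewrite dW // mulr0].
  - move=> y; have [fyx|fyx] := pselect (f y = f x).
      exists [set z | f z = f y]; first exact: lf.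
      by exists (fun=> 1); split=> //; [right|move=> z /= -> /(_ fyx)].
    have [|u Vu uxy] := Vsep (x := x) (y := y); first by move=> xy; apply: fyx; rewrite xy.
    have [e Ve eE] := sw_indicator (u x) Vu.
    exists [set z | u z = u y]; first exact: (Vlc Vu).
    exists e; split=> //.
    + by move=> z; rewrite eE; case: (_ == _); [right|left].
    + by rewrite eE eqxx.
    + by move=> z /= uz _; rewrite eE uz eq_sym (negPf uxy).
  by move=> e [Ve e01 ex eT]; exists e; split=> // y; exact: eT.
(* Two local solutions [e] and [d] are glued by [e + (1 - e) * d], which is 1 where either of them
   is. *)
have := @compact_ind X (fun U => exists e, [/\ V e, forall y, U y -> e y = 1 &
  V (fun y => e y * f y)]) cX; case.
- by exists (fun=> 0); split=> //; have := Vcst 0; congr V; apply/funext => y; rewrite mul0r.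
- by move=> U W UW [e [Ve eW Vef]]; exists e; split=> // y /UW; exact: eW.
- move=> U W [e [Ve eU Vef]] [d [Vd dW Vdf]].
  exists (fun y => e y + (1 - e y) * d y); split.
  + by apply: VD => //; apply: VM => //; exact: VB.
  + move=> y [Uy|Wy]; first by rewrite eU // subrr mul0r addr0.
    by rewrite dW // mulr1 addrC subrK.
  + have := VD Vef (VM (VB (Vcst 1) Ve) Vdf); congr V.
    by apply/funext => y /=; ring.
- move=> x; have [e [Ve e01 ex eN]] := loc x; exists [set y | e y = e x].
    exact: (Vlc Ve).
  exists e; split=> //; first by move=> y /= ->.
  have := VM Ve (Vcst (f x)); congr V; apply/funext => y.
  have [->//|fy] := pselect (f y = f x); by rewrite eN // !mul0r.
by move=> e [Ve eT Vef]; have := Vef; congr V; apply/funext => y; rewrite eT // mul1r.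
Qed.

End StoneWeierstrass.

Section Descent.
Variables (k : diffField) (K : sepClosure k) (A : diffAlg k).
Hypothesis lA : locally_etale A.

Lemma eval_loc_const (a : A) : loc_const (fun h : algHom A K => h a).
Proof. by apply: open_loc_const => c; exact: (@alg_open_eq k A K a (fun x => x = c) lA). Qed.

(** Stone-Weierstrass writes [f] as a combination of elements of [S] with coefficients in [K]. If a
    coefficient is not in [k], some [g] moves it, and equivariance of [f] gives a second expression
    with conjugated coefficients; a combination of the two is shorter. *)
Lemma galois_descent (S : set A) (f : algHom A K -> K) :
    subalgebra S ->
    (forall x y : algHom A K, (forall a, S a -> x a = y a) -> x = y) ->
    loc_const f -> (forall (g : galois K) x, f (alg_comp g x) = g (f x)) ->
  exists2 a, S a & forall x : algHom A K, f x = x a.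
Proof.
move=> [Sc SD SM] Ssep lf fG.
pose lin (s : seq (sc_field K * A)) (h : algHom A K) : sc_field K :=
  \sum_(z <- s) z.1 * h z.2.
pose V : set (algHom A K -> sc_field K) :=
  [set v | exists2 s, forall z, z \in s -> S z.2 & v = lin s].
have S1 : S 1 by have := Sc 1; rewrite rmorph1.
have linD s t h : lin (s ++ t) h = lin s h + lin t h by rewrite /lin big_cat.
have [s0 sS0 fE0] : V f.
  apply: stone_weierstrass lf.
  - exact: algHom_compact.
  - move=> c; exists [:: (c, 1)]; first by move=> z; rewrite inE => /eqP ->.
    by apply/funext => h; rewrite /lin big_seq1 rmorph1 mulr1.
  - move=> _ _ [s sS ->] [t tS ->]; exists (s ++ t).
      by move=> z; rewrite mem_cat => /orP[/sS|/tS].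
    by apply/funext => h; rewrite linD.
  - move=> _ _ [s sS ->] [t tS ->].
    exists [seq (z.1 * w.1, z.2 * w.2) | z <- s, w <- t].
      by move=> _ /allpairsP[[z w] /= [/sS Sz /tS Sw ->]]; exact: SM.
    apply/funext => h; rewrite /lin big_allpairs_dep big_distrl /=; apply: eq_bigr => z _.
    by rewrite big_distrr; apply: eq_bigr => w _; rewrite /= rmorphM mulrACA.
  - move=> _ [s _ ->] h; rewrite /lin; elim: s => [|z s IH].
      by apply: filterE => h'; rewrite !big_nil.
    by apply: filterS2 IH (eval_loc_const z.2 h) => h'; rewrite !big_cons => -> ->.
  - move=> x y xy; have [a Sa axy] : exists2 a, S a & x a <> y a.
      apply: contrapT => N; apply: xy; apply: Ssep => a Sa; apply: contrapT => axy.
      by apply: N; exists a.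
    exists (fun h : algHom A K => h a); last exact/eqP.
    exists [:: (1, a)]; first by move=> z; rewrite inE => /eqP ->.
    by apply/funext => h; rewrite /lin big_seq1 mul1r.
have [n] := ubnP (size s0); elim: n s0 sS0 fE0 => // n IH s sS fE sn.
have [allk|] := pselect (forall z, z \in s -> exists d, z.1 = sc_emb K d).
  clear IH sn; suff [a Sa aE] : exists2 a, S a & forall x, lin s x = x a.
    by exists a => // x; rewrite fE.
  elim: s {fE} sS allk => [|z s IH] sS allk.
    exists 0; first by have := Sc 0; rewrite rmorph0.
    by move=> x; rewrite rmorph0 /lin big_nil.
  have [||a Sa aE] := IH.
  - by move=> w ws; apply: sS; rewrite inE ws orbT.
  - by move=> w ws; apply: allk; rewrite inE ws orbT.
  have [d dE] := allk z (mem_head _ _); exists (da_struct A d * z.2 + a).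
    by apply: SD => //; apply: SM => //; apply: sS; exact: mem_head.
  by move=> x; rewrite /lin big_cons -/(lin s x) aE rmorphD rmorphM alg_str -dE.
move=> /existsNP[z /not_implyP[zs zk]].
have [g gz] : exists g : galois K, g z.1 <> z.1.
  by apply: contrapT => /forallNP N; apply/zk/sc_fixed => g; exact: contrapT.
have {}gz : g z.1 - z.1 != 0 by rewrite subr_eq0; exact/eqP.
set t := rem z s; have ts : perm_eq s (z :: t) by exact: perm_to_rem.
have fE' x : f x = z.1 * x z.2 + lin t x.
  by rewrite fE /lin (perm_big _ ts) /= big_cons.
have gE x : f x = g z.1 * x z.2 + lin [seq (g w.1, w.2) | w <- t] x.
  pose y := alg_comp (gal_inv g) x.
  have -> : x = alg_comp g y by apply: algHom_eq => a; rewrite /= gal_Kinv.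
  rewrite fG fE' rmorphD rmorphM /lin rmorph_sum big_map; congr (_ + _).
  by apply: eq_bigr => w _; rewrite rmorphM.
(* Chosen so that [(1 - c) * z.1 + c * g z.1 = 0]. *)
pose c := - (z.1 / (g z.1 - z.1)).
(* eliminate the term of z between the two expressions of f *)
pose u := [seq ((1 - c) * w.1 + c * g w.1, w.2) | w <- t].
apply: (IH u).
- by move=> _ /mapP[w wt ->] /=; apply: sS; rewrite (perm_mem ts) inE wt orbT.
- apply/funext => x.
  have -> : f x = (1 - c) * f x + c * f x by rewrite -mulrDl subrK mul1r.
  rewrite {1}fE' gE !mulrDr addrACA !mulrA -mulrDl.
  have -> : (1 - c) * z.1 + c * g z.1 = 0.
    by rewrite mulrBl mul1r -addrA [- _ + _]addrC -mulrBr mulNr divfK ?subrr.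
  rewrite mul0r add0r /lin !big_map !mulr_sumr -big_split; apply: eq_bigr => w _ /=.
  ring.
- by rewrite size_map -ltnS (leq_trans _ sn) // (perm_size ts).
Qed.

End Descent.

(* In a compact Hausdorff space, the intersection of the clopen neighborhoods
   of a point is connected. *)
Lemma totally_disconnected_zero_dimensional (X : topologicalType) :
    compact [set: X] -> hausdorff_space X -> totally_disconnected [set: X] ->
  zero_dimensional X.
Proof.
move=> cX hX dX x y xy; apply: contrapT => Nxy.
pose Q := [set z | forall W : set X, clopen W -> W x -> W z].
have Qy : Q y.
  by move=> W cW Wx; apply: contrapT => Wy; apply: Nxy; exists W.
have Qx : Q x by [].
(* By compactness, every open set containing [Q] contains a clopen neighborhood of [x]. *)
have shrink (U : set X) : open U -> Q `<=` U ->
    exists W, [/\ clopen W, W x & W `<=` U].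
  move=> oU QU.
  have := @compact_ind X (fun Z => exists W, [/\ clopen W, W x & W `&` Z `<=` U]) cX; case.
  - by exists setT; split=> [|//|z [_ []]]; exact: clopenT.
  - by move=> Z T ZT [W [cW Wx WT]]; exists W; split=> // z [Wz /ZT Tz]; exact: WT.
  - move=> Z T [W [cW Wx WZ]] [W' [cW' Wx' WT]]; exists (W `&` W'); split=> //.
      exact: clopenI.
    by move=> z [[Wz Wz'] [Zz|Tz]]; [exact: WZ|exact: WT].
  - move=> z; have [Uz|Uz] := pselect (U z).
      exists U; first exact: open_nbhs_nbhs.
      by exists setT; split=> [|//|w []//]; exact: clopenT.
    have /existsNP[W /not_implyP[[oW cW] /not_implyP[Wx Wz]]] : ~ Q z by move/QU.
    exists (~` W); first by apply: open_nbhs_nbhs; split=> //; rewrite openC.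
    by exists W; split=> // w [].
  by move=> W [cW Wx WU]; exists W; split=> // z Wz; exact: WU.
suff cQ : connected Q.
  have : connected_component [set: X] x y by exists Q.
  by rewrite dX // => /esym/eqP; rewrite (negPf xy).
have clQ : closed Q.
  have -> : Q = \bigcap_(W in [set W : set X | clopen W /\ W x]) W.
    by apply/seteqP; split=> [z Qz W [cW Wx]|z Wz W cW Wx]; [exact: Qz|exact: Wz].
  by apply: closed_bigI => W [[]].
move=> B B0 [C oC BC] [D cD BD].
have clB : closed B by rewrite BD; exact: closedI.
have oB' : open (~` (Q `&` ~` C)).
  by rewrite openC; apply: closedI => //; exact: open_closedC.
(* Normality separates [B] from its relative complement in [Q], both being closed. *)
have /(_ B clB (~` (Q `&` ~` C))) := compact_normal hX cX.
case.
  apply/set_nbhsP; exists (~` (Q `&` ~` C)); split=> //.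
  by rewrite BC => z [Qz Cz] [_].
move=> N /set_nbhsP[U [oU BU UN]] NC.
have UV z : U z -> ~ closure N z -> False.
  by move=> Uz; apply; exact/subset_closure/UN.
have QUV : Q `<=` U `|` ~` closure N.
  move=> z Qz; have [Cz|Cz] := pselect (C z); first by left; apply: BU; rewrite BC.
  by right=> /NC; apply.
have oV : open (~` closure N) by rewrite openC; exact: closed_closure.
(* [W] is covered by the disjoint open sets [U] and the complement of [closure N], so it splits into
   two clopen pieces. The piece containing [x] contains [Q]: either [B] is all of [Q], or [B] is
   empty. *)
have [W [[oW cW] Wx WUV]] := shrink _ (openU oU oV) QUV.
have [Ux|Ux] := pselect (U x).
  have cWU : clopen (W `&` U).
    split; first exact: openI.
    rewrite (_ : W `&` U = W `&` ~` ~` closure N).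
      by apply: closedI => //; rewrite setCK; exact: closed_closure.
    apply/seteqP; split=> z [Wz Uz]; split=> //; first by move/(UV z Uz).
    by have [] := WUV z Wz.
  rewrite BC; apply/seteqP; split=> [z []//|z Qz]; split=> //.
  have [_ Uz] := Qz _ cWU (conj Wx Ux).
  apply: contrapT => Cz; exact: (NC _ (subset_closure (UN _ Uz))).
have cWV : clopen (W `&` ~` closure N).
  split; first exact: openI.
  rewrite (_ : W `&` _ = W `&` ~` U).
    by apply: closedI => //; exact: open_closedC.
  apply/seteqP; split=> z [Wz Nz]; split=> //; first by move=> Uz; exact: UV Uz Nz.
  by have [] := WUV z Wz.
have Vx : (~` closure N) x by have [] := WUV x Wx.
have [z Bz] := B0; have Qz : Q z by move: Bz; rewrite BC => -[].
by have [_ Nz] := Qz _ cWV (conj Wx Vx); case: Nz; apply/subset_closure/UN/BU.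
Qed.

(** * Equivariant functions *)

Lemma clopen_loc_const (X : topologicalType) (U : set X) : clopen U -> loc_const U.
Proof.
move=> [oU cU] x; have [Ux|Ux] := pselect (U x).
  by apply: filterS (open_nbhs_nbhs (conj oU Ux)) => y Uy; apply/propext.
have oC : open (~` U) by rewrite openC.
by apply: filterS (open_nbhs_nbhs (conj oC Ux)) => y Uy; apply/propext.
Qed.

Section EquivariantFunctions.
Variables (k : diffField) (K : sepClosure k) (X : gProf K).

Definition equivariant : {pred X -> sc_field K} :=
  fun f => `[< loc_const f /\ forall (g : galois K) x, f (gp_act g x) = g (f x) >].

Lemma equivariantP f : reflect
  (loc_const f /\ forall (g : galois K) x, f (gp_act g x) = g (f x)) (f \in equivariant).
Proof. exact: asboolP. Qed.

Fact equivariant_subring : subring_closed equivariant.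
Proof.
split.
- by apply/equivariantP; split=> [x|g x]; [exact: filterE|rewrite /= rmorph1].
- move=> u v /equivariantP[lu gu] /equivariantP[lv gv]; apply/equivariantP; split.
    exact: loc_const_comp (fun z => z.1 - z.2) (loc_const_pair lu lv).
  by move=> g x; rewrite -[LHS]/(u _ - v _) gu gv -rmorphB.
- move=> u v /equivariantP[lu gu] /equivariantP[lv gv]; apply/equivariantP; split.
    exact: loc_const_comp (fun z => z.1 * z.2) (loc_const_pair lu lv).
  by move=> g x; rewrite -[LHS]/(u _ * v _) gu gv -rmorphM.
Qed.
HB.instance Definition _ :=
  GRing.isSubringClosed.Build (X -> sc_field K) equivariant equivariant_subring.

Record eqv := Eqv { eqv_fun :> X -> sc_field K; eqv_proof : eqv_fun \in equivariant }.
HB.instance Definition _ := [isSub for eqv_fun].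
HB.instance Definition _ := [Choice of eqv by <:].
HB.instance Definition _ := GRing.SubChoice_isSubComPzRing.Build (X -> sc_field K)
  equivariant eqv equivariant_subring.

Lemma eqv_eq (u v : eqv) : u =1 v -> u = v.
Proof. by move=> uv; apply: val_inj; exact/funext. Qed.

Lemma eqv_loc_const (u : eqv) : loc_const u.
Proof. by have /equivariantP[] := eqv_proof u. Qed.

Lemma eqv_act (u : eqv) (g : galois K) x : u (gp_act g x) = g (u x).
Proof. by have /equivariantP[_] := eqv_proof u; apply. Qed.

Definition mk_eqv f (lf : loc_const f)
    (gf : forall (g : galois K) x, f (gp_act g x) = g (f x)) : eqv :=
  Eqv (introT (equivariantP f) (conj lf gf)).

Fact eqv_sigma_lc (u : eqv) : loc_const (fun x => sc_sigma K (u (dp_sigma x))).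
Proof.
apply: loc_const_comp; apply: loc_const_continuous (eqv_loc_const u).
exact: dp_sigma_continuous.
Qed.

Fact eqv_sigma_act (u : eqv) (g : galois K) x :
  sc_sigma K (u (dp_sigma (gp_act g x))) = g (sc_sigma K (u (dp_sigma x))).
Proof. by rewrite gp_act_sigma eqv_act -[LHS]gal_sigmaE. Qed.

(** The twist by [gal_sigma] coming from [dp_sigma] is undone when [g] moves past [sc_sigma K]; this
    is why both endomorphisms enter. *)
Definition eqv_sigma_fun (u : eqv) : eqv := mk_eqv (@eqv_sigma_lc u) (@eqv_sigma_act u).

Fact eqv_sigma_zmod : zmod_morphism eqv_sigma_fun.
Proof. by move=> u v; apply: eqv_eq => x /=; rewrite rmorphB. Qed.

Fact eqv_sigma_monoid : monoid_morphism eqv_sigma_fun.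
Proof.
by split=> [|u v]; apply: eqv_eq => x /=; rewrite ?rmorph1 ?rmorphM.
Qed.

Fact eqv_struct_lc (c : k) : loc_const (fun _ : X => sc_emb K c).
Proof. by move=> x; exact: filterE. Qed.

Fact eqv_struct_act c (g : galois K) (x : X) : sc_emb K c = g (sc_emb K c).
Proof. by rewrite [RHS](alg_str g c). Qed.

Definition eqv_struct_fun c : eqv := mk_eqv (@eqv_struct_lc c) (@eqv_struct_act c).

Fact eqv_struct_zmod : zmod_morphism eqv_struct_fun.
Proof. by move=> u v; apply: eqv_eq => x /=; rewrite rmorphB. Qed.

Fact eqv_struct_monoid : monoid_morphism eqv_struct_fun.
Proof.
by split=> [|u v]; apply: eqv_eq => x /=; rewrite ?rmorph1 ?rmorphM.
Qed.

Definition eqv_sigma : {rmorphism eqv -> eqv} :=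
  mk_rmorphism eqv_sigma_zmod eqv_sigma_monoid.
Definition eqv_struct : {rmorphism k -> eqv} :=
  mk_rmorphism eqv_struct_zmod eqv_struct_monoid.

Fact eqv_compat c : eqv_sigma (eqv_struct c) = eqv_struct (df_sigma k c).
Proof. by apply: eqv_eq => x /=; exact: sc_compat. Qed.

Definition eqv_alg : diffAlg k := DiffAlg eqv_compat.

Definition eqv_eval_fun (x : X) (u : eqv_alg) : K := u x.

Fact eqv_eval_zmod x : zmod_morphism (eqv_eval_fun x).
Proof. by []. Qed.
Fact eqv_eval_monoid x : monoid_morphism (eqv_eval_fun x).
Proof. by []. Qed.
Definition eqv_eval (x : X) : algHom eqv_alg K :=
  mk_algHom (eqv_eval_zmod x) (eqv_eval_monoid x) (fun _ => erefl).

(** An equivariant function has finitely many values, and one separable polynomial over [k] vanishes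
    at all of them. *)
Lemma eqv_etale : locally_etale eqv_alg.
Proof.
move=> u; have [s us] := loc_const_finite (dp_compact (d := X)) (eqv_loc_const u).
have [r sr rs] := sep_roots s; exists r => //; apply: eqv_eq => x.
rewrite -[LHS]/(eqv_eval x _) alg_eval_struct -[RHS]/(0 : sc_field K); have /rootP := rs _ (us x).
rewrite horner_coef size_map_poly => <-.
by apply: eq_bigr => i _; rewrite coef_map.
Qed.

Definition eqv_let : letAlg k := LetAlg eqv_etale.

(** The convention that 0 has inverse 0 makes this a quasi-inverse, still locally constant and
    equivariant. *)
Lemma eqv_inverse (u : eqv) : exists v : eqv, forall x, v x = (u x)^-1.
Proof.
have lv : loc_const (fun x => (u x)^-1).
  exact: loc_const_comp (fun z => z^-1) (eqv_loc_const u).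
have gv (g : galois K) x : (u (gp_act g x))^-1 = g (u x)^-1.
  by rewrite eqv_act fmorphV.
by exists (mk_eqv lv gv).
Qed.

(** Where some [u] in [I] does not vanish, a multiple of it is locally 1. If this happened at every
    point, compactness and the gluing [u + (1 - u) * v] would give 1 in [I]. *)
Lemma ideal_common_zero (I : set eqv_alg) : is_ideal I -> ~ I 1 ->
  exists x, forall u, I u -> u x = 0.
Proof.
move=> [I0 ID IM] I1; apply: contrapT => /forallNP N; apply: I1.
have := @compact_ind X (fun U => exists2 u : eqv_alg, I u & forall x, U x -> u x = 1)
  (dp_compact (d := X)); case.
- by exists 0.
- by move=> U V UV [u Iu uV]; exists u => // x /UV/uV.
- move=> U V [u Iu uU] [v Iv vV]; exists (u + (1 - u) * v).
    by apply: ID => //; exact: IM.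
  move=> x Wx; rewrite -[LHS]/(u x + (1 - u x) * v x).
  by case: Wx => [/uU|/vV] ->; rewrite ?subrr ?mul0r ?addr0 // mulr1 addrC subrK.
- move=> x; have /existsNP[u /not_implyP[Iu /eqP ux]] := N x.
  exists [set y | u y = u x]; first exact: eqv_loc_const.
  have [v vE] := eqv_inverse u; exists (v * u); first exact: IM.
  by move=> y uy; rewrite -[LHS]/(v y * u y) vE uy mulVf.
move=> u Iu uT; suff -> : 1 = u by [].
by apply: eqv_eq => x; rewrite uT.
Qed.

(** Let [x] be a common zero of the kernel of [h]. Sending [h u] to [u x] is a well-defined partial
    homomorphism of [K]; it extends to an automorphism [g'], and [h] is evaluation at the translate
    of [x] by the inverse of [g']. *)
Lemma eqv_eval_surj (h : algHom eqv_alg K) : exists x, h = eqv_eval x.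
Proof.
have [||x xI] := @ideal_common_zero [set u | h u = 0].
- split=> /= [|u v hu hv|u v hv]; first by rewrite rmorph0.
    by rewrite rmorphD hu hv addr0.
  by rewrite rmorphM hv mulr0.
- by apply/eqP; rewrite /= rmorph1 oner_eq0.
pose R : set (K * K) := [set z | exists u : eqv_alg, z = (h u, u x)].
have hR : partial_hom (sc_emb K) (da_struct K) [set 0] R.
  split.
  - by move=> c; exists (da_struct eqv_alg c); rewrite alg_str.
  - by move=> _ _ [u ->] [v ->]; exists (u + v); rewrite rmorphD.
  - by move=> _ _ [u ->] [v ->]; exists (u * v); rewrite rmorphM.
  - by move=> _ ->; exists 0; rewrite rmorph0.
  - by move=> c [u [/esym hu ->]]; exact: xI.
have [g gE] := alg_extend (zero_ideal K) (etale_mod0 (@sc_letale k K)) hR.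
pose g' := Galois (sc_hom_bij g); exists (gp_act (gal_inv g') x).
apply: algHom_eq => u; rewrite /= /eqv_eval_fun eqv_act.
have -> : u x = g' (h u) by apply/esym/gE; exists u.
by rewrite gal_invK.
Qed.

(** By compactness of [X] the stabilizer of [U] is a neighborhood of 1, and a basic neighborhood of
    1 is given by fixing finitely many elements of [K]. *)
Lemma stabilizer_open (U : set X) : clopen U ->
  exists s : seq (sc_field K), forall g : galois K, (forall c, c \in s -> g c = c) ->
    forall x, U (gp_act g x) <-> U x.
Proof.
move=> /clopen_loc_const lU.
have : nbhs (1%g : galois K) [set g : galois K | forall x : X, U (gp_act g x) = U x].
  have /compact_near_coveringP nX := dp_compact (d := X).
  have nP := nX (galois K) (nbhs (1%g : galois K)) (fun g x => U (gp_act g x) = U x)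
    (nbhs_filter (1%g : galois K)).
  apply: filterS (nP _) => [g gU x|x _]; first exact: gU.
  have [[A B] /= [nA nB] AB] := @gp_act_continuous k K X (1%g, x) _ (lU (gp_act 1%g x)).
  exists (B `&` [set y | U y = U x], A) => /=.
    by split=> //; apply: filterI => //; exact: lU.
  move=> [y g] /= [[By ->] Ag]; have := AB (g, y) (conj Ag By).
  by rewrite /= gp_act1.
rewrite nbhsE => -[_ [[W oW <-] W1] VU].
move: oW; rewrite alg_openE => /(_ _ W1)[s [_ sW]]; exists s => g gs x.
suff -> : U (gp_act g x) = U x by [].
apply: VU; apply: sW; apply: alg_eq_on_span => c /gs; exact.
Qed.

End EquivariantFunctions.

(** * Separation of points by equivariant functions *)

Lemma loc_const_filter (X : topologicalType) (T : Type) (P : T -> X -> Prop) (s : seq T) :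
    (forall r, loc_const (P r)) ->
  loc_const (fun x => [seq r <- s | `[< P r x >]]).
Proof.
move=> lP x; elim: s => [|r s IH]; first exact: filterE.
by apply: filterS2 IH (lP r x) => y /= -> ->.
Qed.

Section Separation.
Variables (k : diffField) (K : sepClosure k).

Lemma finite_conjugates (s : seq (sc_field K)) : exists C : seq (seq (sc_field K)),
  forall g : galois K, map g s \in C.
Proof.
elim: s => [|c s [C CP]]; first by exists [:: [::]].
have [p sp pc] := sc_root c; have [rs [_ _ rsE _]] := sc_roots_dvd K sp.
exists [seq z :: t | z <- rs, t <- C] => g; apply: allpairs_f; last exact: CP.
rewrite -[_ \in rs]rsE; have -> : map_poly (sc_emb K) p = map_poly g (map_poly (sc_emb K) p).
  by rewrite -map_poly_comp; apply: eq_map_poly => d /=; rewrite [RHS](alg_str g d).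
exact: rmorph_root.
Qed.

Lemma map_poly_gal1 (q : {poly sc_field K}) : map_poly (1%g : galois K) q = q.
Proof. exact: map_poly_id. Qed.

Lemma map_poly_galM (g h : galois K) (q : {poly sc_field K}) :
  map_poly (g * h)%g q = map_poly g (map_poly h q).
Proof. by rewrite -map_poly_comp. Qed.

Variables (X : gProf K) (U : set X) (s : seq (sc_field K)).
Hypotheses (cU : clopen U)
  (sU : forall g : galois K, (forall c, c \in s -> g c = c) ->
    forall x, U (gp_act g x) <-> U x).

(** The tuple is coded as a polynomial, so that its conjugates can serve as roots of polynomials
    over [{poly sc_field K}]. Trailing zeros are lost, but every [g] fixes them. *)
Let theta := Poly s.

Let theta_fix (g : galois K) : map_poly g theta = theta -> forall x, U (gp_act g x) <-> U x.
Proof.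
move=> gt; apply: sU => c cs; have /(congr1 (fun q : {poly _} => q`_(index c s))) := gt.
by rewrite coef_map coef_Poly nth_index.
Qed.

(** [z] lies in the translate of [U] by some [g] with [g theta = r]. By [theta_fix] this translate
    depends only on [r]. *)
Definition translate (r : {poly sc_field K}) (z : X) : Prop :=
  exists2 g : galois K, map_poly g theta = r & U (gp_act (g^-1)%g z).

Lemma translate_loc_const r : loc_const (translate r).
Proof.
have [[h <-]|N] := pselect (exists h : galois K, map_poly h theta = r); last first.
  move=> z; apply: filterE => w; apply/propext.
  by split=> -[g gE _]; case: N; exists g.
have -> : translate (map_poly h theta) = U \o gp_act (h^-1)%g.
  apply/funext => z; apply/propext; split=> [[g gh Uz]|Uz]; last by exists h.
  rewrite /= -[z]gp_act1 -(mulgV g) -gp_actM mulgA gp_actM; apply/theta_fix => //.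
  by rewrite map_poly_galM gh -map_poly_galM mulVg map_poly_gal1.
apply: loc_const_continuous (clopen_loc_const cU) => z.
apply: (@continuous_comp _ _ _ (fun z : X => ((h^-1)%g : galois K, z))
  (fun gx => gp_act gx.1 gx.2)); last exact: gp_act_continuous.
move=> V [[A B] [/= nA nB] AB]; apply: filterS nB => w Bw; apply: AB; split=> //.
exact: nbhs_singleton nA.
Qed.

Lemma translate_act (g : galois K) r z :
  translate (map_poly g r) (gp_act g z) <-> translate r z.
Proof.
suff imp (h : galois K) q w : translate q w -> translate (map_poly h q) (gp_act h w).
  split; last exact: imp.
  move/(imp (g^-1)%g); rewrite -map_poly_galM -gp_actM mulVg map_poly_gal1.
  by rewrite gp_act1.
move=> [f <- Uw]; exists (h * f)%g; first by rewrite map_poly_galM.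
by rewrite invgM -gp_actM -mulgA mulVg mulg1.
Qed.

Lemma translate_theta z : translate theta z <-> U z.
Proof.
split=> [[g gt]|Uz]; last by exists 1%g; rewrite ?map_poly_gal1 // invg1 gp_act1.
have gt' : map_poly (g^-1)%g theta = theta.
  by rewrite -{1}gt -map_poly_galM mulVg map_poly_gal1.
by move/theta_fix; apply.
Qed.

(** [theta] is a root of [F z] exactly when [z] is in [U], so [F x] and [F y] differ in some
    coefficient. These coefficients are equivariant because [g] maps the root list [T z] onto a
    permutation of [T (gp_act g z)]. *)
Lemma separating_equivariant x y : U x -> ~ U y -> exists u : eqv X, u x <> u y.
Proof.
move=> Ux Uy; have [C0 C0P] := finite_conjugates s.
pose C := undup (map Poly C0).
have CP r z : translate r z -> r \in C.
  move=> [g <- _]; rewrite mem_undup; apply/mapP; exists (map g s) => //.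
  apply/polyP => i; rewrite coef_map !coef_Poly; have [si|si] := ltnP i (size s).
    by rewrite (nth_map 0).
  by rewrite !nth_default ?size_map //; exact: rmorph0.
pose T z := [seq r <- C | `[< translate r z >]].
have TP r z : reflect (translate r z) (r \in T z).
  rewrite mem_filter; apply: (iffP andP) => [[/asboolP]//|rz].
  by split; [exact/asboolP|exact: CP rz].
have lT : loc_const T by apply: loc_const_filter => r; exact: translate_loc_const.
have gT (g : galois K) z : perm_eq [seq map_poly g r | r <- T z] (T (gp_act g z)).
  apply: uniq_perm.
  - by rewrite map_inj_uniq ?filter_uniq ?undup_uniq //; exact: map_poly_inj.
  - by rewrite filter_uniq ?undup_uniq.
  move=> r; apply/mapP/TP => [[q /TP qz ->]|rz]; first exact/translate_act.
  exists (map_poly (g^-1)%g r); last by rewrite -map_poly_galM mulgV map_poly_gal1.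
  by apply/TP/(translate_act g); rewrite -map_poly_galM mulgV map_poly_gal1.
pose F z : {poly {poly sc_field K}} := \prod_(r <- T z) ('X - r%:P).
have lu i j : loc_const (fun z => (F z)`_i`_j).
  by apply: loc_const_comp (fun t =>
    (\prod_(r <- t) ('X - r%:P) : {poly {poly sc_field K}})`_i`_j) lT.
have gF (g : galois K) z : F (gp_act g z) = map_poly (map_poly g) (F z).
  rewrite /F -(perm_big _ (gT g z)) big_map rmorph_prod /=; apply: eq_bigr => r _.
  by rewrite rmorphB /= map_polyX map_polyC.
have gu i j (g : galois K) z : (F (gp_act g z))`_i`_j = g (F z)`_i`_j.
  by rewrite gF !coef_map.
apply: contrapT => /forallNP N; apply: Uy; apply/translate_theta/TP.
rewrite -root_prod_XsubC -/(F y).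
have -> : F y = F x.
  apply/polyP => i; apply/polyP => j; apply/esym; apply: contrapT => xy.
  exact: (N (mk_eqv (@lu i j) (gu i j)) xy).
by rewrite root_prod_XsubC; exact/TP/translate_theta.
Qed.

End Separation.

Section Unit.
Variables (k : diffField) (K : sepClosure k) (X : gProf K).

Lemma eqv_eval_inj : injective (@eqv_eval k K X).
Proof.
move=> x y xy; apply: contrapT => /eqP nxy.
have zX := totally_disconnected_zero_dimensional (dp_compact (d := X))
  (dp_hausdorff (d := X)) (dp_totally_disconnected (d := X)).
have [U [cU Ux Uy]] := zX x y nxy; have [s sU] := stabilizer_open cU.
have [u] := separating_equivariant cU sU Ux Uy; apply.
by have := congr1 (fun h : algHom (eqv_alg X) K => h u) xy.
Qed.

End Unit.

(** * The anti-equivalence *)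

Section Duality.
Variables (k : diffField) (K : sepClosure k).

Section Precomp.
Variables (X Y : gProf K) (f : gProfHom X Y).

Fact eqv_precomp_lc (u : eqv Y) : loc_const (fun x => u (f x)).
Proof. exact: loc_const_continuous (dph_continuous (d := f)) (eqv_loc_const u). Qed.

Fact eqv_precomp_act (u : eqv Y) (g : galois K) x : u (f (gp_act g x)) = g (u (f x)).
Proof. by rewrite gph_act eqv_act. Qed.

Definition eqv_precomp_fun (u : eqv_alg Y) : eqv_alg X :=
  mk_eqv (@eqv_precomp_lc u) (@eqv_precomp_act u).

Fact eqv_precomp_zmod : zmod_morphism eqv_precomp_fun.
Proof. by move=> u v; exact: eqv_eq. Qed.

Fact eqv_precomp_monoid : monoid_morphism eqv_precomp_fun.
Proof. by split=> [|u v]; exact: eqv_eq. Qed.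

Fact eqv_precomp_str c : eqv_precomp_fun (da_struct (eqv_alg Y) c) = da_struct (eqv_alg X) c.
Proof. exact: eqv_eq. Qed.

Definition eqv_precomp_alg := mk_algHom eqv_precomp_zmod eqv_precomp_monoid eqv_precomp_str.

Fact eqv_precomp_sigma u :
  eqv_precomp_alg (da_sigma (eqv_alg Y) u) = da_sigma (eqv_alg X) (eqv_precomp_alg u).
Proof. by apply: eqv_eq => x /=; rewrite dph_sigma. Qed.

Definition eqv_precomp : dalgHom (eqv_let Y) (eqv_let X) := DAlgHom eqv_precomp_sigma.

End Precomp.

Fact eqv_precomp1 (X : gProf K) : eqv_precomp (gph_id X) = dalg_id (eqv_let X).
Proof. by apply: dalgHom_eq => u; exact: eqv_eq. Qed.

Fact eqv_precompM (X Y Z : gProf K) (g : gProfHom Y Z) (f : gProfHom X Y) :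
  eqv_precomp (gph_comp g f) = dalg_comp (eqv_precomp f) (eqv_precomp g).
Proof. by apply: dalgHom_eq => u; exact: eqv_eq. Qed.

Definition eqv_functor : functor (gProf_cat K) (opposite (let_cat k)) :=
  @Functor (gProf_cat K) (opposite (let_cat k)) (@eqv_let k K)
    (fun X Y f => eqv_precomp f) eqv_precomp1
    (fun X Y Z g f => eqv_precompM g f).

Section Gelfand.
Variable A : letAlg k.
Let lA : locally_etale A := @let_etale k A.
Local Notation X := (galois_object K A).

Fact gelfand_lc (a : A) : loc_const (fun h : X => (h : algHom A K) a).
Proof. exact: eval_loc_const. Qed.

Fact gelfand_act (a : A) (g : galois K) (h : X) :
  (gp_act g h : algHom A K) a = g ((h : algHom A K) a).
Proof. by []. Qed.

Definition gelfand_fun (a : A) : eqv_alg X := mk_eqv (@gelfand_lc a) (@gelfand_act a).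

Fact gelfand_zmod : zmod_morphism gelfand_fun.
Proof. by move=> a b; apply: eqv_eq => h; exact: rmorphB. Qed.

Fact gelfand_monoid : monoid_morphism gelfand_fun.
Proof.
by split=> [|a b]; apply: eqv_eq => h; [exact: rmorph1|exact: rmorphM].
Qed.

Fact gelfand_str c : gelfand_fun (da_struct A c) = da_struct (eqv_alg X) c.
Proof. by apply: eqv_eq => h; exact: (alg_str (h : algHom A K)). Qed.

Definition gelfand_alg := mk_algHom gelfand_zmod gelfand_monoid gelfand_str.

Fact gelfand_sigma a : gelfand_alg (da_sigma A a) = da_sigma (eqv_alg X) (gelfand_alg a).
Proof. by apply: eqv_eq => h; apply/esym; exact: (hom_sigmaE lA). Qed.

Definition gelfand : dalgHom A (eqv_let X) := DAlgHom gelfand_sigma.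

Lemma gelfand_inj : injective gelfand.
Proof.
move=> a b ab; apply: (alg_separate (K := K) lA) => h.
exact: (congr1 (fun u : eqv X => u h) ab).
Qed.

Lemma gelfand_surj u : exists a, gelfand a = u.
Proof.
have [||||a _ aE] := @galois_descent k K A lA setT (u : algHom A K -> sc_field K).
- by [].
- by move=> x y xy; apply: algHom_eq => a; exact: xy.
- exact: (eqv_loc_const u).
- by move=> g x; exact: (eqv_act u).
by exists a; apply: eqv_eq => h; apply/esym; exact: aE.
Qed.

End Gelfand.

(** The inverse is returned as data, as [nat_iso] requires; its compatibilities follow by applying
    the injective [f]. *)
Lemma dalg_inverse (A B : diffAlg k) (f : dalgHom A B) : injective f ->
  (forall b, exists a, f a = b) ->
  {g : dalgHom B A | dalg_comp g f = dalg_id A & dalg_comp f g = dalg_id B}.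
Proof.
move=> fI /choice[g gE].
have gB : zmod_morphism g by move=> x y; apply: fI; rewrite rmorphB !gE.
have gM : monoid_morphism g.
  by split=> [|x y]; apply: fI; rewrite ?rmorphM ?rmorph1 !gE.
have gs c : g (da_struct B c) = da_struct A c by apply: fI; rewrite gE alg_str.
have gd x : mk_algHom gB gM gs (da_sigma B x) = da_sigma A (mk_algHom gB gM gs x).
  by apply: fI; rewrite /= dalg_sigma !gE.
exists (DAlgHom gd); apply: dalgHom_eq => x; last exact: gE.
by apply: fI; rewrite /= gE.
Qed.

Section Counit.
Variable X : gProf K.
Local Notation Y := (galois_object K (eqv_let X)).

Definition unit_fun (x : X) : Y := eqv_eval x.

Fact unit_continuous : continuous unit_fun.
Proof.
move=> x U /alg_nbhsP[s [_ sU]].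
have : \forall y \near x, forall u, u \in s -> (u : eqv X) y = u x.
  elim: {sU} s => [|u s IH]; first by apply: filterE.
  apply: filterS2 (eqv_loc_const u x) IH => y uy sy v.
  by rewrite inE => /predU1P[->//|/sy].
apply: filterS => y sy; apply: sU; apply: alg_eq_on_span => u /sy; exact.
Qed.

Fact unit_sigma x : unit_fun (dp_sigma x) = dp_sigma (unit_fun x).
Proof. by apply: hom_sigma_unique => u. Qed.

Fact unit_act g x : unit_fun (gp_act g x) = gp_act g (unit_fun x).
Proof. by apply: algHom_eq => u; exact: eqv_act. Qed.

Definition unit_hom : gProfHom X Y := @GProfHom k K X Y
  (@DiffProfHom X Y unit_fun unit_continuous unit_sigma) unit_act.

End Counit.

Lemma gProf_inverse (X Y : gProf K) (f : gProfHom X Y) : injective f ->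
  (forall y, exists x, f x = y) ->
  {g : gProfHom Y X | gph_comp g f = gph_id X & gph_comp f g = gph_id Y}.
Proof.
move=> fI /choice[g gE].
have gK : cancel f g by move=> x; apply: fI; rewrite gE.
have gc : continuous g.
  exact: compact_inverse_continuous (dp_compact (d := X)) (dp_hausdorff (d := Y))
    (dph_continuous (d := f)) gK gE.
have gs y : g (dp_sigma y) = dp_sigma (g y) by apply: fI; rewrite dph_sigma !gE.
have ga a y : g (gp_act a y) = gp_act a (g y) by apply: fI; rewrite gph_act !gE.
by exists (@GProfHom k K Y X (@DiffProfHom Y X g gc gs) ga); apply: gProfHom_eq.
Qed.

Lemma unit_inj X : injective (unit_hom X).
Proof. exact: eqv_eval_inj. Qed.

Lemma unit_surj X h : exists x, unit_hom X x = h.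
Proof. by have [x ->] := eqv_eval_surj h; exists x. Qed.

Theorem galois_equivalence : is_equivalence (galois_functor K).
Proof.
exists eqv_functor; split; constructor.
  (* In the opposite category [gelfand] points from the double dual of [A] to [A], as the counit
     must. *)
  pose inv (A : letAlg k) := dalg_inverse (@gelfand_inj A) (@gelfand_surj A).
  apply: (@NatIso (opposite (let_cat k)) (opposite (let_cat k))
    (comp_functor eqv_functor (galois_functor K)) (id_functor _)
    (fun A => @gelfand A) (fun A => s2val (inv A))).
  - by move=> A B f; apply: dalgHom_eq => b; apply: eqv_eq => h.
  - by move=> A /=; exact: (s2valP' (inv A)).
  - by move=> A /=; exact: (s2valP (inv A)).
pose inv (X : gProf K) := gProf_inverse (@unit_inj X) (@unit_surj X).
have nat (X Y : gProf K) (f : gProfHom X Y) :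
    gph_comp (galois_hom K (eqv_precomp f)) (unit_hom X) = gph_comp (unit_hom Y) f.
  by apply: gProfHom_eq => x; exact: algHom_eq.
apply: (@NatIso (gProf_cat K) (gProf_cat K)
    (comp_functor (galois_functor K) eqv_functor) (id_functor _)
    (fun X => s2val (inv X)) (fun X => unit_hom X)).
(* Here the component is the inverse of [unit_hom]. Naturality is checked after applying the
   injective [unit_hom Y], at points in the image of [unit_hom X]. *)
- move=> X Y f /=; apply: gProfHom_eq => h; apply: (@unit_inj Y).
  have [x <-] := unit_surj h.
  have iX : s2val (inv X) (unit_hom X x) = x.
    exact: (congr1 (fun f : gProfHom X X => f x) (s2valP (inv X))).
  have iY y : unit_hom Y (s2val (inv Y) y) = y.
    exact: (congr1 (fun f : gProfHom _ _ => f y) (s2valP' (inv Y))).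
  rewrite [LHS](_ : _ = unit_hom Y (f (s2val (inv X) (unit_hom X x)))) // iX.
  rewrite [RHS](_ : _ = unit_hom Y (s2val (inv Y)
    (galois_hom K (eqv_precomp f) (unit_hom X x)))) // iY.
  exact: (congr1 (fun f : gProfHom _ _ => f x) (esym (nat _ _ f))).
- by move=> X /=; exact: (s2valP' (inv X)).
- by move=> X /=; exact: (s2valP (inv X)).
Qed.

(** For the converse, injectivity says that the image of [f] separates the points of the dual of
    [B], so descent finds each [b] in that image. *)
Lemma galois_surj_inj (A B : letAlg k) (f : dalgHom A B) :
  (forall b : B, exists a : A, f a = b) <-> injective (galois_hom K f).
Proof.
split=> [fS x y xy|fI b].
  apply: algHom_eq => b; have [a <-] := fS b.
  exact: (congr1 (fun h : algHom A K => h a) xy).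
have lB : locally_etale B := @let_etale k B.
pose S : set B := [set b | exists a, f a = b].
have SS : subalgebra S.
  split.
  - by move=> c; exists (da_struct A c); rewrite alg_str.
  - by move=> _ _ [x <-] [y <-]; exists (x + y); rewrite rmorphD.
  - by move=> _ _ [x <-] [y <-]; exists (x * y); rewrite rmorphM.
have [|||_ [a <-] aE] := @galois_descent k K B lB S (fun h => h b) SS.
- by move=> x y xy; apply: fI; apply: algHom_eq => a; apply: xy; exists a.
- exact: eval_loc_const.
- by [].
by exists a; apply: (alg_separate (K := K) lB) => h; rewrite aE.
Qed.

(** If [f] is injective, a point of the dual of [A] is a partial homomorphism on the image of [f],
    which extends to [B]. Conversely, elements of [A] are separated by points, all of which factor
    through [f]. *)
Lemma galois_inj_surj (A B : letAlg k) (f : dalgHom A B) :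
  injective f <-> (forall x : galois_object K A, exists y : galois_object K B,
    galois_hom K f y = x).
Proof.
have lA : locally_etale A := @let_etale k A.
have lB : locally_etale B := @let_etale k B.
split=> [fI x|fS a b ab].
  pose R : set (B * K) := [set z | exists a, z = (f a, (x : algHom A K) a)].
  have hR : partial_hom (sc_emb K) (da_struct B) [set 0] R.
    split.
    - by move=> c; exists (da_struct A c); rewrite !alg_str.
    - by move=> _ _ [u ->] [v ->]; exists (u + v); rewrite !rmorphD.
    - by move=> _ _ [u ->] [v ->]; exists (u * v); rewrite !rmorphM.
    - by move=> _ ->; exists 0; rewrite !rmorph0.
    - move=> c [u [/esym fu ->]]; rewrite (fI u 0) ?rmorph0 //.
  have [y yE] := alg_extend (zero_ideal B) (etale_mod0 lB) hR.
  by exists y; apply: algHom_eq => a; apply: yE; exists a.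
apply: (alg_separate (K := K) lA) => x; have [y <-] := fS x.
by rewrite /= ab.
Qed.

End Duality.

(** * Symbolic coding *)

Section Coding.
Variable X : diffProf.
Local Notation sigma := (@dp_sigma X).

Definition generating (T : Type) (c : X -> T) : Prop :=
  forall x y, (forall n, c (iter n sigma x) = c (iter n sigma y)) -> x = y.

Lemma iter_sigma_continuous n : continuous (iter n sigma).
Proof.
elim: n => [|n IH] x; first exact: cvg_id.
by apply: (continuous_comp (IH x)); exact: dp_sigma_continuous.
Qed.

Lemma loc_const_iter (T : Type) (c : X -> T) n :
  loc_const c -> loc_const (fun x => c (iter n sigma x)).
Proof. by move=> lc; exact: (loc_const_continuous (@iter_sigma_continuous n) lc). Qed.

(** Two points with different values of [d] are told apart by [c] at some time. Compactness in [y]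
    bounds this time for fixed [x]; compactness in [x] then makes the bound uniform. *)
Lemma generating_determines (T U : Type) (c : X -> T) (d : X -> U) :
    loc_const c -> generating c -> loc_const d ->
  exists N, forall x y, (forall l, (l <= N)%N -> c (iter l sigma x) = c (iter l sigma y)) ->
    d x = d y.
Proof.
move=> lc gc ld.
have loc x : exists N, forall y,
    (forall l, (l <= N)%N -> c (iter l sigma x) = c (iter l sigma y)) -> d x = d y.
  have := @compact_ind X (fun Z => exists N, forall y, Z y ->
    (forall l, (l <= N)%N -> c (iter l sigma x) = c (iter l sigma y)) -> d x = d y)
    (dp_compact (d := X)); case.
  - by exists 0%N.
  - by move=> Z W ZW [N NW]; exists N => y /ZW; exact: NW.
  - move=> Z W [N NZ] [M MW]; exists (maxn N M) => y [Zy|Wy] xy.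
      by apply: NZ => // l lN; apply: xy; rewrite leq_max lN.
    by apply: MW => // l lM; apply: xy; rewrite leq_max lM orbT.
  - move=> y; have [dxy|dxy] := pselect (d x = d y).
      by exists [set z | d z = d y]; [exact: ld|exists 0%N => z /= ->].
    have [n cn] : exists n, c (iter n sigma x) <> c (iter n sigma y).
      by apply/existsNP => /gc xy; apply: dxy; rewrite xy.
    exists [set z | c (iter n sigma z) = c (iter n sigma y)]; first exact: (loc_const_iter n lc).
    by exists n => z /= cz /(_ n (leqnn n)); rewrite cz => /cn.
  by move=> N NT; exists N => y; exact: NT.
have := @compact_ind X (fun Z => exists N, forall x y, Z x ->
  (forall l, (l <= N)%N -> c (iter l sigma x) = c (iter l sigma y)) -> d x = d y)
  (dp_compact (d := X)); case.
- by exists 0%N.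
- by move=> Z W ZW [N NW]; exists N => x y /ZW; exact: NW.
- move=> Z W [N NZ] [M MW]; exists (maxn N M) => x y [Zx|Wx] xy.
    by apply: NZ => // l lN; apply: xy; rewrite leq_max lN.
  by apply: MW => // l lM; apply: xy; rewrite leq_max lM orbT.
- move=> x; have [N Nx] := loc x.
  exists [set z | d z = d x /\ forall l, (l <= N)%N -> c (iter l sigma z) = c (iter l sigma x)].
    have nN M : \forall z \near x, forall l, (l < M)%N -> c (iter l sigma z) = c (iter l sigma x).
      elim: M => [|M IH]; first by apply: filterE.
      apply: filterS2 IH (loc_const_iter M lc x) => z zM zM' l.
      by rewrite ltnS leq_eqVlt => /predU1P[->//|/zM].
    by apply: filterS2 (ld x) (nN N.+1) => z dz cz; split.
  exists N => z y [dz cz] zy; rewrite dz; apply: Nx => l lN.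
  by rewrite -cz // zy.
by move=> N NT; exists N => x y; exact: NT.
Qed.

Definition itinerary (E : finType) (c : X -> E) (x : X) : full_shift E :=
  fun n => c (iter n sigma x).

Lemma itinerary_continuous (E : finType) (c : X -> E) :
  loc_const c -> continuous (itinerary c).
Proof.
move=> lc x; apply/cvg_sup.
move=> n; move: x.
apply/(@continuousP _ (initial_topology (@^~ n))) => _ [B oB <-].
exact: (loc_const_open _ (loc_const_iter n lc)).
Qed.

Lemma itinerary_sigma (E : finType) (c : X -> E) x :
  itinerary c (sigma x) = dp_sigma (itinerary c x).
Proof. by apply/funext => n; rewrite /itinerary /= /shift_map -iterSr. Qed.

Lemma isomorphic_subshift (E : finType) (c : X -> E) (S : set (full_shift E))
    (cS : closed S) (sS : forall x, S x -> S (dp_sigma x)) :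
    loc_const c -> generating c -> (forall x, S (itinerary c x)) ->
    (forall u, S u -> exists x, itinerary c x = u) ->
  isomorphic (C := diffProf_cat) X (subshift cS sS).
Proof.
move=> lc gc cI cO.
pose f (x : X) : subshift cS sS := SigSub (mem_set (cI x)).
have fc : continuous f.
  apply/continuousP => _ [U oU <-].
  by have /continuousP/(_ U oU) := itinerary_continuous lc.
have fs x : f (dp_sigma x) = dp_sigma (f x).
  by apply: val_inj; rewrite /= itinerary_sigma.
have fI x y : f x = f y -> x = y.
  move=> /(congr1 val) /= xy; apply: gc => n.
  exact: (congr1 (fun u : full_shift E => u n) xy).
have /choice[g gE] (u : subshift cS sS) : exists x, f x = u.
  by have [x xu] := cO _ (set_valP u); exists x; apply: val_inj.
have gK : cancel f g by move=> x; apply: fI; rewrite gE.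
have gc' : continuous g.
  exact: compact_inverse_continuous (dp_compact (d := X))
    (dp_hausdorff (d := subshift cS sS)) fc gK gE.
have gs u : g (dp_sigma u) = dp_sigma (g u) by apply: fI; rewrite fs !gE.
exists (DiffProfHom fc fs), (DiffProfHom gc' gs).
by split; apply: diffProfHom_eq.
Qed.

(** The code of a point is the symbol at coordinate 0 of its image; equivariance recovers the other
    symbols. *)
Lemma isomorphic_coding (E : finType) (S : set (full_shift E))
    (cS : closed S) (sS : forall x, S x -> S (dp_sigma x)) :
    isomorphic (C := diffProf_cat) X (subshift cS sS) ->
  exists c : X -> E, [/\ loc_const c, generating c, forall x, S (itinerary c x) &
    forall u, S u -> exists x, itinerary c x = u].
Proof.
move=> [f [g [gf fg]]].
have gK x : g (f x) = x by exact: (congr1 (fun h : diffProfHom X X => h x) gf).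
have fK u : f (g u) = u.
  exact: (congr1 (fun h : diffProfHom (subshift cS sS) (subshift cS sS) => h u) fg).
pose c (x : X) : E := (val (f x) : full_shift E) 0%N.
have cE x : itinerary c x = val (f x).
  apply/funext => n; rewrite /itinerary /c.
  have -> : forall m, f (iter m sigma x) = iter m (@dp_sigma (subshift cS sS)) (f x).
    by elim=> //= m IH; rewrite dph_sigma IH.
  suff H m : (val (iter n (@dp_sigma (subshift cS sS)) (f x)) : full_shift E) m =
      (val (f x) : full_shift E) (m + n)%N by rewrite H.
  by elim: n m => [|n IH] m; rewrite ?addn0 //= /shift_map IH addSnnS.
exists c; split.
- apply: open_loc_const => e.
  have c0 : open [set u : full_shift E | u 0%N = e].
    have /continuousP/(_ [set e]) := @coord_continuous E 0%N; apply.
    exact: discrete_open.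
  have /continuousP := dph_continuous (d := f).
  move=> /(_ (set_val @^-1` [set u : full_shift E | u 0%N = e])); apply.
  by exists [set u : full_shift E | u 0%N = e].
- move=> x y xy; rewrite -[x]gK -[y]gK; congr (g _); apply: val_inj.
  by rewrite -!cE; apply/funext.
- by move=> x; rewrite cE; exact: set_valP.
- by move=> u Su; exists (g (SigSub (mem_set Su))); rewrite cE fK.
Qed.

(** The finite range of [c] serves as alphabet, and the set of itineraries is closed as the image of
    a compact space. *)
Lemma generating_subshift (T : choiceType) (c : X -> T) :
  loc_const c -> generating c -> is_subshift X.
Proof.
move=> lc gc; have [s cs] := loc_const_finite (dp_compact (d := X)) lc.
pose d x : seq_sub s := SeqSub (cs x).
have ld : loc_const d by move=> x; apply: filterS (lc x) => y cy; exact: val_inj.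
have gd : generating d.
  by move=> x y xy; apply: gc => n; exact: (congr1 val (xy n)).
have cS : closed (range (itinerary d)).
  apply: compact_closed; first exact: (dp_hausdorff (d := full_shift (seq_sub s))).
  apply: continuous_compact; last exact: dp_compact.
  exact/continuous_subspaceT/itinerary_continuous.
have sS u : range (itinerary d) u -> range (itinerary d) (dp_sigma u).
  by move=> [x _ <-]; exists (sigma x) => //; exact: itinerary_sigma.
exists (seq_sub s), (range (itinerary d)), cS, sS.
apply: isomorphic_subshift ld gd _ _; first by move=> x; exists x.
by move=> u [x _ <-]; exists x.
Qed.

(* Sliding blocks of length N + 1 turn a window condition into a graph condition. *)
Lemma window_sft (F : finType) (c : X -> F) (N : nat) (W : (nat -> F) -> Prop) :
    loc_const c -> generating c ->
    (forall u v, (forall l, (l <= N)%N -> u l = v l) -> W u -> W v) ->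
    (forall x i, W (fun l => itinerary c x (i + l)%N)) ->
    (forall u : full_shift F, (forall i, W (fun l => u (i + l)%N)) ->
      exists x, itinerary c x = u) ->
  is_sft X.
Proof.
move=> lc gc WN Wc Wu.
pose ok (w : {ffun 'I_N.+1 -> F}) := `[< W (fun l => w (inord l)) >].
(* Admissible windows are the edges and blocks of length [N] the vertices; the source forgets the
   last symbol, the target the first. For [N = 0] there is a single vertex. *)
pose s (w : {w | ok w}) : {ffun 'I_N -> F} := [ffun l : 'I_N => val w (inord l)].
pose t (w : {w | ok w}) : {ffun 'I_N -> F} := [ffun l : 'I_N => val w (inord l.+1)].
pose win (u : nat -> F) : {ffun 'I_N.+1 -> F} := [ffun l : 'I_N.+1 => u l].
have win_ok u : W u -> ok (win u).
  move=> Wu'; apply/asboolP; apply: WN Wu' => l lN.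
  by rewrite ffunE inordK.
pose d x : {w | ok w} := exist _ (win (itinerary c x)) (win_ok _ (Wc x 0%N)).
have ld : loc_const d.
  move=> x.
  have nN M : \forall z \near x, forall l, (l < M)%N -> c (iter l sigma z) = c (iter l sigma x).
    elim: M => [|M IH]; first by apply: filterE.
    apply: filterS2 IH (loc_const_iter M lc x) => z zM zM' l.
    by rewrite ltnS leq_eqVlt => /predU1P[->//|/zM].
  apply: filterS (nN N.+1) => z zx; apply: val_inj; apply/ffunP => l.
  by rewrite !ffunE; exact: zx.
have dE x n (l : 'I_N.+1) : val (d (iter n sigma x)) l = c (iter (l + n) sigma x).
  by rewrite ffunE /itinerary iterD.
have gd : generating d.
  move=> x y xy; apply: gc => n; have := congr1 (fun w : {w | ok w} => val w ord0) (xy n).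
  by rewrite !dE.
exists {ffun 'I_N -> F}, {w | ok w}, s, t.
apply: isomorphic_subshift ld gd _ _.
  move=> x i; apply/ffunP => l; rewrite !ffunE /itinerary -!iterD.
  have lN : (l.+1 < N.+1)%N by rewrite ltnS.
  by rewrite !inordK ?addSnnS // ltnW.
move=> v vE; pose u n : F := val (v n) ord0.
(* A path is determined by the first symbols of its edges, since consecutive windows overlap. *)
have uE l n : (l <= N)%N -> val (v n) (inord l) = u (n + l)%N.
  elim: l n => [|l IH] n lN.
    by rewrite addn0 (_ : inord 0 = ord0) //; apply: val_inj; rewrite /= inordK.
  have /ffunP/(_ (Ordinal lN)) := vE n; rewrite !ffunE /= => <-.
  by rewrite IH ?addSnnS // ltnW.
have [i|x xu] := Wu u.
  have /asboolP := valP (v i); apply: WN => l lN; exact: uE.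
exists x; apply/funext => n; apply: val_inj; apply/ffunP => l.
rewrite /itinerary dE -[c _]/(itinerary c x (l + n)%N) xu addnC -uE ?inord_val //.
by rewrite -ltnS.
Qed.

End Coding.

(** * Difference polynomials *)

Module DiffPolyTheory.
Import monalg.
Section DiffPolyTheory.
Variables (k : diffField) (n : nat).
Local Notation P := (diff_poly k n).
Local Notation mon := (DiffPoly.mon n).

Definition pmon (m : mon) : P := (<< 1 *g m >> : {malg k[{cmonom (DiffPoly.var n)}]}).
Definition pvar (i : nat) (j : 'I_n) : P := pmon (ucm ((i, j) : DiffPoly.var n)).

Lemma pmonM (m m' : mon) : pmon (mmul m m') = pmon m * pmon m'.
Proof.
rewrite /pmon [RHS]malgM_def [RHS]fgmulUU.
by rewrite mul1r.
Qed.

Lemma pmon1 : pmon mone = 1.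
Proof. by []. Qed.

Lemma sigma_pvar i j : da_sigma P (pvar i j) = pvar i.+1 j.
Proof.
have e : DiffPoly.shift_mon (ucm ((i, j) : DiffPoly.var n)) = ucm ((i.+1, j) : DiffPoly.var n).
  apply/eqP/cmP => -[[|l] j']; rewrite DiffPoly.shift_monE /DiffPoly.shift_exp /=.
    by rewrite cmU.
  by rewrite !cmU.
rewrite [LHS]mmapU /= rmorph1 [X in X * _](_ : _ = 1) // mul1r.
exact: (congr1 pmon e).
Qed.

Lemma diff_poly_ind (S : set P) : subalgebra S -> (forall i j, S (pvar i j)) -> forall f, S f.
Proof.
move=> [Sc SD SM] Sv.
have Sm (m : mon) : S (pmon m).
  have [d] := ubnP (mdeg m); elim: d m => // d IH m md.
  have [->|m1] := eqVneq m mone; first by rewrite pmon1; have := Sc 1; rewrite rmorph1.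
  have [w wm] : exists w, m w != 0%N.
    apply: contrapT => N; case/eqP: m1; apply/eqP/cmP => w; rewrite cm1.
    by apply/eqP; apply: contrapT => /negP mw; apply: N; exists w.
  pose m' := divcm m (ucm w); have mE : m = mmul (ucm w) m'.
    apply/eqP/cmP => v; rewrite cmM divcmE cmU; have [<-|_] := eqVneq w v.
      by rewrite subnKC // lt0n.
    by rewrite subn0.
  rewrite mE pmonM; apply: SM; first by case: (w) => i j; exact: Sv.
  by apply: IH; move: md; rewrite mE mdegM mdegU.
move=> f; rewrite [f]monalgE; apply: big_ind => //.
  by have := Sc 0; rewrite rmorph0.
move=> m _; have := SM _ _ (Sc (f : {malg k[{cmonom _}]})@_m) (Sm m); congr S.
by rewrite [LHS]malgM_def [LHS]fgmulUU mulr1 mul1m.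
Qed.

Section Eval.
Variables (B : comNzRingType) (t : {rmorphism k -> B}) (v : nat -> 'I_n -> B).

Definition mon_eval (m : mon) : B := \prod_(w <- finsupp m) v w.1 w.2 ^+ m w.

Lemma mon_evalEw (m : mon) (d : {fset DiffPoly.var n}) : (finsupp m `<=` d)%fset ->
  mon_eval m = \prod_(w <- d) v w.1 w.2 ^+ m w.
Proof.
move=> le; rewrite /mon_eval (big_fset_incl _ le) //.
by move=> i i_in_d; rewrite -cmE_neq0 negbK => /eqP ->.
Qed.

Fact mon_eval_mmorphism : mmorphism mon_eval.
Proof.
split=> [m1 m2|]; last by rewrite /mon_eval mdom1 big_seq_fset0.
rewrite {1}/mon_eval mdomD.
rewrite (mon_evalEw (fsubsetUl _ (finsupp m2))) (mon_evalEw (fsubsetUr (finsupp m1) _)).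
by rewrite -big_split /=; apply/eq_bigr=> /= i _; rewrite cmM exprD.
Qed.
HB.instance Definition _ := monalg.isMultiplicative.Build _ _ mon_eval mon_eval_mmorphism.

Definition poly_eval : {rmorphism P -> B} := mmap t mon_eval.

Lemma poly_eval_str c : poly_eval (da_struct P c) = t c.
Proof. exact: mmapC. Qed.

Lemma poly_eval_var i j : poly_eval (pvar i j) = v i j.
Proof.
rewrite [LHS]mmapU /= rmorph1 mul1r /mon_eval mdomU big_seq_fset1 cmUU.
by rewrite expr1.
Qed.
End Eval.

Lemma diff_poly_hom (A : diffAlg k) (v : nat -> 'I_n -> A) :
  exists h : algHom P A, forall i j, h (pvar i j) = v i j.
Proof.
have [A1|A1] := eqVneq (1 : A) 0.
  have e := zero_ring_eq A1; pose f (_ : P) : A := 0.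
  have fB : zmod_morphism f by move=> x y; exact: e.
  have fM : monoid_morphism f by split=> [|x y]; exact: e.
  have fs c : f (da_struct P c) = da_struct A c by exact: e.
  by exists (mk_algHom fB fM fs) => i j; exact: e.
pose h := @poly_eval (nonzero_ring A1) (da_struct A) v.
have hs c : h (da_struct P c) = da_struct A c.
  by exact: (@poly_eval_str (nonzero_ring A1) (da_struct A) v c).
by exists (@AlgHom k P A h hs) => i j; exact: (@poly_eval_var (nonzero_ring A1)).
Qed.

End DiffPolyTheory.
End DiffPolyTheory.

(** * Ideals and free difference algebras *)

Section Ideals.
Variable A : comPzRingType.

Lemma ideal_span_is_ideal (S : set A) : is_ideal (ideal_span S).
Proof.
split.
- by move=> I [I0 _ _] _.
- by move=> x y Sx Sy I idI SI; have [_ ID _] := idI; apply: ID; [exact: Sx|exact: Sy].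
- by move=> a x Sx I idI SI; have [_ _ IM] := idI; apply: IM; exact: Sx.
Qed.

Lemma ideal_span_sub (S : set A) : S `<=` ideal_span S.
Proof. by move=> x Sx I _; apply. Qed.

Lemma kernel_ideal (B : comPzRingType) (f : {rmorphism A -> B}) :
  is_ideal [set x | f x = 0].
Proof.
split=> /= [|x y fx fy|a x fx]; first exact: rmorph0.
- by rewrite rmorphD fx fy addr0.
- by rewrite rmorphM fx mulr0.
Qed.
End Ideals.

Section SigmaIdeals.
Variables (k : diffField) (A : diffAlg k).

Lemma ideal_span_sigma (B : seq A) x :
  ideal_span (sigma_orbit B) x -> ideal_span (sigma_orbit B) (da_sigma A x).
Proof.
have [J0 JD JM] := ideal_span_is_ideal (sigma_orbit B).
move=> /(_ [set u | ideal_span (sigma_orbit B) (da_sigma A u)]); apply; first split=> /=.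
- by rewrite rmorph0.
- by move=> u v Ju Jv; rewrite rmorphD; exact: JD.
- by move=> a u Ju; rewrite rmorphM; exact: JM.
move=> _ [b bB [i ->]]; apply: ideal_span_sub; exists b => //; exists i.+1.
by [].
Qed.

Lemma alg_eval_sigma (p : {poly k}) (a : A) :
  da_sigma A (alg_eval p a) = alg_eval (map_poly (df_sigma k) p) (da_sigma A a).
Proof.
rewrite /alg_eval size_map_poly rmorph_sum; apply: eq_bigr => i _.
by rewrite rmorphM rmorphXn da_compat coef_map.
Qed.
End SigmaIdeals.

(** An interface to the difference polynomial ring: the arguments below use only these properties.
    The last clause concerns homomorphisms of algebras, without [sigma], because the homomorphisms
    built later respect it only as a sequence. *)
Definition free_diff_alg (k : diffField) (n : nat) (P : diffAlg k)
    (x : nat -> 'I_n -> P) : Prop :=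
  [/\ forall i j, da_sigma P (x i j) = x i.+1 j,
      forall S : set P, subalgebra S -> (forall i j, S (x i j)) -> forall f, S f &
      forall (A : diffAlg k) (v : nat -> 'I_n -> A),
        exists h : algHom P A, forall i j, h (x i j) = v i j].

Section FreeHoms.
Variables (k : diffField) (K : sepClosure k) (n : nat) (P : diffAlg k).
Variables (x : nat -> 'I_n -> P) (freeP : free_diff_alg x).

Lemma free_sigma i j : da_sigma P (x i j) = x i.+1 j.
Proof. by case: freeP. Qed.

Lemma free_ind (S : set P) : subalgebra S -> (forall i j, S (x i j)) -> forall f, S f.
Proof. by case: freeP => _ + _; apply. Qed.

Lemma free_hom (A : diffAlg k) (v : nat -> 'I_n -> A) :
  exists h : algHom P A, forall i j, h (x i j) = v i j.
Proof. by case: freeP. Qed.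

Lemma free_iter_sigma i j : iter i (da_sigma P) (x 0%N j) = x i j.
Proof. by elim: i => //= i ->; rewrite free_sigma. Qed.

Lemma free_hom_eq (B : diffAlg k) (h h' : algHom P B) :
  (forall i j, h (x i j) = h' (x i j)) -> forall f, h f = h' f.
Proof.
move=> hh'; apply: free_ind => //; split.
- by move=> c /=; rewrite !alg_str.
- by move=> f g /=; rewrite !rmorphD => -> ->.
- by move=> f g /=; rewrite !rmorphM => -> ->.
Qed.

Lemma free_semilinear (A : diffAlg k) (h h' : algHom P A) :
    (forall i j, da_sigma A (h' (x i j)) = h (x i.+1 j)) ->
  forall f, da_sigma A (h' f) = h (da_sigma P f).
Proof.
move=> hh'; apply: (@free_ind [set f | da_sigma A (h' f) = h (da_sigma P f)]).
  split=> /=.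
  - by move=> c; rewrite da_compat !alg_str da_compat.
  - by move=> f g hf hg; rewrite !rmorphD hf hg.
  - by move=> f g hf hg; rewrite !rmorphM hf hg.
by move=> i j; rewrite /= free_sigma.
Qed.

(** Such a sequence replaces the orbit of a point under [hom_sigma], which is defined only on
    homomorphisms from locally étale algebras. *)
Lemma semilinear_chain (H : nat -> algHom P K) :
    (forall i f, sc_sigma K (H i.+1 f) = H i (da_sigma P f)) ->
  forall l i f, H i (iter l (da_sigma P) f) = iter l (sc_sigma K) (H (i + l)%N f).
Proof.
move=> HS; elim=> [|l IH] i f; first by rewrite addn0.
by rewrite iterSr IH -HS addnS -iterSr.
Qed.

(* An intrinsic form of "q only involves the variables sigma^i(x_j) with i <= N". *)
Definition order_le (N : nat) (q : P) : Prop := forall h h' : algHom P K,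
  (forall i j, (i <= N)%N -> h (x i j) = h' (x i j)) -> h q = h' q.

Lemma order_le_subalgebra N : subalgebra [set q | order_le N q].
Proof.
split=> /=.
- by move=> c h h' _; rewrite !alg_str.
- by move=> f g hf hg h h' hh'; rewrite !rmorphD (hf h h') // (hg h h').
- by move=> f g hf hg h h' hh'; rewrite !rmorphM (hf h h') // (hg h h').
Qed.

Lemma order_le_mono N M q : (N <= M)%N -> order_le N q -> order_le M q.
Proof. by move=> NM qN h h' hh'; apply: qN => i j iN; apply: hh'; exact: leq_trans NM. Qed.

Lemma order_le_exists q : exists N, order_le N q.
Proof.
apply: (@free_ind [set q | exists N, order_le N q]) q; last first.
  by move=> i j; exists i => h h'; apply.
split=> /=.
- by move=> c; exists 0%N; have [+ _ _] := order_le_subalgebra 0; apply.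
- move=> f g [N fN] [M gM]; exists (maxn N M).
  have [_ + _] := order_le_subalgebra (maxn N M); apply.
    by apply: order_le_mono fN; exact: leq_maxl.
  by apply: order_le_mono gM; exact: leq_maxr.
- move=> f g [N fN] [M gM]; exists (maxn N M).
  have [_ _] := order_le_subalgebra (maxn N M); apply.
    by apply: order_le_mono fN; exact: leq_maxl.
  by apply: order_le_mono gM; exact: leq_maxr.
Qed.

Lemma order_le_seq (B : seq P) : exists N, forall b, b \in B -> order_le N b.
Proof.
elim: B => [|b B [N BN]]; first by exists 0%N.
have [M bM] := order_le_exists b; exists (maxn N M) => c.
rewrite inE => /predU1P[->|/BN bN]; first by apply: order_le_mono bM; exact: leq_maxr.
by apply: order_le_mono bN; exact: leq_maxl.
Qed.

End FreeHoms.

Lemma diff_poly_free (k : diffField) (n : nat) : free_diff_alg (@DiffPolyTheory.pvar k n).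
Proof.
split.
- exact: DiffPolyTheory.sigma_pvar.
- exact: DiffPolyTheory.diff_poly_ind.
- exact: DiffPolyTheory.diff_poly_hom.
Qed.

(** * Finite generation and finite presentation *)

Section FinitelyGenerated.
Variables (k : diffField) (K : sepClosure k) (A : letAlg k).
Let lA : locally_etale A := @let_etale k A.
Local Notation X := (galois_object K A).

Lemma iter_sc_inj i : injective (iter i (sc_sigma K)).
Proof. by elim: i => [|i IH] // x y /= /sc_sigma_inj/IH. Qed.

Definition val_at (x : X) (a : A) : sc_field K := (x : algHom A K) a.

(** With the injectivity of [sc_sigma K], the symbol seen by a shifted point and the value at an
    iterate of [da_sigma A] determine each other. *)
Lemma val_at_iter i (x : X) a :
  iter i (sc_sigma K) (val_at (iter i (@dp_sigma X) x) a) = val_at x (iter i (da_sigma A) a).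
Proof.
elim: i a => [|i IH] a //; rewrite [in LHS]iterSr [in RHS]iterSr -IH.
congr (iter _ _ _); exact: (hom_sigmaE lA).
Qed.

Definition code (B : seq A) (x : X) : seq (sc_field K) := [seq val_at x b | b <- B].

Lemma code_loc_const B : loc_const (code B).
Proof.
elim: B => [|b B IH]; first by move=> x; apply: (@filterE _ _ (nbhs_filter x)).
exact: (loc_const_comp (fun z => z.1 :: z.2) (loc_const_pair (eval_loc_const lA b) IH)).
Qed.

(** Near each point [c] depends only on the values at finitely many elements of [A]; compactness
    collects these elements. *)
Lemma code_finite (T : Type) (c : X -> T) : loc_const c ->
  exists B, forall x y, code B x = code B y -> c x = c y.
Proof.
move=> lc; have := @compact_ind X (fun U => exists B, forall x y, U x ->
  code B x = code B y -> c x = c y) (dp_compact (d := X)); case.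
- by exists [::].
- by move=> U V UV [B BV]; exists B => x y /UV; exact: BV.
- move=> U V [B BU] [C CV]; exists (B ++ C) => x y; rewrite /code !map_cat.
  move=> UVx /eqP; rewrite eqseq_cat ?size_map // => /andP[/eqP Bxy /eqP Cxy].
  by case: UVx => [/BU|/CV]; apply.
- move=> x; have /alg_nbhsP[s [_ sc]] := lc x.
  exists [set y | code s y = code s x]; first exact: code_loc_const.
  exists s => y z yx yz; rewrite (sc y) ?(sc z) //; apply: alg_eq_on_span => a as_.
    by have /eq_in_map := etrans (esym yz) yx; apply.
  by have /eq_in_map := yx; apply.
by move=> B BT; exists B => x y; exact: BT.
Qed.

(** The elements at which two points agree form a subalgebra, which gives one direction. In the
    other, a subalgebra containing the orbit of [B] separates points, so descent shows that it is
    everything. *)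
Lemma generated_code (B : seq A) :
  (forall S : set A, subalgebra S -> sigma_orbit B `<=` S -> forall a, S a) <->
  generating (code B).
Proof.
split=> [gB x y xy|gB S SS BS a].
  apply: algHom_eq => a; apply: (gB [set a | val_at x a = val_at y a]).
    split.
    - by move=> c; rewrite /val_at /= !alg_str.
    - by move=> u v; rewrite /val_at /= !rmorphD => -> ->.
    - by move=> u v; rewrite /val_at /= !rmorphM => -> ->.
  move=> _ [b bB [i ->]] /=; rewrite -!val_at_iter; congr (iter _ _ _).
  by have /eq_in_map := xy i; apply.
have [|||b Sb bE] := @galois_descent k K A lA S (fun h => h a) SS.
- move=> x y xy; apply: gB => i; apply/eq_in_map => b bB.
  apply: (@iter_sc_inj i); rewrite !val_at_iter; apply: xy; apply: BS.
  by exists b => //; exists i.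
- exact: eval_loc_const.
- by [].
by rewrite (alg_separate (K := K) lA bE).
Qed.

Theorem finitely_generated_subshift :
  finitely_sigma_generated A <-> is_subshift (galois_object K A).
Proof.
split=> [[B /generated_code gB]|[E [S [cS [sS /isomorphic_coding[c [lc gc _ _]]]]]]].
  exact: generating_subshift (@code_loc_const B) gB.
have [B Bc] := code_finite lc; exists B; apply/generated_code => x y xy.
by apply: gc => i; apply: Bc; exact: xy.
Qed.

End FinitelyGenerated.

Section FinitelyPresented.
Variables (k : diffField) (K : sepClosure k) (A : letAlg k).
Let lA : locally_etale A := @let_etale k A.
Local Notation X := (galois_object K A).
Local Notation sigmaX := (@dp_sigma X).

Lemma code_nth (B : seq A) (x y : X) :
  (forall j : 'I_(size B), val_at x B`_j = val_at y B`_j) -> code B x = code B y.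
Proof.
move=> xy; apply/eq_in_map => b /(nthP 0)[j jB <-].
exact: (xy (Ordinal jB)).
Qed.

Section FreePresentation.
Variables (n : nat) (P : diffAlg k) (v : nat -> 'I_n -> P) (freeP : free_diff_alg v).

(** The alphabet consists of the tuples of values at the generators [a j]. The relations [B] have
    order at most some [N], so they constrain windows of length [N + 1]; a sequence meeting all
    these constraints defines a homomorphism that kills [I], hence a point of [X]. *)
Lemma presented_sft (I : set P) (p : dalgHom P A) (B : seq P) :
    (forall b, b \in B -> I b) -> I = ideal_span (sigma_orbit B) ->
    (forall a, exists f, p f = a) -> (forall f, p f = 0 <-> I f) ->
  is_sft X.
Proof.
move=> BI IE pS pK; pose a j : A := p (v 0%N j).
have pE i j : p (v i j) = iter i (da_sigma A) (a j).
  by elim: i => //= i <-; rewrite -dalg_sigma free_sigma.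
pose c (x : X) : {ffun 'I_n -> sc_field K} := [ffun j => val_at x (a j)].
have lc : loc_const c.
  have ca (x y : X) : code (codom a) x = code (codom a) y -> c x = c y.
    move=> /eq_in_map xy; apply/ffunP => j; rewrite !ffunE; apply: xy; exact: codom_f.
  by move=> x; apply: (@filterS _ _ (nbhs_filter x) _ _ _ (code_loc_const (codom a) x)) => y /ca.
have gc : generating c.
  move=> x y xy; apply: algHom_eq => b; have [f <-] := pS b.
  apply: (free_hom_eq freeP (h := alg_comp x p) (h' := alg_comp y p)) => i j.
  rewrite /= pE -[LHS]/(val_at x _) -[RHS]/(val_at y _) -!val_at_iter.
  by have /ffunP/(_ j) := xy i; rewrite !ffunE => ->.
have [s cs] := loc_const_finite (dp_compact (d := X)) lc.
pose d (x : X) : seq_sub s := SeqSub (cs x).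
have ld : loc_const d.
  by move=> x; apply: (@filterS _ _ (nbhs_filter x) _ _ _ (lc x)) => y cy; exact: val_inj.
have gd : generating d by move=> x y xy; apply: gc => i; exact: (congr1 val (xy i)).
have [N BN] := order_le_seq K freeP B.
(* The values on variables of order above [N] are left free; by [BN] they do not affect [h b]. *)
pose W (u : nat -> seq_sub s) := forall h : algHom P K,
  (forall l j, (l <= N)%N -> h (v l j) = iter l (sc_sigma K) (val (u l) j)) ->
  forall b, b \in B -> h b = 0.
have pB b : b \in B -> p b = 0 by move=> bB; apply/pK/BI.
apply: (window_sft (N := N) (W := W) ld gd).
- by move=> u w uw Wu h hw; apply: Wu => l j lN; rewrite uw ?hw.
- move=> x i h hE b bB; pose y : algHom A K := iter i sigmaX x.
  rewrite (BN b bB h (alg_comp y p)); first by rewrite /= pB // rmorph0.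
  move=> l j lN; rewrite hE //= pE -[RHS]/(val_at (iter i sigmaX x) _) -val_at_iter.
  by rewrite ffunE addnC iterD.
move=> u Wu.
have /choice[H HE] i : exists h : algHom P K, forall l j,
    h (v l j) = iter l (sc_sigma K) (val (u (i + l)%N) j).
  exact: (free_hom freeP (A := K) (fun l j => iter l (sc_sigma K) (val (u (i + l)%N) j))).
have HS i f : sc_sigma K (H i.+1 f) = H i (da_sigma P f).
  by apply: (free_semilinear freeP (A := K)) => l j; rewrite !HE addSnnS.
(* [H 0] maps the [i]-th iterate of [b] to the [i]-th iterate of [H i b], which is 0 by the
   constraint on the window at [i]. *)
have HI f : I f -> H 0%N f = 0.
  rewrite IE => /(_ [set f | H 0%N f = 0]); apply; first exact: kernel_ideal.
  move=> _ [b bB [i ->]] /=; rewrite (semilinear_chain HS) add0n.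
  rewrite (Wu i (H i)) //; first by elim: (i) => //= l ->; rewrite rmorph0.
(* The factorization of [H 0] through [p], as a partial homomorphism. *)
pose R : set (A * K) := [set z | exists f, z = (p f, H 0%N f)].
have hR : partial_hom (sc_emb K) (da_struct A) [set 0] R.
  split.
  - by move=> e; exists (da_struct _ e); rewrite !alg_str.
  - by move=> _ _ [f ->] [g ->]; exists (f + g); rewrite !rmorphD.
  - by move=> _ _ [f ->] [g ->]; exists (f * g); rewrite !rmorphM.
  - by move=> _ ->; exists 0; rewrite !rmorph0.
  - by move=> e [f [/esym/pK/HI f0 ->]].
have [y yE] := alg_extend (zero_ideal A) (etale_mod0 lA) hR.
exists (y : X); apply/funext => i; apply: val_inj; apply/ffunP => j.
rewrite ffunE; apply: (@iter_sc_inj _ K i); rewrite val_at_iter -pE.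
transitivity (H 0%N (v i j)); last by rewrite HE add0n.
by apply: yE; exists (v i j).
Qed.

(** Modulo [J], the element [f] is a root of a separable [q], so [h] of its image under [sigma] is a
    root of [q] with twisted coefficients and lies in the image of [sc_sigma K]. Freeness lets [h']
    be prescribed on the variables. *)
Lemma semilinear_shift (J : set P) (h : algHom P K) :
    is_ideal J -> (forall f, J f -> J (da_sigma _ f)) -> etale_mod J ->
    (forall f, J f -> h f = 0) ->
  exists2 h' : algHom P K, forall f, J f -> h' f = 0 &
    forall f, sc_sigma K (h' f) = h (da_sigma _ f).
Proof.
move=> idJ sJ eJ hJ.
have lift f : exists r, sc_sigma K r = h (da_sigma _ f).
  have [q sq Jq] := eJ f; have [rs rsP] := sc_roots K sq.
  have [|r _ ->] := rsP (sc_sigma K) (h (da_sigma _ f)); last by exists r.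
  have e : h (da_sigma _ (alg_eval q f)) = 0 by exact/hJ/sJ.
  rewrite alg_eval_sigma alg_eval_struct in e.
  have := @sc_eval_root k K K idfun (sc_emb K) (fun=> erefl) _ _ e.
  rewrite -map_poly_comp; congr (root _ _); apply: eq_map_poly => c /=.
  by rewrite -[LHS]sc_compat.
have [w wE] : exists w : nat -> 'I_n -> sc_field K, forall l j,
    sc_sigma K (w l j) = h (v l.+1 j).
  have /choice[g gE] := lift; exists (fun l j => g (v l j)) => l j.
  by rewrite gE free_sigma.
have [h' h'E] := free_hom freeP (A := K) w.
have hS : forall f, sc_sigma K (h' f) = h (da_sigma _ f).
  by apply: (free_semilinear freeP (A := K)) => l j; rewrite h'E wE.
exists h' => // f Jf; apply: sc_sigma_inj; rewrite hS rmorph0.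
exact/hJ/sJ.
Qed.

End FreePresentation.
End FinitelyPresented.

Section Presentation.
Variables (k : diffField) (K : sepClosure k) (A : letAlg k).
Let lA : locally_etale A := @let_etale k A.
Local Notation X := (galois_object K A).
Local Notation sigmaX := (@dp_sigma X).
Variables (n : nat) (P : diffAlg k) (v : nat -> 'I_n -> P) (freeP : free_diff_alg v).

Lemma free_dalg_hom (a : 'I_n -> A) :
  exists p : dalgHom P A, forall i j, p (v i j) = iter i (da_sigma A) (a j).
Proof.
have [h hE] := free_hom freeP (fun i j => iter i (da_sigma A) (a j)).
have hS f : h (da_sigma P f) = da_sigma A (h f).
  by apply/esym/(free_semilinear freeP) => i j; rewrite !hE.
by exists (DAlgHom hS).
Qed.

Variables (p : dalgHom P A) (M : nat).

(* Only finitely many values of the variables of order at most M are compatible with the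
   separable polynomials; each one not attained on X is excluded by one element of ker p. *)
Lemma finite_relations : exists B : seq P, [/\ forall b, b \in B -> p b = 0,
    forall j : 'I_n, exists2 q : {poly k}, separable_poly q & alg_eval q (v 0%N j) \in B &
    forall h : algHom P K, (forall b, b \in B -> h b = 0) ->
      exists y : X, forall l j, (l <= M)%N -> val_at y (p (v l j)) = h (v l j)].
Proof.
pose T := ('I_M.+1 * 'I_n)%type; pose w (z : T) : P := v z.1 z.2.
have /choice[q qE] (z : T) : exists q : {poly k}, separable_poly q /\ p (alg_eval q (w z)) = 0.
  by have [q sq q0] := lA (p (w z)); exists q; split=> //; rewrite alg_eval_struct.
have /choice[rs rsE] (z : T) : exists rs : seq (sc_field K),
    forall c : sc_field K, root (map_poly (sc_emb K) (q z)) c -> c \in rs.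
  have [rs [_ _ rsE _]] := sc_roots_dvd K (qE z).1; exists rs => c.
  by rewrite -[c \in rs]rsE.
pose rt := flatten [seq rs z | z : T].
have rtE (h : algHom P K) z : h (alg_eval (q z) (w z)) = 0 -> h (w z) \in rt.
  rewrite alg_eval_struct => e; apply/flattenP; exists (rs z); first exact: codom_f.
  by apply: rsE; exact: (@sc_eval_root k K K idfun (sc_emb K) (fun=> erefl) _ _ e).
have /choice[b bE] (u : {ffun T -> seq_sub rt}) : exists b : P, p b = 0 /\
    forall h : algHom P K, (forall z, h (w z) = val (u z)) -> h b = 0 ->
      exists y : X, forall z, val_at y (p (w z)) = val (u z).
  have [[h0 h0E]|N] := pselect (exists h : algHom P K, forall z, h (w z) = val (u z)); last first.
    by exists 0; rewrite rmorph0; split=> // h hE; case: N; exists h.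
  (* Either some [f] of order at most [M] in the kernel of [p] rules out the assignment [u], or [h0]
     on polynomials of order at most [M] factors through [p] and extends to a point. *)
  have [[f [oM pf hf]]|N] := pselect (exists f, [/\ order_le K v M f, p f = 0 & h0 f <> 0]).
    exists f; split=> // h hE hf0; case: hf; rewrite -hf0; apply: oM => i j iM.
    by have := h0E (Ordinal (iM : (i < M.+1)%N), j); rewrite -hE.
  exists 0; split=> [|h _ _]; first by rewrite rmorph0.
  have [Oc OD OM] := order_le_subalgebra K v M.
  pose R : set (A * K) := [set z | exists2 f, order_le K v M f & z = (p f, h0 f)].
  have hR : partial_hom (sc_emb K) (da_struct A) [set 0] R.
    split.
    - by move=> e; exists (da_struct _ e); rewrite ?alg_str //; exact: Oc.
    - by move=> _ _ [f fo ->] [g go ->]; exists (f + g); rewrite ?rmorphD //; exact: OD.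
    - by move=> _ _ [f fo ->] [g go ->]; exists (f * g); rewrite ?rmorphM //; exact: OM.
    - move=> _ ->; exists (da_struct P 0); first exact: Oc.
      by rewrite !alg_str !rmorph0.
    - move=> e [f fo [/esym pf ->]]; apply: contrapT => hf; apply: N; exists f.
      by split.
  have [y yE] := alg_extend (zero_ideal A) (etale_mod0 lA) hR.
  exists y => z; rewrite -h0E; apply: yE; exists (w z) => // h1 h2; apply.
  by rewrite -ltnS.
exists (codom (fun z : T => alg_eval (q z) (w z)) ++ codom b); split.
- by move=> f; rewrite mem_cat => /orP[] /codomP[z ->]; [exact: (qE z).2|exact: (bE z).1].
- move=> j; exists (q (ord0, j)); first exact: (qE _).1.
  by rewrite mem_cat (codom_f (fun z : T => alg_eval (q z) (w z)) (ord0, j)).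
- move=> h hB.
  have hrt z : h (w z) \in rt.
    by apply: rtE; apply: hB; rewrite mem_cat (codom_f (fun z : T => alg_eval (q z) (w z))).
  pose u : {ffun T -> seq_sub rt} := [ffun z => SeqSub (hrt z)].
  have [||y yE] := (bE u).2 h.
  - by move=> z; rewrite ffunE.
  - by apply: hB; rewrite mem_cat codom_f orbT.
  exists y => l j lM; have := yE (Ordinal (lM : (l < M.+1)%N), j).
  by rewrite ffunE.
Qed.

End Presentation.

Section Converse.
Variables (k : diffField) (K : sepClosure k) (A : letAlg k).
Let lA : locally_etale A := @let_etale k A.
Local Notation X := (galois_object K A).
Local Notation sigmaX := (@dp_sigma X).

(** A homomorphism satisfying the finitely many relations is approximated on each window by a point
    of [X]. The codes of these points form a path in the graph, hence come from one point [x], and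
    [x] induces the given homomorphism. Separation modulo [J] then excludes elements of the kernel
    outside [J]. *)
Lemma sft_presented : is_sft X -> exists n, forall (P : diffAlg k) (v : nat -> 'I_n -> P),
    free_diff_alg v -> exists (p : dalgHom P A) (B : seq P),
  [/\ forall b, b \in B -> p b = 0, forall a, exists f, p f = a &
      forall f, p f = 0 -> ideal_span (sigma_orbit B) f].
Proof.
move=> [V [E [s [t /isomorphic_coding[c [lc gc cI cO]]]]]].
have [B0 B0c] := code_finite lc.
have gB0 : generating (code B0 : X -> _) by move=> x y xy; apply: gc => i; apply: B0c; exact: xy.
have [N NB0] := generating_determines lc gc (@code_loc_const k K A B0).
exists (size B0) => P v freeP.
have [p pE] := @free_dalg_hom k A _ P v freeP (fun j => B0`_j).
(* Order [N.+1] instead of [N] makes the shift by one, needed for the graph condition, available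
   even when [N = 0]. *)
have [B [pB sepB hB]] := @finite_relations k K A _ P v p N.+1; exists p, B.
split=> //.
  have := (generated_code K B0).2 gB0 [set a | exists f, p f = a]; apply.
    split.
    - by move=> d; exists (da_struct P d); rewrite alg_str.
    - by move=> _ _ [f <-] [g <-]; exists (f + g); rewrite rmorphD.
    - by move=> _ _ [f <-] [g <-]; exists (f * g); rewrite rmorphM.
  move=> _ [b /(nthP 0)[j jB <-] [i ->]].
  by exists (v i (Ordinal jB)); rewrite pE.
set J := ideal_span _; move=> f pf; apply: contrapT => Jf.
have idJ : is_ideal J by exact: ideal_span_is_ideal.
have sJ g : J g -> J (da_sigma P g) by exact: ideal_span_sigma.
have BJ b : b \in B -> J b.
  by move=> bB; apply: ideal_span_sub; exists b => //; exists 0%N.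
(* Étale elements modulo [J] form a subalgebra, so variables suffice; applying [sigma] to a
   polynomial relation passes from one variable to the next. *)
have eJ : etale_mod J.
  move=> g; apply: (free_ind freeP (etale_mod_subalgebra K idJ)) g => i j.
  elim: i => [|i [r sr Jr]].
    by have [r sr rB] := sepB j; exists r => //; exact: BJ.
  exists (map_poly (df_sigma k) r); first by rewrite separable_map.
  by rewrite -(free_sigma freeP) -alg_eval_sigma; exact: sJ.
have [h hJ hf] := alg_separate_mod K idJ eJ Jf.
pose Z := {h : algHom P K | forall g, J g -> h g = 0}.
have /choice[shift shiftE] (z : Z) : exists z' : Z, forall g,
    sc_sigma K (sval z' g) = sval z (da_sigma P g).
  have [h' h'J h'E] := semilinear_shift freeP idJ sJ eJ (svalP z).
  by exists (exist _ h' h'J).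
pose H i : algHom P K := sval (iter i shift (exist _ h hJ : Z)).
have HJ i g : J g -> H i g = 0 by exact: svalP (iter i shift _) g.
have HS i g : sc_sigma K (H i.+1 g) = H i (da_sigma P g) by exact: shiftE.
have HE l i j : H i (v l j) = iter l (sc_sigma K) (H (i + l)%N (v 0%N j)).
  by rewrite -(free_iter_sigma freeP) (semilinear_chain HS).
(* The points [y i] are chosen independently; only their codes are related. *)
have /choice[y yE] i : exists y : X, forall l j, (l <= N.+1)%N ->
    val_at y (p (v l j)) = H i (v l j).
  by apply: hB => b /BJ; exact: HJ.
have yS i l (j : 'I_(size B0)) : (l <= N.+1)%N ->
    val_at (iter l sigmaX (y i)) (B0`_j) = H (i + l)%N (v 0%N j) :> sc_field K.
  move=> lN; apply: (@iter_sc_inj _ K l); by rewrite val_at_iter -pE yE.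
have cS i l : (l <= N.+1)%N -> c (iter l sigmaX (y i)) = c (y (i + l)%N).
  move=> lN; apply: B0c; apply: code_nth => j; rewrite yS //.
  by rewrite -[RHS](_ : val_at (iter 0 sigmaX (y (i + l)%N)) B0`_j = _) // yS // addn0.
(* The codes of [y i] and [y i.+1] are adjacent, since the latter is the code of the shift of
   [y i]. *)
have [x xE] : exists x, itinerary c x = fun i => c (y i).
  apply: cO => i; have := cI (y i) 0%N; rewrite /itinerary /= => <-.
  by congr (s _); have := cS i 1%N isT; rewrite addn1 => <-.
have xS i (j : 'I_(size B0)) : val_at (iter i sigmaX x) B0`_j = H i (v 0%N j) :> sc_field K.
  have <- : val_at (iter 0 sigmaX (y i)) B0`_j = H i (v 0%N j) :> sc_field K.
    by rewrite yS // addn0.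
  (* The first [N + 1] symbols of the shifted [x] and of [y i] agree, and [NB0] says that they
     determine the code by [B0]. *)
  have /eq_in_map : code B0 (iter i sigmaX x) = code B0 (y i).
    apply: NB0 => l lN; rewrite cS ?(leq_trans lN) // -iterD addnC.
    exact: (congr1 (fun u : full_shift E => u (i + l)%N) xE).
  by apply; exact: mem_nth.
case/eqP: hf; rewrite (free_hom_eq freeP (h' := alg_comp (x : algHom A K) p)).
  by rewrite /= pf rmorph0.
move=> i j; rewrite /= pE -[RHS]/(val_at x _) -val_at_iter xS.
by rewrite -[LHS]/(H 0%N (v i j)) HE.
Qed.

Theorem finitely_presented_sft :
  finitely_sigma_presented A <-> is_sft (galois_object K A).
Proof.
split=> [[n [I [p [_ [B BI IE] pS pK]]]]|/sft_presented[n nE]].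
  exact: (@presented_sft k K A n _ _ (@diff_poly_free k n) I p B BI IE pS pK).
have [p [B [pB pS pJ]]] := nE _ _ (@diff_poly_free k n).
exists n, [set f | p f = 0], p; split=> //.
- split; first exact: kernel_ideal.
  by move=> f /= pf; rewrite dalg_sigma pf rmorph0.
- exists B => //; apply/seteqP; split=> [f /pJ//|f].
  move=> /(_ [set f | p f = 0]); apply; first exact: kernel_ideal.
  move=> _ [b bB [i ->]] /=; elim: i => [|i IH]; first exact: pB.
  by rewrite /= dalg_sigma IH rmorph0.
Qed.

End Converse.

Theorem theorem5p1 (k : diffField) (K : sepClosure k) :
  is_equivalence (galois_functor K) /\
  (forall (A B : letAlg k) (f : dalgHom A B),
     (forall b : B, exists a : A, f a = b) <-> injective (galois_hom K f)) /\
  (forall (A B : letAlg k) (f : dalgHom A B),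
     injective f <->
     (forall x : galois_object K A, exists y : galois_object K B,
        galois_hom K f y = x)) /\
  (forall A : letAlg k,
     finitely_sigma_generated A <-> is_subshift (galois_object K A)) /\
  (forall A : letAlg k,
     finitely_sigma_presented A <-> is_sft (galois_object K A)).
Proof.
split; first exact: galois_equivalence.
split; first by move=> A B f; exact: galois_surj_inj.
split; first by move=> A B f; exact: galois_inj_surj.
split=> A; first exact: finitely_generated_subshift.
exact: finitely_presented_sft.
Qed.
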